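(* Let $d\ge2$, $\{r_n\}\subset(0,1)$ and $\{s_n\}\subset(1,+\infty)$ with $r_n\to0^+$ and $s_n\to1^+$. Then: (i) (Compactness) If $U\subset\mathbb{R}^d$ is open and bounded and $\{E_n\}$ are measurable with $E_n\subset U$ and $\tilde J^{s_n}_{r_n}(E_n)\le M\beta(r_n,s_n)$ for all $n$, with $M$ independent of $n$, then, up to a subsequence, $\chi_{E_n}\to\chi_E$ strongly in $L^1(\mathbb{R}^d)$ for some measurable $E$ of finite measure with $\mathrm{Per}(E)<+\infty$. (ii) (Lower bound) If $E$ is measurable with finite measure and $\{E_n\}$ are measurable of finite measure with $\chi_{E_n}\to\chi_E$ in $L^1(\mathbb{R}^d)$, then $\omega_{d-1}\mathrm{Per}(E)\le\liminf_{n\to\infty}\frac{\tilde J^{s_n}_{r_n}(E_n)}{\beta(r_n,s_n)}$. (iii) (Upper bound) For every measurable $E$ of finite measure there exist measurable $E_n$ of finite measure with $\chi_{E_n}\to\chi_E$ in $L^1(\mathbb{R}^d)$ and $\omega_{d-1}\mathrm{Per}(E)=\limsup_{n\to\infty}\frac{\tilde J^{s_n}_{r_n}(E_n)}{\beta(r_n,s_n)}$.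
   Context: $k^s_r(t)=r^{-d-s}$ for $0\le t\le r$ and $k^s_r(t)=t^{-d-s}$ for $t>r$; $\tilde J_r^s(E):=\int_E\int_{\mathbb{R}^d\setminus E}k^s_r(|x-y|)\,dy\,dx$ for measurable $E$ of finite measure. $\beta(r,s):=\frac{d+s}{d+1}\frac{r^{1-s}-1}{s-1}+\frac1{d+1}$ for $r\in(0,1)$, $s>1$. $\omega_{d-1}$ is the measure of the unit ball of $\mathbb{R}^{d-1}$; $\mathrm{Per}$ is the De Giorgi perimeter. *)

(* Defs.v *)
From HB Require Import structures.
From mathcomp Require Import all_boot all_order all_algebra.
From mathcomp Require Import all_classical all_reals all_analysis.
Set Implicit Arguments. Unset Strict Implicit. Unset Printing Implicit Defensive.
Import Order.TTheory GRing.Theory Num.Theory.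
Import numFieldNormedType.Exports.
Local Open Scope classical_set_scope.
Local Open Scope ring_scope.

Section Lebesgue_Rd.
Context {R : realType} (d : nat).

(* Euclidean norm and distance on R^d (the library norm on 'rV is the sup norm) *)
Definition eucl_norm (x : 'rV[R]_d) : R := Num.sqrt (\sum_(i < d) x ord0 i ^+ 2).
Definition eucl_dist (x y : 'rV[R]_d) : R := eucl_norm (x - y).

Definition box (a b : 'rV[R]_d) : set 'rV[R]_d :=
  [set x | forall i, a ord0 i < x ord0 i <= b ord0 i].

(* volume of a set that is a box (+oo for sets that are not boxes);
   the empty set gets volume 0 (relevant only for the degenerate case d = 0) *)
Definition boxvol (A : set 'rV[R]_d) : \bar R :=
  if pselect (A = set0) then 0%E else
  ereal_inf [set (\prod_(i < d) Num.max (ab.2 ord0 i - ab.1 ord0 i) 0)%:E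
            | ab in [set ab : 'rV[R]_d * 'rV[R]_d | A = box ab.1 ab.2]].

Lemma boxvol_ge0 A : (0 <= boxvol A)%E.
Proof.
rewrite /boxvol; case: (pselect (A = set0)) => h; first by [].
apply: le_ereal_inf_tmp => _ [ab _ <-]; rewrite lee_fin.
by apply: prodr_ge0 => i _; rewrite le_max lexx orbT.
Qed.

Lemma boxvol0 : boxvol set0 = 0%E.
Proof. by rewrite /boxvol; case: (pselect (set0 = set0)). Qed.

(* the ambient type with the discrete sigma-algebra, used only to build the
   outer measure via the library's mu_ext (countable covers) *)
Definition RdAll := 'rV[R]_d.
HB.instance Definition _ := Pointed.on RdAll.
HB.instance Definition _ := @isMeasurable.Build default_measure_display
  RdAll discrete_measurable discrete_measurable0
  discrete_measurableC discrete_measurableU.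

Definition lebesgue_outer : set 'rV[R]_d -> \bar R :=
  @mu_ext _ RdAll R boxvol.

HB.instance Definition _ := isOuterMeasure.Build R 'rV[R]_d lebesgue_outer
  (@mu_ext0 _ RdAll R boxvol boxvol0 boxvol_ge0)
  (@mu_ext_ge0 _ RdAll R boxvol boxvol_ge0)
  (@le_mu_ext _ RdAll R boxvol)
  (@mu_ext_sigma_subadditive _ RdAll R boxvol boxvol_ge0).

End Lebesgue_Rd.

Section Lebesgue_measure_Rd.
Context {R : realType} (d : nat).
Local Open Scope ereal_scope.

Definition LRd := caratheodory_type (@lebesgue_outer R d).

Definition leb : set LRd -> \bar R := @lebesgue_outer R d.

HB.instance Definition _ := isMeasure.Build _ _ _ leb
  (@caratheodory_measure0 R 'rV[R]_d (@lebesgue_outer R d))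
  (@caratheodory_measure_ge0 R 'rV[R]_d (@lebesgue_outer R d))
  (@caratheodory_measure_sigma_additive R 'rV[R]_d (@lebesgue_outer R d)).

End Lebesgue_measure_Rd.

Section Nonlocal_perimeter.
Context {R : realType} (d : nat).
Local Open Scope ereal_scope.

Definition kern (r s t : R) : R :=
  (if t <= r then r `^ (- (d%:R + s)) else t `^ (- (d%:R + s)))%R.

Definition Jt (r s : R) (E : set (LRd d)) : \bar R :=
  \int[@leb R d]_(x in E) \int[@leb R d]_(y in ~` E) (kern r s (eucl_dist x y))%:E.

Definition beta (r s : R) : R :=
  ((d%:R + s) / (d%:R + 1) * ((r `^ (1 - s) - 1) / (s - 1)) + 1 / (d%:R + 1))%R.

Definition omega_dm1 : \bar R :=
  @lebesgue_outer R d.-1 [set x | (eucl_norm x < 1)%R].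

Definition divergence (phi : 'rV[R]_d -> 'rV[R]_d) (x : 'rV[R]_d) : R :=
  (\sum_(i < d) 'D_(delta_mx ord0 i) (fun y => phi y ord0 i) x)%R.

Definition C1c_field (phi : 'rV[R]_d -> 'rV[R]_d) : Prop :=
  [/\ (forall x, differentiable phi x),
      (forall i j : 'I_d,
         continuous (fun x => 'D_(delta_mx ord0 i) (fun y => phi y ord0 j) x)) &
      compact (closure [set x | phi x != 0%R])].

Definition Per (E : set (LRd d)) : \bar R :=
  ereal_sup [set \int[@leb R d]_(x in E) (divergence phi x)%:E
            | phi in [set phi | C1c_field phi /\ forall x, (eucl_norm (phi x) <= 1)%R]].

Definition L1_conv (En : nat -> set (LRd d)) (E : set (LRd d)) : Prop :=
  (fun n => \int[@leb R d]_x (`| \1_(En n) x - \1_E x |)%:E) @ \oo --> 0.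

End Nonlocal_perimeter.

(* Main.v *)
(* Let V(h) be the measure of {x in E | x + h not in E} and A(t) the integral of V over
   the ball |h| < t. The layer-cake formula writes the energy as the integral over t > r
   of (d + s) t^(-d-s-1) A(t), and beta(r, s) is the same integral of
   t^(d+1) over r < t < 1, divided by d + 1, up to a bounded term; as beta tends to
   infinity, only the behaviour of A(t) / t^(d+1) near t = 0 matters. It is compared with the perimeter
   through the identity int_{|h|<t} (h.v)_+ dh = c t^(d+1) |v|, c = omega_{d-1} / (d+1).
   - A(t) <= c t^(d+1) Per E: test the perimeter with the field
     x |-> int_{|h|<t} h (mean of g on the segment [x - h, x]) dh, g a smooth
     approximation of the indicator of E.
   - If A(t) <= S t^(d+1) for small t then c Per E <= S: for a mollification f of the
     indicator, c t^(d+1) int |Df| <= A(t) + O(t^(d+2)).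
   - V is subadditive, so A(m t) <= m^(d+1) A(t); hence a bound on the energies of E_n
     bounds A at every fixed scale, uniformly in large n, and A(t) depends continuously
     on E in L^1. This gives the lower bound.
   - Compactness: if A is small at a scale, a set is determined up to small measure by
     the grid cells at that scale of which it fills at least half; conclude by a diagonal
     argument. *)
From HB Require Import structures.
From mathcomp Require Import all_boot all_order all_algebra.
From mathcomp Require Import all_classical all_reals all_analysis.
From mathcomp Require Import measurable_realfun ring lra.
Require Import Defs.
Set Implicit Arguments. Unset Strict Implicit. Unset Printing Implicit Defensive.
Import Order.TTheory GRing.Theory Num.Theory.
Import numFieldNormedType.Exports.
Local Open Scope classical_set_scope.
Local Open Scope ring_scope.

(** * Lebesgue measure of boxes and Borel sets *)

Section boxes.
Context {R : realType} (d : nat).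
Implicit Types (a b x : 'rV[R]_d) (A : set 'rV[R]_d).
Local Open Scope ereal_scope.

(** The obstacle is measurability. [LRd] carries the Caratheodory sigma-algebra, and for such a set
    [E] the pairs [(x, h)] with [x + h] in [E] do not visibly form a set of the product
    sigma-algebra, on which Tonelli rests. Estimates are therefore made for Borel sets; [E] is
    replaced at the end by a Borel superset with null difference, which changes neither energy,
    perimeter nor L^1 limits. The constant c needs rotation invariance of a measure defined by
    boxes: by uniqueness of Haar measure a linear isometry multiplies it by a factor, and the factor
    is 1 because the unit ball is preserved. Smoothness enters through one inequality, a global
    quadratic Taylor bound. It is stable under translation, sums and integration in a parameter, so
    convolutions and averaged fields acquire derivatives without any limit under an integral sign;
    test fields are compared with mollified gradients by difference quotients and Fubini. The
    recovery sequence is constant, since A(t) <= c t^(d+1) Per E holds for every Borel set of finite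
    measure and every t > 0. *)

Definition vol a b : R := (\prod_(i < d) Num.max (b ord0 i - a ord0 i) 0)%R.

Lemma vol_ge0 a b : (0 <= vol a b)%R.
Proof. by apply: prodr_ge0 => i _; rewrite le_max lexx orbT. Qed.

Definition halfspace (i : 'I_d) (t : R) : set 'rV[R]_d := [set x | (x ord0 i <= t)%R].

Definition is_box A := A = set0 \/ exists a b, A = box a b.

Lemma boxvol_box_le a b : boxvol (box a b) <= (vol a b)%:E.
Proof.
rewrite /boxvol; case: pselect => h; first by rewrite lee_fin vol_ge0.
by apply: ereal_inf_lbound; exists (a, b).
Qed.

(** Reduces comparisons with [boxvol] to genuine boxes: on any other nonempty set the infimum is
    over the empty set, hence [+oo]. *)
Lemma le_boxvol (m : set 'rV[R]_d -> \bar R) A : m set0 <= 0 ->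
  (forall a b, m (box a b) <= (vol a b)%:E) -> m A <= boxvol A.
Proof.
move=> m0 mbox; rewrite /boxvol; case: pselect => [h|h] /=; first by rewrite h.
by apply: le_ereal_inf_tmp => _ [[a b] /= -> <-]; exact: mbox.
Qed.

Lemma boxvol_lty A : boxvol A < +oo -> is_box A.
Proof.
rewrite /boxvol; case: pselect => [h _|A0]; first by left.
case: (pselect (exists a b, A = box a b)) => [|nbox]; first by right.
rewrite (_ : [set _ | _ in _] = set0) ?ereal_inf0 ?ltxx//.
by rewrite -subset0 => _ [[a b] /= Aab _]; apply: nbox; exists a, b.
Qed.

Lemma lebesgue_outer_le_boxvol A : lebesgue_outer A <= boxvol A.
Proof.
pose F : nat -> set 'rV[R]_d := fun n => if n is 0%N then A else set0.
apply: ereal_inf_lbound; exists F.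
  split=> [i|x Ax]; last by exists 0%N.
  by case: i => [|i].
rewrite (nneseries_split 0%N 1%N) ?add0n; last first.
  by move=> n _; apply: boxvol_ge0.
rewrite big_nat1 eseries0 ?adde0//= => -[|i] // _ _.
by rewrite boxvol0.
Qed.

Lemma lebesgue_outer_box_le a b : lebesgue_outer (box a b) <= (vol a b)%:E.
Proof. exact: le_trans (lebesgue_outer_le_boxvol _) (boxvol_box_le _ _). Qed.

(** A cover with a member of infinite [boxvol] has infinite sum, so only covers by boxes have to be
    tested. *)
Lemma le_lebesgue_outer (m : set 'rV[R]_d -> \bar R) A : m set0 <= 0 ->
  (forall a b, m (box a b) <= (vol a b)%:E) ->
  (forall F : nat -> set 'rV[R]_d, (forall k, is_box (F k)) ->
     A `<=` \bigcup_k F k -> m A <= \sum_(k <oo) boxvol (F k)) ->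
  m A <= lebesgue_outer A.
Proof.
move=> m0 mbox msub; apply: le_ereal_inf_tmp => _ [F [_ AF] <-].
have [[k Fk]|] := pselect (exists k, boxvol (F k) = +oo).
  rewrite (eseries_pinfty _ _ Fk) ?leey// => n _.
  by rewrite -ltNye (lt_le_trans _ (boxvol_ge0 _)).
move=> /forallNP Foo; apply: msub => // k; apply: boxvol_lty.
by rewrite ltey; apply/eqP/Foo.
Qed.

(** Half-open boxes are stable under cutting: [x_i <= t] and its complement leave two half-open
    boxes whose i-th sides add up to the original one, all other sides being unchanged. *)
Lemma boxvol_split (i : 'I_d) t A :
  boxvol (A `&` halfspace i t) + boxvol (A `&` ~` halfspace i t) <= boxvol A.
Proof.
apply: (@le_boxvol (fun X => boxvol (X `&` halfspace i t) +
  boxvol (X `&` ~` halfspace i t))).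
- by rewrite !set0I /= boxvol0 adde0.
- move=> a b.
  pose b' : 'rV[R]_d := (\row_j if j == i then Num.min (b ord0 j) t else b ord0 j)%R.
  pose a' : 'rV[R]_d := (\row_j if j == i then Num.max (a ord0 j) t else a ord0 j)%R.
  have -> : box a b `&` halfspace i t = box a b'.
    apply/seteqP; split => [x [xab /= xt] j|x xab]; rewrite /box/=.
      by rewrite mxE; have := xab j; case: eqP => // -> /andP[-> xb]; rewrite le_min xb.
    split=> /=; last by have := xab i; rewrite mxE eqxx le_min => /and3P[].
    move=> j; have := xab j; rewrite mxE; case: eqP => // ->.
    by rewrite le_min => /and3P[-> ->].
  have -> : box a b `&` ~` halfspace i t = box a' b.
    apply/seteqP; split => [x [xab /negP]|x xab]; rewrite /box/=.
      rewrite -ltNge => xt j; rewrite mxE; have := xab j; case: eqP => // ->.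
      by move=> /andP[ax ->]; rewrite gt_max ax xt.
    split=> /=; last first.
      apply/negP; rewrite -ltNge.
      by have := xab i; rewrite mxE eqxx gt_max => /andP[/andP[]].
    move=> j; have := xab j; rewrite mxE; case: eqP => // ->.
    by rewrite gt_max => /andP[/andP[-> _] ->].
  apply: (le_trans (leeD (boxvol_box_le _ _) (boxvol_box_le _ _))).
  rewrite -EFinD lee_fin /vol !(bigD1 i (P := predT))//= !mxE eqxx.
  set P1 := (\prod_(_ < _ | _) _)%R; set P2 := (\prod_(_ < _ | _) _)%R.
  set P := (\prod_(_ < _ | _) _)%R.
  have -> : P1 = P by apply: eq_bigr => j /negPf ji; rewrite mxE ji.
  have -> : P2 = P by apply: eq_bigr => j /negPf ji; rewrite mxE ji.
  rewrite -mulrDl ler_wpM2r//.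
    by apply: prodr_ge0 => j _; rewrite le_max lexx orbT.
  rewrite /Num.max /Num.min.
  by repeat case: ifPn; rewrite -?leNgt; lra.
Qed.

(** Each member of a cover is cut in two by [boxvol_split], so the two halves of the test set are
    covered at no extra cost. *)
Lemma halfspace_caratheodory (i : 'I_d) t :
  (@lebesgue_outer R d).-caratheodory%mu (halfspace i t).
Proof.
apply: le_caratheodory_measurable => X.
apply: le_ereal_inf_tmp => _ [F [_ XF] <-].
apply: (@le_trans _ _ (\sum_(k <oo) lebesgue_outer (F k `&` halfspace i t) +
  \sum_(k <oo) lebesgue_outer (F k `&` ~` halfspace i t))).
  apply: leeD.
    apply: le_trans (outer_measure_sigma_subadditive _ _).
    by apply: le_outer_measure; rewrite -setI_bigcupl; exact: setSI.
  apply: le_trans (outer_measure_sigma_subadditive _ _).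
  by apply: le_outer_measure; rewrite -setI_bigcupl; exact: setSI.
rewrite -nneseriesD => [|n _ _|n _ _]; rewrite ?outer_measure_ge0//.
apply: lee_nneseries => [k _ _|k _]; first by rewrite adde_ge0// outer_measure_ge0.
by apply: le_trans (boxvol_split i t _); apply: leeD; exact: lebesgue_outer_le_boxvol.
Qed.

End boxes.

(** * Borel sets generated by half-spaces *)

Section borel.
Context {R : realType} (d : nat).

Definition halfspaces : set (set 'rV[R]_d) :=
  [set A | exists i t, A = halfspace i t].

(** A second measurable structure on the same carrier. A map into [BRd] is measurable as soon as its
    coordinates are, which is what sums, differences and pairs of points require. *)
Definition BRd := g_sigma_algebraType halfspaces.

Definition borel (A : set 'rV[R]_d) := measurable (A : set BRd).

Lemma borel_halfspace i t : borel (halfspace i t).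
Proof. by apply: sub_sigma_algebra; exists i, t. Qed.

Lemma borel_measurable (A : set 'rV[R]_d) : borel A -> measurable (A : set (@LRd R d)).
Proof.
apply: smallest_sub; first exact: sigma_algebra_measurable.
by move=> _ [i [t ->]]; exact: halfspace_caratheodory.
Qed.

Lemma measurable_id_BRd : measurable_fun setT (id : @LRd R d -> BRd).
Proof. by move=> _ A mA; rewrite setTI; exact: borel_measurable. Qed.

Lemma measurable_coordB i : measurable_fun setT (fun x : BRd => x ord0 i).
Proof.
apply: (measurability _ (RGenOInfty.measurableE R)) => _ [_ [t ->] <-].
rewrite setTI (_ : _ @^-1` _ = ~` halfspace i t).
  by apply: measurableC; exact: borel_halfspace.
apply/seteqP; split => x /=; rewrite in_itv/= andbT ltNge; first by move/negP.
by move/negP.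
Qed.

Lemma measurable_coord i : measurable_fun setT (fun x : @LRd R d => x ord0 i).
Proof.
exact: (measurableT_comp (measurable_coordB i) measurable_id_BRd).
Qed.

Lemma measurable_to_BRd d' (T : measurableType d') (f : T -> 'rV[R]_d) :
  (forall i, measurable_fun setT (fun x => f x ord0 i)) ->
  measurable_fun setT (f : T -> BRd).
Proof.
move=> mf; have := @measurability _ _ T BRd setT f halfspaces erefl; apply.
move=> _ [_ [i [t ->]] <-]; rewrite setTI.
rewrite (_ : _ @^-1` _ = setT `&` (fun x => f x ord0 i) @^-1` `]-oo, t]).
  exact: mf.
by apply/seteqP; split => x /=; rewrite in_itv //= => -[].
Qed.

Lemma borel_box a b : borel (box a b).
Proof.
rewrite (_ : box a b = \bigcap_(i in [set: 'I_d])
   (~` halfspace i (a ord0 i) `&` halfspace i (b ord0 i))).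
  apply: (@fin_bigcap_measurable _ BRd) => // i _; apply: measurableI.
    by apply: measurableC; exact: borel_halfspace.
  exact: borel_halfspace.
apply/seteqP; split => x.
  move=> xab i _; have /andP[ax xb] := xab i.
  by split => //=; apply/negP; rewrite -ltNge.
move=> xab i; have [/= /negP + ->] := xab i I.
by rewrite -ltNge => ->.
Qed.

(** [U] is the countable union of the boxes it contains among those with rational centre and
    half-width [1 / n.+1]. If such a box contains [x], all its points are within [2 / n.+1] of [x]
    in the sup norm. *)
Lemma borel_open (U : set 'rV[R]_d) : open U -> borel U.
Proof.
move=> oU; pose e (n : nat) : R := n.+1%:R^-1.
pose B (p : 'rV[rat]_d * nat) : set 'rV[R]_d :=
  box (\row_i (ratr (p.1 ord0 i) - e p.2)) (\row_i (ratr (p.1 ord0 i) + e p.2)).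
rewrite (_ : U = \bigcup_p if `[< B p `<=` U >] then B p else set0).
  apply: (@countable_bigcupT_measurable _ BRd) => // p.
  by case: ifPn => // _; exact: borel_box.
apply/seteqP; split => [x Ux|x [p _]]; last by case: ifPn => // /asboolP; apply.
have /nbhs_ballP[r /= r0 xr] := open_nbhs_nbhs (conj oU Ux).
pose n := Num.truncn (2 / r).
have e0 : 0 < e n by rewrite /e invr_gt0 ltr0n.
have enr : 2 * e n < r.
  rewrite /e -ltr_pdivlMl//.
  have : 2 / r < n.+1%:R by rewrite truncnS_gt.
  rewrite ltr_pdivrMr// => h; rewrite ltr_pdivlMl// mulrC.
  by rewrite mulrC ltr_pdivrMr ?ltr0n// mulrC.
have q_ i : {q : rat | x ord0 i - e n < ratr q < x ord0 i + e n}.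
  apply: cid; have /rat_in_itvoo[q] : x ord0 i - e n < x ord0 i + e n by lra.
  by rewrite in_itv /=; exists q.
exists (\row_i projT1 (q_ i), n) => //.
have xB : B (\row_i projT1 (q_ i), n) x.
  by move=> i /=; rewrite !mxE /=; case: (q_ i) => q /= /andP[? ?]; apply/andP; split; lra.
case: ifPn => // /asboolPn[] y yB; apply: xr; split=> // i j.
rewrite ord1; have := yB j; rewrite /= !mxE; case: (q_ j) => q /= /andP[h1 h2] /andP[h3 h4].
by rewrite /ball/= ltr_norml; apply/andP; split; lra.
Qed.

Lemma continuous_measurableB (f : 'rV[R]_d -> R) :
  continuous f -> measurable_fun setT (f : BRd -> R).
Proof.
move=> /continuousP cf.
apply: (measurability _ (RGenOpens.measurableE R)).
move=> _ [_ [a [b ->]] <-]; rewrite setTI; apply: borel_open; apply: cf.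
exact: interval_open.
Qed.

Lemma continuous_measurable (f : 'rV[R]_d -> R) :
  continuous f -> measurable_fun setT (f : @LRd R d -> R).
Proof.
move=> cf; exact: (measurableT_comp (continuous_measurableB cf) measurable_id_BRd).
Qed.

Lemma borelC A : borel A -> borel (~` A). Proof. exact: measurableC. Qed.
Lemma borelI A B : borel A -> borel B -> borel (A `&` B). Proof. exact: measurableI. Qed.
Lemma borelU A B : borel A -> borel B -> borel (A `|` B). Proof. exact: measurableU. Qed.
Lemma borelD A B : borel A -> borel B -> borel (A `\` B). Proof. exact: measurableD. Qed.

End borel.
Arguments borel {R d} A.

(** * Volume of boxes, uniqueness and slicing *)

Section lebesgue_Rd.
Context {R : realType}.
Local Open Scope ereal_scope.

Definition cube d (n : R) : set 'rV[R]_d := box (const_mx (- n)%R) (const_mx n).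

Lemma leb_box_le d a b : @leb R d (box a b) <= (vol a b)%:E.
Proof. exact: lebesgue_outer_box_le. Qed.

Lemma bigcup_cube d : \bigcup_n @cube d n%:R = setT.
Proof.
apply/seteqP; split => // x _.
exists (Num.truncn `|x|).+1 => // i.
have xi : (`|x ord0 i| <= `|x|)%R.
  by rewrite /Num.norm/= mx_normrE; apply: le_trans (le_bigmax _ _ (ord0, i)).
have : (`|x| < (Num.truncn `|x|).+1%:R)%R by rewrite truncnS_gt.
move=> h; have := le_lt_trans xi h.
by rewrite !mxE ltr_norml => /andP[-> /ltW ->].
Qed.

Lemma leb_sigma_finite d : sigma_finite [set: @LRd R d] (@leb R d).
Proof.
exists (fun n => @cube d n%:R); first by rewrite bigcup_cube.
move=> n; split; first by apply: borel_measurable; exact: borel_box.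
exact: le_lt_trans (leb_box_le _ _) (ltry _).
Qed.

HB.instance Definition _ d := Measure_isSigmaFinite.Build _ _ _ (@leb R d)
  (@leb_sigma_finite d).

Definition cons_rv d (p : measurableTypeR R * @LRd R d) : @BRd R d.+1 :=
  (\row_i if unlift ord0 i is Some j then p.2 ord0 j else p.1)%R.

Lemma measurable_cons_rv d : measurable_fun setT (@cons_rv d).
Proof.
apply: measurable_to_BRd => i; rewrite /cons_rv.
case: (unliftP ord0 i) => [j ->|->].
  under eq_fun do rewrite mxE liftK.
  by apply: (measurableT_comp (measurable_coord j)); exact: measurable_snd.
under eq_fun do rewrite mxE unlift_none.
exact: measurable_fst.
Qed.

Definition push_measure d1 d2 (T1 : measurableType d1) (T2 : measurableType d2)
    (m : {measure set T1 -> \bar R}) (f : T1 -> T2)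
    (mf : measurable_fun setT f) : {measure set T2 -> \bar R} :=
  measure_function_pushforward__canonical__measure_function_Measure m mf.

(** The product of a line with the measure one dimension lower. It competes with [leb] in dimension
    [d.+1]: first to bound the measure of boxes from below, later to integrate by slices. *)
Definition slice_leb d : {measure set (@BRd R d.+1) -> \bar R} :=
  push_measure (@lebesgue_measure R \x @leb R d) (@measurable_cons_rv d).

Definition bleb d : {measure set (@BRd R d) -> \bar R} :=
  push_measure (@leb R d) (@measurable_id_BRd R d).

Lemma is_box_borel d (A : set 'rV[R]_d) : is_box A -> borel A.
Proof. by case=> [->|[a [b ->]]]; [exact: measurable0|exact: borel_box]. Qed.

(** Maximality of the outer measure among Borel measures that do not exceed the volume on boxes:
    such a measure is bounded by the sum over any cover. *)
Lemma borel_le_lebesgue_outer d (m : {measure set (@BRd R d) -> \bar R}) :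
  (forall a b, m (box a b) <= (vol a b)%:E) ->
  forall A, borel A -> m A <= leb A.
Proof.
move=> mbox A bA; apply: le_lebesgue_outer => //; first by rewrite measure0.
move=> F bF AF.
apply: (@le_trans _ _ (\sum_(k <oo) m (F k))).
  apply: measure_sigma_subadditive => //.
  by move=> k; exact: is_box_borel.
apply: lee_nneseries => // k _.
by apply: le_boxvol => //; rewrite measure0.
Qed.

Lemma slice_box d a b :
  @slice_leb d (box a b) =
  (Num.max (b ord0 ord0 - a ord0 ord0) 0)%:E *
  leb (box (\row_j a ord0 (lift ord0 j)) (\row_j b ord0 (lift ord0 j)) : set (@LRd R d)).
Proof.
rewrite /slice_leb /= /pushforward (_ : _ @^-1` _ =
  `]a ord0 ord0, b ord0 ord0] `*` box (\row_j a ord0 (lift ord0 j)) (\row_j b ord0 (lift ord0 j))).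
  rewrite product_measure1E//; last by apply: borel_measurable; exact: borel_box.
  rewrite [X in X * _ = _]lebesgue_measure_itv/= lte_fin; congr (_ * _).
  by case: ifPn; rewrite -?leNgt => h; rewrite -?EFinB; congr (_%:E);
    rewrite /Num.max; case: ifPn; rewrite -?leNgt; lra.
apply/seteqP; split => [[x y] xab|[x y] [xab yab]] /=.
  split=> [|j] /=; first by have := xab ord0; rewrite mxE unlift_none/= in_itv.
  by have := xab (lift ord0 j); rewrite !mxE liftK.
move=> i; rewrite mxE; case: (unliftP ord0 i) => [j ->|->].
  by have := yab j; rewrite !mxE.
by move: xab => /=; rewrite in_itv.
Qed.

Lemma vol_recl d (a b : 'rV[R]_d.+1) : vol a b =
  (Num.max (b ord0 ord0 - a ord0 ord0) 0 *
   vol (\row_j a ord0 (lift ord0 j)) (\row_j b ord0 (lift ord0 j)))%R.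
Proof.
by rewrite /vol big_ord_recl; congr (_ * _)%R; apply: eq_bigr => i _; rewrite !mxE.
Qed.

(** Only the lower bound is at stake. By induction [slice_leb] gives a box exactly its volume, and
    maximality of the outer measure places [slice_leb] below [leb]. *)
Lemma leb_box d a b : @leb R d (box a b) = (vol a b)%:E.
Proof.
apply/eqP; rewrite eq_le leb_box_le/=; elim: d a b => [|d IH] a b.
  (* In dimension 0 the space is a point and the empty product is 1; the competitor is the Dirac
     mass. *)
  have -> : box a b = setT by apply/seteqP; split => // x _ [].
  have := @borel_le_lebesgue_outer 0%N (dirac ((0 : 'rV[R]_0)%R : @BRd R 0)) _ setT.
  move=> h; apply: (le_trans _ (h _ _)); last exact: measurableT.
    by rewrite /vol big_ord0 /= /dirac indicE mem_set.
  by move=> {}a {}b; rewrite /vol big_ord0 /= /dirac lee_fin indicE; case: (_ \in _).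
have <- : slice_leb d (box a b) = (vol a b)%:E.
  rewrite slice_box vol_recl EFinM; congr (_ * _).
  by apply/eqP; rewrite eq_le leb_box_le IH.
apply: borel_le_lebesgue_outer; last exact: borel_box.
move=> {}a {}b; rewrite slice_box vol_recl EFinM lee_wpmul2l ?leb_box_le//.
by rewrite lee_fin le_max lexx orbT.
Qed.

Lemma boxI d (a b a' b' : 'rV[R]_d) : box a b `&` box a' b' =
  box (\row_i Num.max (a ord0 i) (a' ord0 i)) (\row_i Num.min (b ord0 i) (b' ord0 i)).
Proof.
apply/seteqP; split => [x [xab xab'] i|x xab].
  by rewrite !mxE gt_max le_min; have /andP[-> ->] := xab i; have /andP[-> ->] := xab' i.
by split=> i; have := xab i; rewrite !mxE gt_max le_min => /andP[/andP[? ?] /andP[? ?]];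
  apply/andP.
Qed.

Definition boxes d : set (set 'rV[R]_d) := [set A | exists a b, A = box a b].

Lemma borelE d : @measurable _ (@BRd R d) = <<s @boxes d >>.
Proof.
apply/seteqP; split; last first.
  apply: smallest_sub; first exact: sigma_algebra_measurable.
  by move=> _ [a [b ->]]; exact: borel_box.
apply: smallest_sub; first exact: smallest_sigma_algebra.
move=> _ [i [t ->]].
rewrite (_ : halfspace i t = \bigcup_n box (const_mx (- n%:R)%R)
   (\row_j if j == i then Num.min n%:R t else n%:R)%R).
  apply: sigma_algebra_bigcup => n; apply: sub_sigma_algebra.
  by do 2 eexists.
apply/seteqP; split => [x xt|x [n _ xn] /=].
  have : (\bigcup_n @cube d n%:R) x by rewrite bigcup_cube.
  move=> [n _ xn]; exists n => // j; have := xn j; rewrite !mxE.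
  by case: eqP => // ->; rewrite le_min => /andP[-> ->].
by have := xn i; rewrite !mxE eqxx le_min => /and3P[].
Qed.

Lemma borel_measure_unique d (m1 m2 : {measure set (@BRd R d) -> \bar R}) :
  (forall a b, m1 (box a b) = m2 (box a b)) ->
  (forall n, m1 (@cube d n%:R) < +oo) ->
  forall A, borel A -> m1 A = m2 A.
Proof.
move=> m12 m1oo A bA.
have := @measure_unique _ _ (@BRd R d) (@boxes d) (fun n => @cube d n%:R) _ _ _ _ m1 m2 _ _ A bA; apply => //.
- exact: borelE.
- by move=> _ _ [a [b ->]] [a' [b' ->]]; rewrite boxI; do 2 eexists.
- by move=> i; do 2 eexists.
- exact: bigcup_cube.
- by move=> _ [a [b ->]]; exact: m12.
Qed.

(** Both measures agree on boxes, which generate the Borel sets and are stable under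
    intersection. *)
Lemma slice_lebE d (A : set 'rV[R]_d.+1) : borel A -> slice_leb d A = leb A.
Proof.
apply: (borel_measure_unique (m2 := @bleb d.+1)) => [a b|n].
  by rewrite slice_box [RHS]leb_box leb_box vol_recl EFinM.
by rewrite slice_box leb_box ltry.
Qed.

End lebesgue_Rd.

(** * Invariance of the Lebesgue measure *)

Lemma tonelli_set d1 d2 (T1 : measurableType d1) (T2 : measurableType d2)
    (R : realType) (m1 : {sigma_finite_measure set T1 -> \bar R})
    (m2 : {sigma_finite_measure set T2 -> \bar R}) (S : set (T1 * T2)) :
  measurable S ->
  (\int[m1]_x m2 [set y | S (x, y)] = \int[m2]_y m1 [set x | S (x, y)])%E.
Proof.
move=> mS.
have mf : measurable_fun [set: T1 * T2] (EFin \o (\1_S : T1 * T2 -> R)).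
  by apply/measurable_EFinP; exact: measurable_indic.
have f0 p : (0 <= (EFin \o (\1_S : T1 * T2 -> R)) p)%E by rewrite /= lee_fin.
have := @fubini_tonelli _ _ _ _ _ m1 m2 _ mf f0.
under eq_integral => x _.
  rewrite (_ : (fun y => _) = (EFin \o \1_[set y | S (x, y)])); last first.
    by apply/funext => y /=; rewrite !indicE; congr ((_ : bool)%:R%:E); apply/idP/idP; rewrite !inE.
  rewrite integral_indic// ?setIT; last first.
    have := measurable_xsection x mS.
    by rewrite (_ : xsection S x = [set y | S (x, y)])//; apply/seteqP; split => y; rewrite /xsection/= inE.
  over.
move=> ->; apply: eq_integral => y _.
rewrite (_ : (fun x => _) = (EFin \o \1_[set x | S (x, y)])); last first.
  by apply/funext => x /=; rewrite !indicE; congr ((_ : bool)%:R%:E); apply/idP/idP; rewrite !inE.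
rewrite integral_indic ?setIT//.
have := measurable_ysection y mS.
by rewrite (_ : ysection S y = [set x | S (x, y)])//; apply/seteqP; split => x; rewrite /ysection/= inE.
Qed.

Section invariance.
Context {R : realType} (d : nat).
Local Open Scope ereal_scope.
Local Notation leb := (@leb R d).

Lemma lebesgue_outer_preimage_le (f : 'rV[R]_d -> 'rV[R]_d) (k : R) : (0 < k)%R ->
  (forall a b, lebesgue_outer (f @^-1` box a b) <= (k * vol a b)%:E) ->
  forall A, lebesgue_outer (f @^-1` A) <= k%:E * lebesgue_outer A.
Proof.
move=> k0 fbox A; rewrite -lee_pdivrMl//.
apply: (@le_lebesgue_outer _ _ (fun A => (k^-1)%:E * lebesgue_outer (f @^-1` A))).
- by rewrite preimage_set0 outer_measure0 mule0.
- by move=> a b; rewrite lee_pdivrMl.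
- move=> F bF AF; rewrite lee_pdivrMl//.
  apply: (@le_trans _ _ (\sum_(i <oo) lebesgue_outer (f @^-1` F i))).
    apply: le_trans (outer_measure_sigma_subadditive _ _).
    by apply: le_outer_measure; rewrite -preimage_bigcup; exact: preimage_subset.
  rewrite -nneseriesZl; last by move=> *; exact: boxvol_ge0.
  apply: lee_nneseries => [i _ _|i _]; first by rewrite outer_measure_ge0.
  rewrite -lee_pdivrMl//.
  apply: (@le_boxvol _ _ (fun A => (k^-1)%:E * lebesgue_outer (f @^-1` A))).
    by rewrite preimage_set0 outer_measure0 mule0.
  by move=> a b; rewrite lee_pdivrMl.
Qed.

Variables (f g : 'rV[R]_d -> 'rV[R]_d) (k : R).
Hypotheses (k0 : (0 < k)%R) (fK : cancel f g) (gK : cancel g f).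
Hypothesis fbox : forall a b, lebesgue_outer (f @^-1` box a b) <= (k * vol a b)%:E.
Hypothesis gbox : forall a b, lebesgue_outer (g @^-1` box a b) <= (k^-1 * vol a b)%:E.

(** The one-sided bound is used for [f] and for its inverse, whose factor is [k^-1]. *)
Lemma lebesgue_outer_preimage A : lebesgue_outer (f @^-1` A) = k%:E * lebesgue_outer A.
Proof.
apply/eqP; rewrite eq_le lebesgue_outer_preimage_le//= -lee_pdivlMl//.
have := @lebesgue_outer_preimage_le g (k^-1)%R _ gbox (f @^-1` A).
rewrite (_ : g @^-1` (f @^-1` A) = A); first by apply; rewrite invr_gt0.
by apply/seteqP; split => x /=; rewrite gK.
Qed.

(** Every test set is a preimage under the bijection [f], and [f] scales the outer measure of all
    sets, so the Caratheodory equality is transported. *)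
Lemma measurable_fun_caratheodory : measurable_fun setT (f : LRd d -> LRd d).
Proof.
move=> _ A mA; rewrite setTI.
suff : (@lebesgue_outer R d).-caratheodory%mu (f @^-1` A) by [].
move=> X.
have -> : X = f @^-1` (g @^-1` X) by apply/seteqP; split => x /=; rewrite fK.
rewrite preimage_setC -!preimage_setI.
rewrite !lebesgue_outer_preimage -ge0_muleDr ?outer_measure_ge0//.
by congr (_ * _); exact: mA.
Qed.

Lemma ge0_integral_preimage (F : LRd d -> \bar R) :
  measurable_fun setT F -> (forall x, 0 <= F x) ->
  \int[leb]_x F (f x) = k%:E * \int[leb]_x F x.
Proof.
move=> mF F0.
have := @ge0_integral_pushforward _ _ (LRd d) (LRd d) R f measurable_fun_caratheodory
  leb setT F measurableT mF (fun x _ => F0 x).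
rewrite preimage_setT => <-.
have k0' := ltW k0.
rewrite -(@ge0_integral_mscale _ _ _ leb setT measurableT (NngNum k0') F) //.
apply: eq_measure_integral => [|? A mA _]; first exact: measurable_fun_caratheodory.
by rewrite /pushforward /mscale/=; exact: lebesgue_outer_preimage.
Qed.

End invariance.

(** * Translations and dilations *)

Section translation_scaling.
Context {R : realType} (d : nat).
Local Open Scope ereal_scope.
Implicit Types (h : 'rV[R]_d) (A : set 'rV[R]_d).

Lemma translate_box h a b :
  lebesgue_outer ((fun x : 'rV[R]_d => x + h)%R @^-1` box a b) <= (1 * vol a b)%:E.
Proof.
rewrite mul1r (_ : _ @^-1` _ = box (a - h) (b - h))%R.
  apply: (le_trans (lebesgue_outer_box_le _ _)); rewrite lee_fin /vol.
  under eq_bigr do rewrite !mxE.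
  rewrite le_eqVlt; apply/orP; left; apply/eqP; apply: eq_bigr => i _.
  by congr Num.max; ring.
apply/seteqP; split => x xab i; have := xab i; rewrite !mxE.
  by rewrite ltrBlDr lerBrDr.
by rewrite ltrBlDr lerBrDr.
Qed.

Lemma leb_translate h A : leb ((fun x : LRd d => (x + h)%R : LRd d) @^-1` A) = leb A.
Proof.
rewrite -[RHS]mul1e.
apply: (@lebesgue_outer_preimage _ _ (fun x : 'rV[R]_d => x + h)%R (fun x => x - h)%R 1).
- by [].
- by move=> x; rewrite subrK.
- exact: translate_box.
- by move=> a b; rewrite invr1; exact: translate_box.
Qed.

Lemma ge0_integral_translate h (F : LRd d -> \bar R) :
  measurable_fun setT F -> (forall x, 0 <= F x) ->
  \int[@leb R d]_x F (x + h)%R = \int[@leb R d]_x F x.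
Proof.
move=> mF F0; rewrite -[RHS]mul1e.
apply: (@ge0_integral_preimage _ _ (fun x : 'rV[R]_d => x + h)%R (fun x => x - h)%R 1) => //.
- by move=> x; rewrite addrK.
- by move=> x; rewrite subrK.
- exact: translate_box.
- by move=> a b; rewrite invr1; exact: translate_box.
Qed.

Lemma scale_box (t : R) a b : (0 < t)%R ->
  lebesgue_outer ((fun x : 'rV[R]_d => t *: x)%R @^-1` box a b) <= (t ^- d * vol a b)%:E.
Proof.
move=> t0; rewrite (_ : _ @^-1` _ = box (t^-1 *: a) (t^-1 *: b))%R.
  apply: (le_trans (lebesgue_outer_box_le _ _)); rewrite lee_fin /vol.
  rewrite -exprVn -[X in (_ <= _ ^+ X * _)%R](card_ord d) -prodr_const -big_split/=.
  rewrite le_eqVlt; apply/orP; left; apply/eqP; apply: eq_bigr => i _.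
  by rewrite !mxE -mulrBr maxr_pMr ?invr_ge0 ?(ltW t0)// mulr0.
apply/seteqP; split => x xab i; have := xab i; rewrite !mxE.
  by rewrite ltr_pdivrMl// ler_pdivlMl.
by rewrite ltr_pdivrMl// ler_pdivlMl.
Qed.

Let scaleK (t : R) : (0 < t)%R -> cancel (fun x : 'rV[R]_d => t *: x)%R (fun x => t^-1 *: x)%R.
Proof. by move=> t0 x; rewrite scalerA mulVf ?gt_eqF// scale1r. Qed.

Let scaleKV (t : R) : (0 < t)%R -> cancel (fun x : 'rV[R]_d => t^-1 *: x)%R (fun x => t *: x)%R.
Proof. by move=> t0 x; rewrite scalerA mulfV ?gt_eqF// scale1r. Qed.

Let scale_boxV (t : R) : (0 < t)%R -> forall a b, lebesgue_outer ((fun x : 'rV[R]_d => t^-1 *: x)%R @^-1` box a b)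
   <= ((t ^- d)^-1 * vol a b)%:E.
Proof.
move=> t0 a b; rewrite -exprVn; apply: scale_box; by rewrite invr_gt0.
Qed.

Lemma leb_scale (t : R) A : (0 < t)%R ->
  leb ((fun x : LRd d => (t *: x)%R : LRd d) @^-1` A) = (t ^- d)%:E * leb A.
Proof.
move=> t0.
apply: (@lebesgue_outer_preimage _ _ (fun x : 'rV[R]_d => t *: x)%R (fun x => t^-1 *: x)%R).
- by rewrite invr_gt0 exprn_gt0.
- exact: scaleKV.
- by move=> a b; exact: scale_box.
- exact: scale_boxV.
Qed.

Lemma measurable_scale (t : R) : (0 < t)%R ->
  measurable_fun setT (fun x : LRd d => (t *: x)%R : LRd d).
Proof.
move=> t0.
apply: (@measurable_fun_caratheodory _ _ (fun x : 'rV[R]_d => t *: x)%R (fun x => t^-1 *: x)%R (t ^- d)).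
- by rewrite invr_gt0 exprn_gt0.
- exact: scaleK.
- exact: scaleKV.
- by move=> a b; exact: scale_box.
- exact: scale_boxV.
Qed.

Lemma ge0_integral_scale (t : R) (F : LRd d -> \bar R) : (0 < t)%R ->
  measurable_fun setT F -> (forall x, 0 <= F x) ->
  \int[@leb R d]_x F (t *: x)%R = (t ^- d)%:E * \int[@leb R d]_x F x.
Proof.
move=> t0 mF F0.
apply: (@ge0_integral_preimage _ _ (fun x : 'rV[R]_d => t *: x)%R (fun x => t^-1 *: x)%R) => //.
- by rewrite invr_gt0 exprn_gt0.
- exact: scaleK.
- exact: scaleKV.
- by move=> a b; exact: scale_box.
- exact: scale_boxV.
Qed.

End translation_scaling.


Lemma muleIr (R : realType) (a b c : \bar R) :
  (0 < c < +oo -> a * c = b * c -> a = b)%E.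
Proof.
case: c => [c| |]//=; rewrite ?ltxx ?andbF//= lte_fin ltry andbT => c0.
move=> /(congr1 (fun z => z * (c^-1)%:E)%E).
by rewrite -!muleA -EFinM mulfV ?gt_eqF// !mule1.
Qed.

(** * Uniqueness of Haar measure for additive bijections *)

Section haar.
Context {R : realType} (d : nat).
Local Open Scope ereal_scope.
Local Notation L := (@LRd R d).
Implicit Types (A B : set 'rV[R]_d).

Lemma measurable_preimage_borel d' (T : measurableType d') (f : T -> 'rV[R]_d) A :
  borel A -> (forall i, measurable_fun setT (fun x => f x ord0 i)) ->
  measurable (f @^-1` A).
Proof. by move=> bA /measurable_to_BRd/(_ measurableT _ bA); rewrite setTI. Qed.

Lemma integral_if_cst d' (T : measurableType d') (m : {measure set T -> \bar R})
  (D : set T) (c : \bar R) (F : T -> \bar R) : measurable D -> 0 <= c ->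
  (forall x, D x -> F x = c) -> (forall x, ~ D x -> F x = 0) ->
  \int[m]_x F x = c * m D.
Proof.
move=> mD c0 Fc F0; rewrite (_ : F = (cst c) \_ D); last first.
  apply/funext => x; rewrite patchE; case: ifPn; rewrite ?inE => xD; first exact: Fc.
  by apply: F0; move: xD; rewrite notin_setE.
by rewrite -integral_mkcond integral_cst.
Qed.

Variables (O P : 'rV[R]_d -> 'rV[R]_d).
Hypothesis OB : forall x y, O (x - y)%R = (O x - O y)%R.
Hypothesis PK : cancel P O.
Hypothesis mO : forall i, measurable_fun setT (fun x : L => O x ord0 i).

(* Haar uniqueness: evaluate the double integral of 1_A(Ox) 1_B(Ox + y) in both orders *)
Lemma haar A B : borel A -> borel B ->
  @leb R d (O @^-1` A) * @leb R d B =
  @leb R d ((fun x => - x)%R @^-1` A) * @leb R d (O @^-1` B).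
Proof.
move=> bA bB.
have mpre C : borel C -> measurable (O @^-1` C : set (L)).
  by move=> bC; exact: measurable_preimage_borel.
have m1 i : measurable_fun setT (fun p : L * L => O p.1 ord0 i).
  by apply: (measurableT_comp (mO i)); exact: measurable_fst.
have m2 i : measurable_fun setT (fun p : L * L => p.2 ord0 i).
  by apply: (measurableT_comp (measurable_coord i)); exact: measurable_snd.
pose S : set (L * L) := [set p | A (O p.1) /\ B (O p.1 + p.2)%R].
pose S' : set (L * L) := [set p | A (O p.1 - p.2)%R /\ B (O p.1)].
have mS : measurable S.
  apply: (@measurableI _ (L * L)%type [set p : L * L | A (O p.1)] [set p : L * L | B (O p.1 + p.2)%R]).
    exact: (@measurable_preimage_borel _ _ (fun p : L * L => O p.1)).
  apply: (@measurable_preimage_borel _ _ (fun p : L * L => O p.1 + p.2)%R) => // i.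
  by under eq_fun do rewrite mxE; apply: measurable_funD.
have mS' : measurable S'.
  apply: (@measurableI _ (L * L)%type [set p : L * L | A (O p.1 - p.2)%R] [set p : L * L | B (O p.1)]).
    apply: (@measurable_preimage_borel _ _ (fun p : L * L => O p.1 - p.2)%R) => // i.
    by under eq_fun do rewrite !mxE; apply: measurable_funB.
  exact: (@measurable_preimage_borel _ _ (fun p : L * L => O p.1)).
transitivity (\int[@leb R d]_x @leb R d [set y | S (x, y)]).
  rewrite muleC; symmetry; apply: integral_if_cst => //; first exact: mpre.
  - move=> x /= OxA; rewrite -[RHS](leb_translate (O x)); congr (leb _).
    by apply/seteqP; split => y /=; rewrite addrC; [case|split].
  - by move=> x /= OxA; rewrite (_ : [set _ | _] = set0) ?measure0//; apply/seteqP; split => y //= -[].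
rewrite tonelli_set//.
(* Translation by [- P y] turns [O x] into [O x - y], which carries the section of [S] at [y] to
   that of [S']. *)
transitivity (\int[@leb R d]_y @leb R d [set x | S' (x, y)]).
  apply: eq_integral => y _.
  rewrite -[LHS](leb_translate (- P y)); congr (leb _).
  by apply/seteqP; split => x; rewrite /S /S' /= OB PK subrK.
rewrite -tonelli_set//; apply: integral_if_cst => //; first exact: mpre.
- move=> x /= OxB.
  rewrite -[LHS](leb_translate (O x)); congr (leb _).
  by apply/seteqP; split => y; rewrite /S' /= opprD addrCA subrr addr0; [case|split].
- by move=> x /= OxA; rewrite (_ : [set _ | _] = set0) ?measure0//; apply/seteqP; split => y //= -[].
Qed.

End haar.

(** * Balls and invariance under isometries *)

Section isometry.
Context {R : realType} (d : nat).
Local Open Scope ereal_scope.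
Local Notation L := (@LRd R d).
Implicit Types (A B : set 'rV[R]_d).

Definition nsq (x : 'rV[R]_d) : R := (\sum_(i < d) x ord0 i ^+ 2)%R.

Lemma leb_cube_gt0 (n : R) : (0 < n)%R -> 0 < @leb R d (@cube R d n) < +oo.
Proof.
move=> n0; rewrite leb_box ltry andbT lte_fin /vol; apply: prodr_gt0 => i _.
by rewrite !mxE opprK lt_max addr_gt0.
Qed.

(** The Haar identity with [O = id], tested against a cube, whose finite positive measure
    cancels. *)
Lemma leb_opp_borel A : borel A -> @leb R d ((fun x => - x)%R @^-1` A) = @leb R d A.
Proof.
move=> bA; have c0 := leb_cube_gt0 ltr01.
have := @haar R d id id (fun _ _ => erefl) (fun _ => erefl) (@measurable_coord R d) A
  (@cube R d 1) bA (borel_box _ _).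
by move=> /esym; exact: muleIr.
Qed.

Lemma nsq_ge0 x : (0 <= nsq x)%R. Proof. by apply: sumr_ge0 => i _; exact: sqr_ge0. Qed.

Lemma measurable_nsq d' (T : measurableType d') (f : T -> 'rV[R]_d) :
  (forall i, measurable_fun setT (fun x => f x ord0 i)) ->
  measurable_fun setT (fun x => nsq (f x)).
Proof.
move=> mf; apply: measurable_sum => i; exact: measurable_funX.
Qed.

(** The open Euclidean ball without square roots. Only [t ^+ 2] enters, so it agrees with the set of
    points of norm less than [t] for [t > 0] only. *)
Definition ball2 (t : R) : set 'rV[R]_d := [set x | (nsq x < t ^+ 2)%R].

Lemma borel_ball2 t : borel (ball2 t).
Proof.
pose s : R := (t ^+ 2)%R.
have := measurable_nsq (@measurable_coordB R d).
move=> /(_ measurableT `]-oo, s[%classic (measurable_itv _)).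
by rewrite setTI.
Qed.

Lemma ball2_cube t : (0 < t)%R -> ball2 t `<=` @cube R d t.
Proof.
move=> t0 x xt i; rewrite !mxE; have : (x ord0 i ^+ 2 < t ^+ 2)%R.
  by apply: le_lt_trans xt; rewrite /nsq (bigD1 i)//= lerDl; apply: sumr_ge0 => j _; exact: sqr_ge0.
rewrite -(real_normK (num_real (x ord0 i))) ltr_pXn2r ?nnegrE ?normr_ge0 ?(ltW t0)//.
by rewrite ltr_norml => /andP[-> /ltW].
Qed.

(** The half-side [t / d.+1] gives [nsq x <= d t^2 / (d+1)^2 < t^2], strictly even when [d = 0]. *)
Lemma cube_ball2 t : (0 < t)%R -> @cube R d (t / d.+1%:R) `<=` ball2 t.
Proof.
move=> t0 x xt; have d0 : (0 < d.+1%:R :> R)%R by rewrite ltr0n.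
rewrite /ball2/=; apply: (@le_lt_trans _ _ (\sum_(i < d) (t / d.+1%:R) ^+ 2)%R).
  apply: ler_sum => i _; have := xt i; rewrite !mxE => /andP[h1 h2].
  rewrite -(real_normK (num_real (x ord0 i))) ler_pXn2r ?nnegrE ?normr_ge0 ?divr_ge0 ?(ltW t0)//.
  by rewrite ler_norml h2 ltW.
rewrite sumr_const card_ord expr_div_n -[X in (X < _)%R]mulr_natl mulrCA gtr_pMr ?exprn_gt0//.
rewrite ltr_pdivrMr ?exprn_gt0// mul1r -natrX ltr_nat.
by rewrite -mulnn; apply: leq_trans (leq_pmulr _ _).
Qed.

Lemma leb_ball2_gt0 t : (0 < t)%R -> 0 < @leb R d (ball2 t).
Proof.
move=> t0; have /andP[+ _] := @leb_cube_gt0 (t / d.+1%:R) (divr_gt0 t0 (ltr0Sn _ _)).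
move=> /lt_le_trans; apply; apply: le_outer_measure; exact: cube_ball2.
Qed.

Lemma leb_ball2_lty t : @leb R d (ball2 t) < +oo.
Proof.
have h : (0 < `|t| + 1)%R by rewrite ltr_wpDl.
have /andP[_] := @leb_cube_gt0 (`|t| + 1) h; apply: le_lt_trans.
apply: le_outer_measure => x xt; apply: ball2_cube => //; apply: lt_le_trans xt _.
by rewrite -(real_normK (num_real t)) ler_pXn2r ?nnegrE// ?lerDl// ltW.
Qed.

Variables (O P : 'rV[R]_d -> 'rV[R]_d).
Hypothesis OB : forall x y, O (x - y)%R = (O x - O y)%R.
Hypothesis OK : cancel O P.
Hypothesis PK : cancel P O.
Hypothesis mO : forall i, measurable_fun setT (fun x : L => O x ord0 i).
Hypothesis Onsq : forall x, nsq (O x) = nsq x.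

(** The Haar identity is tested against the unit ball, which [O] preserves; its finite positive
    measure cancels. *)
Lemma leb_isometry A : borel A -> @leb R d (O @^-1` A) = @leb R d A.
Proof.
move=> bA; have := haar OB PK mO bA (borel_ball2 1).
have -> : O @^-1` ball2 1 = ball2 1.
  by apply/seteqP; split => x; rewrite /ball2 /= Onsq.
by rewrite leb_opp_borel//; apply: muleIr; rewrite leb_ball2_gt0 ?leb_ball2_lty.
Qed.

End isometry.

(** * The integral of the positive part of a linear form over a ball *)

Lemma indic_iff (R : pzRingType) (T U : Type) (A : set T) (B : set U) x y :
  (A x <-> B y) -> \1_A x = \1_B y :> R.
Proof. by move=> AB; rewrite !indicE; congr ((_ : bool)%:R); apply/idP/idP; rewrite !inE; tauto. Qed.

Section directional.
Context {R : realType} (d : nat).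
Local Notation L := (@LRd R d).
Implicit Types (u v x h : 'rV[R]_d).

Definition dot x v : R := \sum_(i < d) x ord0 i * v ord0 i.

Lemma dotDl x y v : dot (x + y) v = dot x v + dot y v.
Proof. by rewrite /dot -big_split; apply: eq_bigr => i _; rewrite mxE mulrDl. Qed.
Lemma dotC x v : dot x v = dot v x.
Proof. by apply: eq_bigr => i _; rewrite mulrC. Qed.
Lemma dotZl a x v : dot (a *: x) v = a * dot x v.
Proof. by rewrite /dot mulr_sumr; apply: eq_bigr => i _; rewrite mxE mulrA. Qed.
Lemma dotZr a x v : dot x (a *: v) = a * dot x v.
Proof. by rewrite dotC dotZl dotC. Qed.
Lemma dotDr x y v : dot v (x + y) = dot v x + dot v y.
Proof. by rewrite dotC dotDl !(dotC v). Qed.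
Lemma dotNl x v : dot (- x) v = - dot x v.
Proof. by rewrite -scaleN1r dotZl mulN1r. Qed.
Lemma dotNr x v : dot x (- v) = - dot x v.
Proof. by rewrite dotC dotNl dotC. Qed.
Lemma dotBl x y v : dot (x - y) v = dot x v - dot y v.
Proof. by rewrite dotDl dotNl. Qed.
Lemma dotBr x y v : dot v (x - y) = dot v x - dot v y.
Proof. by rewrite dotDr dotNr. Qed.
Lemma dotxx x : dot x x = nsq x.
Proof. by apply: eq_bigr => i _; rewrite expr2. Qed.

Lemma dot_delta x i : dot x (delta_mx ord0 i) = x ord0 i.
Proof.
rewrite /dot (bigD1 i)//= big1 ?mxE ?eqxx ?mulr1 ?addr0//.
by move=> j /negPf ji; rewrite mxE ji andbF mulr0.
Qed.

Lemma nsqZ a x : nsq (a *: x) = a ^+ 2 * nsq x.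
Proof. by rewrite -!dotxx dotZl dotZr mulrA expr2. Qed.
Lemma nsqN x : nsq (- x) = nsq x.
Proof. by rewrite -!dotxx dotNl dotNr opprK. Qed.
Lemma nsqD x y : nsq (x + y) = nsq x + 2 * dot x y + nsq y.
Proof. by rewrite -!dotxx dotDl !dotDr (dotC y x); ring. Qed.
Lemma nsqB x y : nsq (x - y) = nsq x - 2 * dot x y + nsq y.
Proof. by rewrite nsqD nsqN dotNr mulrN. Qed.

Lemma nsq_eq0 x : nsq x = 0 -> x = 0.
Proof.
move=> /eqP; rewrite psumr_eq0; last by move=> i _; exact: sqr_ge0.
move=> /allP x0; apply/rowP => i; rewrite mxE; apply/eqP.
by have := x0 i (mem_index_enum _); rewrite /= sqrf_eq0.
Qed.

Lemma eucl_normE x : eucl_norm x = Num.sqrt (nsq x). Proof. by []. Qed.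

Lemma eucl_norm_sq x : eucl_norm x ^+ 2 = nsq x.
Proof. by rewrite sqr_sqrtr// nsq_ge0. Qed.

Lemma eucl_norm_ge0 x : 0 <= eucl_norm x. Proof. exact: sqrtr_ge0. Qed.

Lemma eucl_norm_ltE x t : 0 < t -> (eucl_norm x < t) = (nsq x < t ^+ 2).
Proof.
by move=> t0; rewrite -eucl_norm_sq ltr_pXn2r ?nnegrE ?eucl_norm_ge0 ?(ltW t0).
Qed.

Lemma cauchy_schwarz x y : dot x y <= eucl_norm x * eucl_norm y.
Proof.
have [x0|x0] := eqVneq (nsq x) 0.
  rewrite (nsq_eq0 x0) /dot big1 ?mulr_ge0 ?eucl_norm_ge0// => i _.
  by rewrite mxE mul0r.
have [y0|y0] := eqVneq (nsq y) 0.
  rewrite (nsq_eq0 y0) /dot big1 ?mulr_ge0 ?eucl_norm_ge0// => i _.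
  by rewrite mxE mulr0.
have xn : 0 < eucl_norm x by rewrite sqrtr_gt0 lt_neqAle eq_sym x0 nsq_ge0.
have yn : 0 < eucl_norm y by rewrite sqrtr_gt0 lt_neqAle eq_sym y0 nsq_ge0.
(* Expanding this square gives [2 |x| |y| (|x| |y| - x.y) >= 0]. *)
have := nsq_ge0 (eucl_norm y *: x - eucl_norm x *: y).
rewrite nsqB !nsqZ dotZl dotZr -!eucl_norm_sq.
have -> : eucl_norm y ^+ 2 * eucl_norm x ^+ 2 - 2 * (eucl_norm y * (eucl_norm x * dot x y)) +
  eucl_norm x ^+ 2 * eucl_norm y ^+ 2 = 2 * (eucl_norm x * eucl_norm y) *
  (eucl_norm x * eucl_norm y - dot x y) by ring.
by rewrite pmulr_rge0 ?mulr_gt0// subr_ge0.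
Qed.

Lemma measurable_dot d' (T : measurableType d') (f : T -> 'rV[R]_d) v :
  (forall i, measurable_fun setT (fun z => f z ord0 i)) ->
  measurable_fun setT (fun z => dot (f z) v).
Proof. by move=> mf; apply: measurable_sum => i; apply: measurable_funM. Qed.

Lemma measurable_ball2 t : measurable (@ball2 R d t : set L).
Proof. by apply: borel_measurable; exact: borel_ball2. Qed.

Definition dirint (t : R) v : \bar R :=
  (\int[@leb R d]_h (\1_(ball2 t) h * Num.max (dot h v) 0)%:E)%E.

Lemma measurable_dirint t v :
  measurable_fun setT (fun h : L => \1_(ball2 t) h * Num.max (dot h v) 0).
Proof.
apply: measurable_funM; first exact/measurable_indic/measurable_ball2.
have mdot : measurable_fun setT (fun h : L => dot h v).
  apply: measurable_dot; exact: measurable_coord.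
exact: (@measurable_maxr _ L R setT (fun h : L => dot h v) (fun=> 0) mdot (measurable_cst _)).
Qed.

Lemma measurable_EdirInt t v :
  measurable_fun setT (fun h : L => (\1_(ball2 t) h * Num.max (dot h v) 0)%:E).
Proof. exact/measurable_EFinP/measurable_dirint. Qed.

Lemma dirint_ge0 t v h : (0 <= (\1_(ball2 t) h * Num.max (dot h v) 0)%:E)%E.
Proof. by rewrite lee_fin mulr_ge0// le_max lexx orbT. Qed.

Lemma ball2_scale (t : R) h : 0 < t -> ball2 t (t *: h) <-> ball2 1 h.
Proof.
by move=> t0; rewrite /ball2/= nsqZ expr1n gtr_pMr ?exprn_gt0.
Qed.

(** The Jacobian contributes [t ^+ d] and the linear form one more factor [t]. *)
Lemma dirint_scale t v : 0 < t -> dirint t v = ((t ^+ d.+1)%:E * dirint 1 v)%E.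
Proof.
move=> t0.
have /(congr1 (fun z => (t ^+ d)%:E * z)%E) := ge0_integral_scale t0
  (measurable_EdirInt t v) (dirint_ge0 t v).
rewrite muleA -EFinM mulfV ?gt_eqF ?exprn_gt0// mul1e /dirint => <-.
rewrite exprSr EFinM -muleA; congr (_ * _)%E.
rewrite -(ge0_integralZl _ measurableT (measurable_EdirInt 1 v) (fun h _ => dirint_ge0 1 v h));
  last by rewrite lee_fin ltW.
apply: eq_integral => h _; rewrite -EFinM /=; congr (_%:E).
rewrite (indic_iff R (ball2_scale h t0)) dotZl mulrCA; congr (_ * _).
by rewrite maxr_pMr ?(ltW t0)// mulr0.
Qed.

End directional.

(** * Reflection exchanging a unit vector with the first basis vector *)

Section householder.
Context {R : realType} (d : nat).
Local Notation L := (@LRd R d.+1).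
Implicit Types (u v x h : 'rV[R]_d.+1).

Definition e0 : 'rV[R]_d.+1 := delta_mx ord0 ord0.

Lemma dot_e0 x : dot x e0 = x ord0 ord0.
Proof. exact: dot_delta. Qed.

Lemma nsq_e0 : nsq e0 = 1.
Proof. by rewrite -dotxx dot_e0 mxE !eqxx. Qed.

(* for w = 0 the convention 0^-1 = 0 makes the reflection the identity *)
Definition reflection u x : 'rV[R]_d.+1 :=
  let w := u - e0 in x - (2 * dot x w / nsq w) *: w.

Variable u : 'rV[R]_d.+1.

Lemma reflectionB x y : reflection u (x - y) = reflection u x - reflection u y.
Proof.
rewrite /reflection dotBl mulrBr mulrBl scalerBl.
by rewrite !opprD !opprK !addrA; congr (_ + _); exact: addrAC.
Qed.

Lemma dot_reflection x : dot (reflection u x) (u - e0) = - dot x (u - e0).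
Proof.
rewrite /reflection dotBl dotZl dotxx; set w := u - e0.
have [w0|w0] := eqVneq (nsq w) 0.
  have -> : dot x w = 0 by rewrite (nsq_eq0 w0) /dot big1// => i _; rewrite mxE mulr0.
  by rewrite mulr0 mul0r mul0r subr0 oppr0.
by rewrite divfK//; ring.
Qed.

Lemma reflectionK : involutive (reflection u).
Proof.
move=> x; rewrite {1}/reflection dot_reflection /reflection.
by rewrite mulrN mulNr scaleNr opprK subrK.
Qed.

Lemma nsq_reflection x : nsq (reflection u x) = nsq x.
Proof.
rewrite /reflection; set w := u - e0; rewrite nsqB dotZr nsqZ.
have [w0|w0] := eqVneq (nsq w) 0.
  by rewrite w0 invr0 !mulr0 mul0r mulr0 subr0 addr0.
by field.
Qed.

Lemma measurable_reflection i :
  measurable_fun setT (fun x : L => reflection u x ord0 i).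
Proof.
set w := u - e0.
have -> : (fun x : L => reflection u x ord0 i) =
    (fun x : L => dot x (delta_mx ord0 i - (2 / nsq w * w ord0 i) *: w)).
  apply/funext => x; rewrite /reflection -/w [RHS]dotBr [in RHS]dotZr dot_delta.
  have -> k : (x - k *: w) ord0 i = x ord0 i - k * w ord0 i by rewrite !mxE.
  by ring.
apply: measurable_dot; exact: measurable_coord.
Qed.

Lemma reflection_box a b : (lebesgue_outer (reflection u @^-1` box a b) <= (1 * vol a b)%:E)%E.
Proof.
rewrite mul1r -leb_box le_eqVlt; apply/orP; left; apply/eqP.
apply: (@leb_isometry R d.+1 _ _ reflectionB reflectionK).
- exact: measurable_reflection.
- exact: nsq_reflection.
- exact: borel_box.
Qed.

Hypothesis u1 : nsq u = 1.

(** With [w = u - e0] and [|u| = 1] one has [nsq w = 2 (1 - u_0)] and [w.e0 = - (1 - u_0)], so the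
    first coordinate of the image is [x.e0 + x.w = x.u]. *)
Lemma reflection0 x : reflection u x ord0 ord0 = dot x u.
Proof.
rewrite -dot_e0 /reflection; set w := u - e0; rewrite dotBl dotZl.
have ww : nsq w = 2 * (1 - u ord0 ord0) by rewrite nsqB u1 nsq_e0 dot_e0; ring.
have -> : dot w e0 = - (1 - u ord0 ord0) by rewrite dotBl dotxx nsq_e0 dot_e0 opprB.
have [w0|w0] := eqVneq (nsq w) 0.
  rewrite w0 invr0 mulr0 mul0r subr0; congr dot.
  by apply/esym/eqP; rewrite -subr_eq0; apply/eqP/nsq_eq0.
have -> : dot x e0 = dot x u - dot x w by rewrite /w dotBr opprB addrC subrK.
by rewrite ww; move: w0; rewrite ww => w0; field; move: w0; rewrite mulf_eq0 negb_or => /andP[].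
Qed.

Lemma dirint_unit : dirint 1 u = dirint 1 e0.
Proof.
have := @ge0_integral_preimage R d.+1 _ _ 1 ltr01 reflectionK reflectionK reflection_box.
rewrite invr1 => /(_ reflection_box _ (measurable_EdirInt 1 e0)).
move=> /(_ (dirint_ge0 1 e0)); rewrite mul1e /dirint => <-.
apply: eq_integral => h _ /=; rewrite dot_e0 reflection0; congr (_ * _)%:E.
by apply: indic_iff; rewrite /ball2/= nsq_reflection.
Qed.

End householder.

(** * Value of the directional constant by slicing *)

Section dirint_constant.
Context {R : realType} (d : nat).
Hypothesis d0 : (0 < d)%N.
Local Notation L := (@LRd R d.+1).
Local Open Scope ereal_scope.

Let G (x : BRd d.+1) : R := (\1_(ball2 1) x * Num.max (x ord0 ord0) 0)%R.

Let mG : measurable_fun setT (G : @BRd R d.+1 -> R).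
Proof.
apply: measurable_funM; first by apply: measurable_indic; exact: borel_ball2.
exact: (@measurable_maxr _ (@BRd R d.+1) R setT (fun h : @BRd R d.+1 => h ord0 ord0)
  (fun=> 0%R) (measurable_coordB ord0) (measurable_cst _)).
Qed.

Let G0 x : 0 <= (G x)%:E.
Proof. by rewrite lee_fin mulr_ge0// le_max lexx orbT. Qed.

Lemma leb_ball2_scale n t : (0 < t)%R ->
  @leb R n (ball2 t) = (t ^+ n)%:E * @leb R n (ball2 1).
Proof.
move=> t0; have := leb_scale (@ball2 R n t) t0.
rewrite (_ : _ @^-1` _ = ball2 1); last first.
  by apply/seteqP; split => x /= /(ball2_scale x t0).
by move=> ->; rewrite muleA -EFinM mulfV ?mul1e// gt_eqF// exprn_gt0.
Qed.

(** The integral is first moved to the Borel structure, where the slice measure and Lebesgue measure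
    coincide. *)
Lemma dirint_slice : dirint 1 (@e0 R d) = \int[@lebesgue_measure R]_x
  \int[@leb R d]_y (G (cons_rv (x, y)))%:E.
Proof.
have mEG : measurable_fun setT (fun x : @BRd R d.+1 => (G x)%:E).
  by apply/measurable_EFinP; exact: mG.
transitivity (\int[@bleb R d.+1]_x (G x)%:E).
  rewrite (ge0_integral_pushforward (@measurable_id_BRd R d.+1) _ measurableT mEG (fun x _ => G0 x)).
  by rewrite preimage_setT; apply: eq_integral => x _; rewrite /= dot_e0.
transitivity (\int[@slice_leb R d]_x (G x)%:E).
  by apply: eq_measure_integral => A mA _; symmetry; exact: slice_lebE.
rewrite (ge0_integral_pushforward (@measurable_cons_rv R d) _ measurableT mEG (fun x _ => G0 x)).
rewrite preimage_setT fubini_tonelli1//; last by move=> x; exact: G0.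
exact: (measurableT_comp mEG (@measurable_cons_rv R d)).
Qed.

Lemma nsq_cons (x : R) (y : @LRd R d) : nsq (cons_rv (x, y)) = (x ^+ 2 + nsq y)%R.
Proof.
rewrite /nsq big_ord_recl /cons_rv mxE unlift_none /=; congr (_ + _)%R.
by apply: eq_bigr => i _; rewrite mxE liftK.
Qed.

(** At height [x] in []0, 1[] the unit ball is sliced in a ball of radius [sqrt (1 - x^2)]. At the
    closed ends the profile vanishes, at 0 by the factor [x] and at 1 because [0 < d]. *)
Lemma slice_inner (x : R) : \int[@leb R d]_y (G (cons_rv (x, y)))%:E =
  (\1_(`[0%R, 1%R]) x * (x * Num.sqrt (1 - x ^+ 2) ^+ d))%:E * @leb R d (ball2 1).
Proof.
have GE y : G (cons_rv (x, y)) = (\1_(ball2 1) (cons_rv (x, y)) * Num.max x 0)%R.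
  by rewrite /G {2}/cons_rv mxE unlift_none.
have [/= x01|x01] := boolP (x \in `]0%R, 1%R[).
  have /andP[x0 x1] : (0 < x < 1)%R by move: x01; rewrite in_itv.
  have s0 : (0 < 1 - x ^+ 2)%R by rewrite subr_gt0 expr_lt1// ltW.
  rewrite (@integral_if_cst R _ (LRd d) (@leb R d) (ball2 (Num.sqrt (1 - x ^+ 2))) x%:E).
  - transitivity (x%:E * ((Num.sqrt (1 - x ^+ 2) ^+ d)%:E * @leb R d (ball2 1))).
      by congr (_ * _); apply: leb_ball2_scale; rewrite sqrtr_gt0.
    rewrite muleA -EFinM; congr (_%:E * _).
    by rewrite indicE mem_set ?mul1r//= in_itv/= !ltW.
  - exact: measurable_ball2.
  - by rewrite lee_fin ltW.
  - move=> y; rewrite /ball2/= sqr_sqrtr ?(ltW s0)// => yx; congr (_%:E).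
    rewrite GE indicE mem_set ?mul1r; first by rewrite max_l// ltW.
    by rewrite /ball2/= nsq_cons expr1n -ltrBrDl.
  - move=> y; rewrite /ball2/= sqr_sqrtr ?(ltW s0)// => yx; congr (_%:E).
    rewrite GE indicE memNset ?mul0r//.
    by rewrite /ball2/= nsq_cons expr1n -ltrBrDl.
have -> : (\1_(`[0%R, 1%R]) x * (x * Num.sqrt (1 - x ^+ 2) ^+ d) = 0)%R.
  rewrite indicE; case: (boolP (_ \in _)); last by rewrite mul0r.
  rewrite inE/= in_itv/= => /andP[x0 x1]; rewrite mul1r.
  move: x01; rewrite in_itv/= negb_and -!leNgt => /orP[x0'|x1'].
    by rewrite (_ : x = 0%R) ?mul0r//; apply/eqP; rewrite eq_le x0 x0'.
  rewrite (_ : x = 1%R) ?expr1n ?subrr ?sqrtr0 ?expr0n ?gtn_eqF ?mulr0//.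
  by apply/eqP; rewrite eq_le x1 x1'.
rewrite mul0e integral0_eq// => y _; congr (_%:E); rewrite GE.
move: x01; rewrite in_itv/= negb_and -!leNgt => /orP[x0|x1].
  by rewrite max_r ?mulr0.
rewrite indicE memNset ?mul0r//.
rewrite /ball2/= nsq_cons expr1n; apply/negP; rewrite -leNgt.
by rewrite ler_wpDr ?nsq_ge0// exprn_ege1.
Qed.

Lemma integral_profile : \int[@lebesgue_measure R]_(x in `[0%R, 1%R])
   (x * Num.sqrt (1 - x ^+ 2) ^+ d)%:E = (d.+2%:R^-1)%:E.
Proof.
(* A primitive of the profile. The square root is not differentiable at 0, so the derivative is
   taken in the open interval and only continuity is used at the ends. *)
pose F (x : R) : R := (- (Num.sqrt (1 - x ^+ 2) ^+ d.+2 / d.+2%:R))%R.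
have cs : continuous (fun x : R => Num.sqrt (1 - x ^+ 2)).
  move=> x; apply: (@continuous_comp _ _ _ (fun x : R => 1 - x ^+ 2)%R); last exact: sqrt_continuous.
  by apply: cvgB; [exact: cvg_cst|exact: exprn_continuous].
have cX n : continuous (fun x : R => Num.sqrt (1 - x ^+ 2) ^+ n)%R.
  move=> x; apply: (@continuous_comp _ _ _ (fun x : R => Num.sqrt (1 - x ^+ 2))%R (fun y => y ^+ n)%R).
    exact: cs.
  exact: exprn_continuous.
have cF : continuous F by move=> x; apply: cvgN; apply: cvgMl; exact: cX.
have dF (x : R) : x \in `]0%R, 1%R[ -> is_derive x 1%R F (x * Num.sqrt (1 - x ^+ 2) ^+ d)%R.
  rewrite in_itv/= => /andP[x0 x1].
  have s0 : (0 < 1 - x ^+ 2)%R by rewrite subr_gt0 expr_lt1// ltW.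
  have d1 := @is_derive1_sqrt R _ s0.
  have d2 : is_derive x (1%R : R) (cst (1%R : R) - (@id R) ^+ 2)%R (- (2 * x))%R.
    by apply: is_derive_eq; rewrite /= expr1 /GRing.scale/= mulr1 sub0r.
  have d3 : is_derive x (1%R : R) (Num.sqrt \o (cst (1%R : R) - (@id R) ^+ 2)%R) _ :=
    @is_derive1_comp _ Num.sqrt (cst (1%R : R) - (@id R) ^+ 2)%R x _ _ d1 d2.
  rewrite (_ : F = - ((d.+2%:R^-1) \*: (Num.sqrt \o (cst (1%R : R) - (@id R) ^+ 2)%R) ^+ d.+2))%R; last first.
    by apply/funext => z; rewrite /F mulrC exprfctE.
  apply: is_derive_eq.
  rewrite /GRing.scale/= (_ : (cst _ - _ ^+ 2)%R x = (1 - x ^+ 2)%R)//.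
  set n : R := d.+2%:R; have n0 : (n != 0)%R by rewrite pnatr_eq0.
  have q0 : (Num.sqrt (1 - x ^+ 2) != 0)%R by rewrite sqrtr_eq0 -ltNge.
  by rewrite exprS; field; apply/andP.
rewrite (@continuous_FTC2 _ _ F 0%R 1%R) //.
- rewrite /F expr1n subrr sqrtr0 expr0n expr0n/= subr0 sqrtr1 expr1n.
  by rewrite -EFinD mul0r mul1r oppr0 add0r opprK.
- apply: continuous_subspaceT => x; apply: cvgM; first exact: cvg_id.
  exact: cX.
- split.
  + by move=> x /dF [].
  + by apply: cvg_at_right_filter; exact: cF.
  + by apply: cvg_at_left_filter; exact: cF.
- by move=> x /dF xF; rewrite derive1E; apply: derive_val.
Qed.

Lemma dirint_e0 : dirint 1 (@e0 R d) = (d.+2%:R^-1)%:E * @leb R d (ball2 1).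
Proof.
rewrite dirint_slice -integral_profile.
under eq_integral do rewrite slice_inner.
pose p (x : R) : R := (x * Num.sqrt (1 - x ^+ 2) ^+ d)%R.
have p0 x : `[0%R, 1%R]%classic x -> 0 <= (p x)%:E.
  by rewrite /= in_itv/= => /andP[x0 x1]; rewrite lee_fin mulr_ge0// exprn_ge0// sqrtr_ge0.
have mp : measurable_fun setT p.
  apply: continuous_measurable_fun => x; apply: cvgM; first exact: cvg_id.
  apply: (@continuous_comp _ _ _ (fun x : R => Num.sqrt (1 - x ^+ 2))%R (fun y => y ^+ d)%R); last exact: exprn_continuous.
  apply: (@continuous_comp _ _ _ (fun x : R => 1 - x ^+ 2)%R); last exact: sqrt_continuous.
  by apply: cvgB; [exact: cvg_cst|exact: exprn_continuous].
have <- : \int[@lebesgue_measure R]_x ((\1_(`[0%R, 1%R]) x * p x)%:E) =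
    \int[@lebesgue_measure R]_(x in `[0%R, 1%R]) (p x)%:E.
  rewrite [RHS]integral_mkcond; apply: eq_integral => x _.
  by rewrite patchE indicE; case: ifPn => _; rewrite ?mul1r ?mul0r.
rewrite muleC -ge0_integralZl//.
- by apply: eq_integral => x _; rewrite muleC.
- apply/measurable_EFinP; apply: measurable_funM; last exact: mp.
  by apply: measurable_indic; exact: measurable_itv.
- move=> x _; rewrite lee_fin indicE; case: (boolP (_ \in _)); last by rewrite mul0r.
  by rewrite inE => /p0; rewrite lee_fin mul1r.
Qed.

(** In the ambient space of dimension [d.+1] this is the constant [omega_dm1], as a real number. *)
Definition omega : R := fine (@leb R d (ball2 1)).

Lemma omegaE : @leb R d (ball2 1) = omega%:E.
Proof. by rewrite fineK// ge0_fin_numE ?leb_ball2_lty// ltW// leb_ball2_gt0. Qed.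

Lemma omega_gt0 : (0 < omega)%R.
Proof. by rewrite -lte_fin -omegaE leb_ball2_gt0. Qed.

Lemma omega_dm1E : @omega_dm1 R d.+1 = omega%:E.
Proof.
rewrite -omegaE; congr lebesgue_outer; apply/seteqP; split => x /=;
  by rewrite eucl_norm_ltE// expr1n /ball2/= expr1n.
Qed.

(** Homogeneity in [t] and in [v] reduces to the unit ball and a unit vector, the reflection to
    [e0], and slicing to the profile integral. *)
Lemma dirintE t v : (0 < t)%R ->
  @dirint R d.+1 t v = (omega / d.+2%:R * t ^+ d.+2 * eucl_norm v)%:E.
Proof.
move=> t0; rewrite dirint_scale//.
suff -> : dirint 1 v = (omega / d.+2%:R * eucl_norm v)%:E by rewrite -EFinM; congr (_%:E); ring.
have [v0|v0] := eqVneq (nsq v) 0%R.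
  rewrite eucl_normE v0 sqrtr0 mulr0 /dirint integral0_eq// => h _.
  by rewrite (nsq_eq0 v0) /dot big1 ?maxxx ?mulr0// => i _; rewrite mxE mulr0.
have vn : (0 < eucl_norm v)%R by rewrite sqrtr_gt0 lt_neqAle eq_sym v0 nsq_ge0.
have u1 : nsq ((eucl_norm v)^-1 *: v) = 1%R.
  by rewrite nsqZ -eucl_norm_sq -exprMn mulVf ?expr1n// gt_eqF.
have := dirint_unit u1; rewrite dirint_e0 omegaE -EFinM mulrC => duE.
rewrite mulrC EFinM -duE /dirint -(ge0_integralZl _ measurableT (measurable_EdirInt 1 _) (fun h _ => dirint_ge0 1 _ h));
  last by rewrite lee_fin ltW.
apply: eq_integral => h _; rewrite -EFinM; congr (_%:E).
by rewrite [RHS]mulrCA; congr (_ * _)%R; rewrite maxr_pMr ?(ltW vn)// mulr0 dotZr mulVKf// gt_eqF.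
Qed.

End dirint_constant.

(** * Translation variation and the layer-cake formula *)

Section variation.
Context {R : realType} (d : nat).
Local Notation L := (@LRd R d).
Local Notation leb := (@leb R d).
Implicit Types (E F : set 'rV[R]_d) (h x y : 'rV[R]_d).

Lemma measurable_eucl_norm d' (T : measurableType d') (f : T -> 'rV[R]_d) :
  (forall i, measurable_fun setT (fun z => f z ord0 i)) ->
  measurable_fun setT (fun z => eucl_norm (f z)).
Proof.
move=> mf; apply: (@measurableT_comp _ _ _ _ _ _ (@Num.sqrt R) _ (fun z => nsq (f z))).
  by apply: continuous_measurable_fun; exact: sqrt_continuous.
exact: measurable_nsq.
Qed.

Lemma measurable_indic_borel d' (T : measurableType d') (f : T -> 'rV[R]_d) E :
  borel E -> (forall i, measurable_fun setT (fun z => f z ord0 i)) ->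
  measurable_fun setT (fun z => \1_E (f z) : R).
Proof.
move=> bE mf; apply: (@measurableT_comp _ _ _ T (@BRd R d) R (\1_E : @BRd R d -> R) _ f).
  exact: measurable_indic.
exact: measurable_to_BRd.
Qed.

Lemma eucl_normN x : eucl_norm (- x) = eucl_norm x.
Proof. by rewrite !eucl_normE nsqN. Qed.

Lemma mfst i : measurable_fun setT (fun p : L * L => p.1 ord0 i).
Proof. by apply: (measurableT_comp (measurable_coord i)); exact: measurable_fst. Qed.
Lemma msnd i : measurable_fun setT (fun p : L * L => p.2 ord0 i).
Proof. by apply: (measurableT_comp (measurable_coord i)); exact: measurable_snd. Qed.
Lemma madd i : measurable_fun setT (fun p : L * L => (p.1 + p.2 : 'rV[R]_d) ord0 i).
Proof.
under eq_fun do rewrite mxE; apply: measurable_funD; [exact: mfst|exact: msnd].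
Qed.

Definition Vset E h : set L := [set x | E x /\ ~ E (x + h)].
Definition V E h : \bar R := leb (Vset E h).

Lemma measurable_translate_borel E h : borel E -> measurable ([set x | E (x + h)] : set L).
Proof.
move=> bE; apply: (@measurable_preimage_borel R d _ L (fun x => x + h) E bE) => i.
under eq_fun do rewrite mxE; apply: measurable_funD; first exact: measurable_coord.
exact: measurable_cst.
Qed.

Lemma measurable_Vset E h : borel E -> measurable (Vset E h).
Proof.
move=> bE; apply: measurableI; first exact: borel_measurable.
by apply: measurableC; exact: measurable_translate_borel.
Qed.

Lemma measurable_V E : borel E -> measurable_fun setT (V E : L -> \bar R).
Proof.
move=> bE; pose S : set (L * L) := [set p | E p.1] `&` ~` [set p | E (p.1 + p.2)].
have mS : measurable S.
  apply: measurableI.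
    exact: (@measurable_preimage_borel R d _ (L * L)%type (fun p => p.1) E bE mfst).
  apply: measurableC.
  exact: (@measurable_preimage_borel R d _ (L * L)%type (fun p => p.1 + p.2) E bE madd).
have := measurable_fun_ysection leb mS.
congr (measurable_fun _ _); apply/funext => h; rewrite /V /=; congr (leb _).
by apply/seteqP; split => x; rewrite /ysection/= inE.
Qed.

Local Open Scope ereal_scope.

Lemma V_ge0 E h : 0 <= V E h. Proof. exact: measure_ge0. Qed.

(** Substitute [y = x + h] in the inner integral, then exchange the order: the integral in [x] at
    fixed [h] is [V E h]. *)
Lemma double_integral_shift (K : 'rV[R]_d -> R) E : borel E ->
  measurable_fun setT (K : @BRd R d -> R) -> (forall u, 0 <= K u)%R ->
  \int[leb]_(x in (E : set L)) \int[leb]_(y in (~` E : set L)) (K (y - x)%R)%:E =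
  \int[leb]_h ((K h)%:E * V E h).
Proof.
move=> bE mK K0.
pose u (p : L * L) : R := (\1_E p.1 * (1 - \1_E (p.1 + p.2)) * K p.2)%R.
have mu : measurable_fun setT u.
  apply: measurable_funM.
    apply: measurable_funM; first exact: (measurable_indic_borel bE mfst).
    apply: measurable_funB; first exact: measurable_cst.
    exact: (measurable_indic_borel bE madd).
  exact: (measurableT_comp mK (measurable_to_BRd msnd)).
have ind0 z : (0 <= 1 - \1_E z :> R)%R by rewrite indicE; case: (_ \in _); rewrite ?subrr ?subr0.
have u0 p : 0 <= (u p)%:E by rewrite lee_fin /u !mulr_ge0.
transitivity (\int[leb]_x \int[leb]_h (u (x, h))%:E).
  rewrite integral_mkcond; apply: eq_integral => x _; rewrite patchE.
  case: ifPn => [xE|xE]; last first.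
    rewrite integral0_eq// => h _; rewrite /u indicE (negbTE xE) mul0r mul0r//.
  pose F (y : L) : \bar R := ((1 - \1_E y) * K (y - x))%:E.
  transitivity (\int[leb]_y F y).
    rewrite integral_mkcond; apply: eq_integral => y _; rewrite patchE /F indicE.
    by rewrite in_setC; case: (y \in E) => /=; rewrite ?subrr ?subr0 ?mul1r ?mul0r.
  rewrite -(@ge0_integral_translate _ _ x F).
  - apply: eq_integral => h _; rewrite /F /u /= [X in (X * _ * _)%R]indicE xE mul1r (addrC h).
    by rewrite (addrC x h) addrK.
  - apply/measurable_EFinP; apply: measurable_funM.
      apply: measurable_funB; first exact: measurable_cst.
      exact: (measurable_indic_borel bE (@measurable_coord R d)).
    apply: (measurableT_comp mK); apply: measurable_to_BRd => i.
    under eq_fun do rewrite !mxE; apply: measurable_funB; first exact: measurable_coord.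
    exact: measurable_cst.
  - by move=> y; rewrite lee_fin mulr_ge0.
have mEu : measurable_fun setT (EFin \o u) by apply/measurable_EFinP; exact: mu.
rewrite (@fubini_tonelli _ _ _ _ _ leb leb (EFin \o u) mEu u0).
apply: eq_integral => h _; apply: integral_if_cst; first exact: measurable_Vset.
- by rewrite lee_fin.
- move=> x [Ex nEx]; rewrite /= /u /= indicE mem_set// mul1r indicE memNset//.
  by rewrite subr0 mul1r.
- move=> x nx; rewrite /= /u /=; congr (_%:E).
  have [Ex|Ex] := pselect (E x); last by rewrite indicE memNset// !mul0r.
  rewrite [X in (_ * (1 - X))%R]indicE mem_set ?subrr ?mulr0 ?mul0r//.
  by apply: contrapT => nE; apply: nx.
Qed.

Lemma double_integral (K : R -> R) E : borel E -> measurable_fun setT K ->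
  (forall u, 0 <= K u)%R ->
  \int[leb]_(x in (E : set L)) \int[leb]_(y in (~` E : set L)) (K (eucl_dist x y))%:E =
  \int[leb]_h ((K (eucl_norm h))%:E * V E h).
Proof.
move=> bE mK K0; rewrite -(@double_integral_shift (K \o @eucl_norm R d) E bE).
- apply: eq_integral => x _; apply: eq_integral => y _.
  by rewrite /eucl_dist /= -[(x - y)%R]opprB eucl_normN.
- apply: (measurableT_comp mK).
  exact: (@measurable_eucl_norm _ (@BRd R d) id (@measurable_coordB R d)).
- by move=> u; exact: K0.
Qed.

Definition A E (t : R) : \bar R := \int[leb]_h ((\1_(ball2 t) h)%:E * V E h).

Lemma measurable_Aint E t : borel E ->
  measurable_fun setT (fun h : L => (\1_(ball2 t) h)%:E * V E h).
Proof.
move=> bE; apply: emeasurable_funM; last exact: measurable_V.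
by apply/measurable_EFinP; apply: measurable_indic; exact: measurable_ball2.
Qed.

Lemma Aint_ge0 E t h : 0 <= (\1_(ball2 t) h)%:E * V E h.
Proof. by rewrite mule_ge0 ?V_ge0// lee_fin. Qed.

Lemma A_ge0 E t : 0 <= A E t.
Proof. by apply: integral_ge0 => h _; exact: Aint_ge0. Qed.

Lemma AE E t : borel E -> (0 < t)%R ->
  A E t = \int[leb]_(x in (E : set L)) \int[leb]_(y in (~` E : set L)) (\1_(`]-oo, t[) (eucl_dist x y))%:E.
Proof.
move=> bE t0; rewrite (@double_integral (\1_(`]-oo, t[)) E bE).
- apply: eq_integral => h _; congr ((_)%:E * _); apply: indic_iff => /=.
  by rewrite in_itv/= eucl_norm_ltE.
- by apply: measurable_indic; exact: measurable_itv.
- by move=> x; rewrite indicE.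
Qed.

Lemma V_le E h : borel E -> V E h <= leb E.
Proof. by move=> bE; apply: le_outer_measure => x []. Qed.

(** A point of [E] leaving under [h + k] either leaves already under [h], or is brought by [h] to a
    point of [E] that leaves under [k]. *)
Lemma V_sub E h k : borel E -> V E (h + k) <= V E h + V E k.
Proof.
move=> bE; rewrite -[X in _ + X](leb_translate h).
apply: le_trans (outer_measureU2 _ _ _).
apply: le_outer_measure => x [Ex nEx].
have [Exh|] := pselect (E (x + h)%R); last by left.
by right; split => //=; rewrite -addrA.
Qed.

Lemma V0 E : V E 0 = 0.
Proof.
rewrite /V (_ : Vset E 0 = set0) ?measure0//.
by apply/seteqP; split => x // [Ex]; rewrite addr0.
Qed.

Lemma V_muln E h m : borel E -> V E (m%:R *: h)%R <= m%:R%:E * V E h.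
Proof.
move=> bE; elim: m => [|m IH]; first by rewrite scale0r V0 mul0e.
rewrite -natr1 scalerDl scale1r EFinD ge0_muleDl ?lee_fin// mul1e.
by apply: (le_trans (V_sub _ _ bE)); rewrite leeD.
Qed.

Lemma V_diff E F h : borel E -> borel F -> V E h <= V F h + (leb (E `\` F) + leb (F `\` E)).
Proof.
move=> bE bF.
rewrite -[X in _ + (_ + X)](leb_translate h).
apply: (@le_trans _ _ (leb (Vset F h `|` ((E `\` F) `|` [set x : L | (F `\` E) (x + h)%R])))).
  apply: le_outer_measure => x [Ex nEx].
  have [Fx|nFx] := pselect (F x); last by right; left.
  have [Fxh|nFxh] := pselect (F (x + h)%R); last by left.
  by right; right.
apply: (le_trans (outer_measureU2 _ _ _)); apply: leeD => //.
exact: outer_measureU2.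
Qed.

(** The intersections of [E] with its two opposite translates are translates of each other;
    finiteness of [leb E] allows passing to what remains of [E]. *)
Lemma V_opp E h : borel E -> leb E < +oo -> V E (- h)%R = V E h.
Proof.
move=> bE Eoo.
have split k : leb E = leb (E `&` [set x : L | E (x + k)%R]) + V E k.
  rewrite -measureU.
  - by congr (leb _); apply/seteqP; split => x; [|by case=> -[]] => Ex;
      have [Exk|Exk] := pselect (E (x + k)%R); [left|right].
  - by apply: measurableI; [exact: borel_measurable|exact: measurable_translate_borel].
  - exact: measurable_Vset.
  - by apply/seteqP; split => x // [[_ /= Exk] [_]].
have : leb (E `&` [set x : L | E (x + h)%R]) = leb (E `&` [set x : L | E (x - h)%R]).
  rewrite -[RHS](leb_translate h); congr (leb _).
  by apply/seteqP; split => x /=; rewrite addrK => -[].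
have := split (- h)%R; rewrite {1}(split h) => + E1; rewrite E1 => /esym.
have fE : leb (E `&` [set x : L | E (x - h)%R]) \is a fin_num.
  rewrite ge0_fin_numE ?measure_ge0//; apply: le_lt_trans Eoo.
  by apply: le_outer_measure => x [].
move=> /(congr1 (fun z => z - leb (E `&` [set x : L | E (x - h)%R]))).
by rewrite ![_ + V _ _]addeC !addeK.
Qed.

Lemma A_le E t : borel E -> A E t <= leb E * leb (ball2 t).
Proof.
move=> bE; rewrite -(@integral_if_cst R _ L leb (ball2 t) (leb E) (fun h => (\1_(ball2 t) h)%:E * leb E)).
- apply: ge0_le_integral; first exact: measurableT.
  + by move=> h _; exact: Aint_ge0.
  + exact: measurable_Aint.
  + apply: emeasurable_funM; last exact: measurable_cst.
    by apply/measurable_EFinP; apply: measurable_indic; exact: measurable_ball2.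
  + by move=> h _; rewrite lee_wpmul2l ?lee_fin//; exact: V_le.
- exact: measurable_ball2.
- exact: measure_ge0.
- by move=> h ht; rewrite indicE mem_set// mul1e.
- by move=> h ht; rewrite indicE memNset// mul0e.
Qed.

Lemma A_mono E t t' : borel E -> (0 <= t <= t')%R -> A E t <= A E t'.
Proof.
move=> bE /andP[t0 tt']; apply: ge0_le_integral; first exact: measurableT.
- by move=> h _; exact: Aint_ge0.
- exact: measurable_Aint.
- exact: measurable_Aint.
- move=> h _; rewrite lee_wpmul2r ?V_ge0// lee_fin !indicE.
  have [ht|ht] := pselect (ball2 t h); last by rewrite memNset.
  rewrite !mem_set//; apply: lt_le_trans ht _.
  by rewrite ler_pXn2r ?nnegrE// (le_trans t0).
Qed.

Lemma A_diff E F t : borel E -> borel F ->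
  A E t <= A F t + (leb (E `\` F) + leb (F `\` E)) * leb (ball2 t).
Proof.
move=> bE bF; set c := leb (E `\` F) + leb (F `\` E).
have c0 : 0 <= c by rewrite adde_ge0// measure_ge0.
have mi : measurable_fun setT (fun h : L => (\1_(ball2 t) h)%:E * c).
  apply: emeasurable_funM; last exact: measurable_cst.
  by apply/measurable_EFinP; apply: measurable_indic; exact: measurable_ball2.
rewrite -(@integral_if_cst R _ L leb (ball2 t) c (fun h => (\1_(ball2 t) h)%:E * c)).
- rewrite -ge0_integralD; first last.
  + exact: mi.
  + by move=> h _; rewrite mule_ge0// lee_fin.
  + exact: measurable_Aint.
  + by move=> h _; exact: Aint_ge0.
  + exact: measurableT.
  + apply: ge0_le_integral; first exact: measurableT.
    * by move=> h _; exact: Aint_ge0.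
    * exact: measurable_Aint.
    * by apply: emeasurable_funD; [exact: measurable_Aint|exact: mi].
    * move=> h _; rewrite -ge0_muleDr ?V_ge0//.
      by rewrite lee_wpmul2l ?lee_fin//; exact: V_diff.
- exact: measurable_ball2.
- exact: c0.
- by move=> h ht; rewrite indicE mem_set// mul1e.
- by move=> h ht; rewrite indicE memNset// mul0e.
Qed.

(** Dilating [h] by [m] contributes [m ^+ d], and repeated subadditivity, [V E (m h) <= m V E h],
    the remaining factor. *)
Lemma A_scale E t m : borel E -> (0 < m)%N ->
  A E (m%:R * t)%R <= (m%:R ^+ d.+1)%:E * A E t.
Proof.
move=> bE m0; have m0' : (0 < m%:R :> R)%R by rewrite ltr0n.
have := ge0_integral_scale m0' (measurable_Aint (m%:R * t)%R bE) (Aint_ge0 E (m%:R * t)%R).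
rewrite -/(A E (m%:R * t)%R) => /(congr1 (fun z => (m%:R ^+ d)%:E * z)).
rewrite muleA -EFinM mulfV ?gt_eqF ?exprn_gt0// mul1e => <-.
rewrite exprSr EFinM -muleA lee_wpmul2l ?lee_fin ?exprn_ge0//.
rewrite -(ge0_integralZl _ measurableT (measurable_Aint t bE) (fun h _ => Aint_ge0 E t h)) ?lee_fin//.
apply: ge0_le_integral; first exact: measurableT.
- by move=> h _; exact: Aint_ge0.
- exact: (measurableT_comp (measurable_Aint _ bE) (measurable_scale m0')).
- by apply: emeasurable_funM; [exact: measurable_cst|exact: measurable_Aint].
- move=> h _; rewrite muleCA.
  have -> : (\1_(ball2 (m%:R * t)) (m%:R *: h) = \1_(ball2 t) h :> R)%R.
    by apply: indic_iff; rewrite /ball2/= nsqZ exprMn ltr_pM2l// exprn_gt0.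
  by rewrite lee_wpmul2l ?lee_fin//; exact: V_muln.
Qed.

End variation.

(** * Integrals of powers *)

Section power_integrals.
Context {R : realType}.
Implicit Types a b p s t : R.

Lemma powRN_cvg0 p : 0 < p -> t `^ (- p) @[t --> +oo] --> (0 : R).
Proof.
move=> p0; apply/cvgrPdist_lt => e e0.
exists ((e^-1) `^ p^-1); split; first exact: num_real.
move=> t Mt; rewrite sub0r normrN ger0_norm ?powR_ge0// powRN.
have t0 : 0 < t by apply: le_lt_trans Mt; rewrite powR_ge0.
rewrite -[ltRHS]invrK ltf_pV2 ?posrE ?invr_gt0 ?powR_gt0//.
have := gt0_ltr_powR p0 (powR_ge0 (e^-1) (p^-1)) (ltW t0) Mt.
by rewrite -powRrM mulVf ?gt_eqF// powRr1// invr_ge0 ltW.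
Qed.

Lemma powR_continuous_at a p : 0 < a -> {for a, continuous (fun t => t `^ p)}.
Proof.
move=> a0; apply: differentiable_continuous; apply/derivable1_diffP.
by have := is_derive1_powR p a0; move=> [].
Qed.

Lemma is_derive_powR_prim a p : 0 < a -> p != 0 ->
  is_derive a (1 : R) (fun t => t `^ p / p) (a `^ (p - 1)).
Proof.
move=> a0 p0; have d1 := is_derive1_powR p a0.
rewrite (_ : (fun t => _) = p^-1 \*: (fun t => t `^ p)); last first.
  by apply/funext => t; rewrite mulrC.
by apply: is_derive_eq; rewrite /GRing.scale/= mulrA mulVf// mul1r.
Qed.

Lemma integral_powR_y a p : 0 < a -> 0 < p ->
  (\int[@lebesgue_measure R]_(t in `[a, +oo[) (t `^ (- p - 1))%:E = (a `^ (- p) / p)%:E)%E.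
Proof.
move=> a0 p0; have np : - p != 0 by rewrite oppr_eq0 gt_eqF.
rewrite (@ge0_continuous_FTC2y R _ (fun t => t `^ (- p) / (- p)) _ 0).
- by rewrite sub0e -EFinN invrN mulrN opprK.
- by move=> x _; exact: powR_ge0.
- apply: continuous_in_subspaceT => x; rewrite inE/= in_itv/= andbT => ax.
  by apply: powR_continuous_at; exact: lt_le_trans ax.
- by rewrite -[X in _ --> X](mul0r (- p)^-1); apply: cvgMl; exact: powRN_cvg0.
- by move=> x ax; have [] := is_derive_powR_prim (lt_trans a0 ax) np.
- apply: cvg_at_right_filter; apply: cvgMl; exact: powR_continuous_at.
- move=> x; rewrite in_itv/= andbT => ax.
  have dx := is_derive_powR_prim (lt_trans a0 ax) np.
  by rewrite derive1E; apply: derive_val.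
Qed.

Lemma integral_powR a b p : 0 < a -> a < b -> 1 < p ->
  (\int[@lebesgue_measure R]_(t in `[a, b]) (t `^ (- p))%:E =
   ((a `^ (1 - p) - b `^ (1 - p)) / (p - 1))%:E)%E.
Proof.
move=> a0 ab p1; have np : 1 - p != 0 by rewrite subr_eq0 lt_eqF.
have pE : - p = (1 - p) - 1 by ring.
rewrite [in LHS]pE (@continuous_FTC2 R _ (fun t => t `^ (1 - p) / (1 - p)) _ _ ab).
- by rewrite -EFinB; congr (_%:E); field; rewrite np subr_eq0 gt_eqF.
- apply: continuous_in_subspaceT => x; rewrite inE/= in_itv/= => /andP[ax _].
  by apply: powR_continuous_at; exact: lt_le_trans ax.
- split.
  + move=> x; rewrite in_itv/= => /andP[ax _].
    by have [] := is_derive_powR_prim (lt_trans a0 ax) np.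
  + apply: cvg_at_right_filter; apply: cvgMl; exact: powR_continuous_at.
  + apply: cvg_at_left_filter; apply: cvgMl; apply: powR_continuous_at; exact: lt_trans ab.
- move=> x; rewrite in_itv/= => /andP[ax _].
  have dx := is_derive_powR_prim (lt_trans a0 ax) np.
  by rewrite derive1E; apply: derive_val.
Qed.

End power_integrals.

(** * Layers of the truncated kernel *)

Section layer_cake.
Context {R : realType} (d : nat).
Local Notation L := (@LRd R d).
Local Notation leb := (@leb R d).
Local Notation mu := (@lebesgue_measure R).
Implicit Types (E : set 'rV[R]_d) (r s t : R).
Local Open Scope ereal_scope.

(** Minus the derivative of t^(-(d+s)): the density of the layers of the kernel. *)
Definition weight s t : R := ((d%:R + s) * t `^ (- (d%:R + s) - 1))%R.

Lemma weight_ge0 s t : (0 < s)%R -> (0 <= weight s t)%R.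
Proof. by move=> s0; rewrite mulr_ge0 ?powR_ge0// addr_ge0// ltW. Qed.

Lemma measurable_weight s : measurable_fun setT (weight s).
Proof. by apply: measurable_funM; [exact: measurable_cst|exact: measurable_powR]. Qed.

Lemma integral_weight s a : (0 < s)%R -> (0 < a)%R ->
  \int[mu]_(t in `[a, +oo[) (weight s t)%:E = (a `^ (- (d%:R + s)))%:E.
Proof.
move=> s0 a0; have ds : (0 < d%:R + s)%R by rewrite ltr_wpDl.
under eq_integral do rewrite EFinM.
rewrite ge0_integralZl.
- by rewrite integral_powR_y// -EFinM mulrC divfK// gt_eqF.
- exact: measurable_itv.
- by apply/measurable_EFinP; apply: measurable_funTS; exact: measurable_powR.
- by move=> t _; rewrite lee_fin powR_ge0.
- by rewrite lee_fin ltW.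
Qed.

(** The kernel at [u] is the mass of the layers [t > max(r, u)]. Truncating the kernel at [r] thus
    amounts to discarding the layers below [r]. *)
Lemma kern_layer r s u : (0 < r)%R -> (0 < s)%R -> (0 <= u)%R ->
  (kern d r s u)%:E = \int[mu]_(t in `[r, +oo[) ((weight s t)%:E * (\1_(`]-oo, t[) u)%:E).
Proof.
move=> r0 s0 u0; rewrite integral_mkcond /kern.
have mw (D : set R) : measurable_fun D (fun t => (weight s t)%:E).
  by apply: measurable_funTS; apply/measurable_EFinP; exact: measurable_weight.
have [ur|ru] := leP u r.
  transitivity (\int[mu]_(t in `]r, +oo[) (weight s t)%:E).
    by rewrite integral_itv_obnd_cbnd ?integral_weight.
  rewrite -[RHS]integral_mkcond -integral_itv_obnd_cbnd; last first.
    apply: emeasurable_funM; first exact: mw.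
    apply: measurable_funTS; apply/measurable_EFinP.
    rewrite (_ : (fun t => _) = \1_(`]u, +oo[)); first by apply: measurable_indic; exact: measurable_itv.
    by apply/funext => t; apply: indic_iff; rewrite /= !in_itv/= andbT.
  apply: eq_integral => t; rewrite inE/= in_itv/= andbT => rt.
  by rewrite indicE mem_set ?mule1//= in_itv/= (le_lt_trans ur).
transitivity (\int[mu]_(t in `]u, +oo[) (weight s t)%:E).
  by rewrite integral_itv_obnd_cbnd ?integral_weight// (lt_trans r0).
rewrite [LHS]integral_mkcond; apply: eq_integral => t _; rewrite !patchE.
have [ut|ut] := ltP u t.
  rewrite !mem_set/= ?in_itv/= ?andbT ?(ltW (lt_trans ru ut))//.
  by rewrite indicE mem_set ?mule1//= in_itv.
rewrite memNset/=; last by rewrite in_itv/= andbT; apply/negP; rewrite -leNgt.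
case: ifPn => // _; rewrite indicE memNset ?mule0//=.
by rewrite in_itv/=; apply/negP; rewrite -leNgt.
Qed.

Lemma kern_ge0 r s u : (0 <= kern d r s u)%R.
Proof. by rewrite /kern; case: ifP => _; exact: powR_ge0. Qed.

Lemma measurable_kern r s : measurable_fun setT (kern d r s).
Proof.
apply: measurable_fun_ifT.
- by apply: measurable_fun_ler; [exact: measurable_id|exact: measurable_cst].
- exact: measurable_cst.
- exact: measurable_powR.
Qed.

Lemma Jt_V r s E : borel E -> Jt r s E = \int[leb]_h ((kern d r s (eucl_norm h))%:E * V E h).
Proof.
move=> bE; apply: double_integral => //; first exact: measurable_kern.
exact: kern_ge0.
Qed.

Lemma indic_ball_norm t (h : 'rV[R]_d) : (0 < t)%R ->
  \1_(`]-oo, t[) (eucl_norm h) = \1_(ball2 t) h :> R.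
Proof. by move=> t0; apply: indic_iff; rewrite /= in_itv/= eucl_norm_ltE. Qed.

Lemma Jt_layer r s E : borel E -> (0 < r)%R -> (0 < s)%R ->
  Jt r s E = \int[mu]_(t in `[r, +oo[) ((weight s t)%:E * A E t).
Proof.
move=> bE r0 s0; rewrite Jt_V//.
(* Written as a comparison of two measurable functions of [(h, t)], which gives joint measurability;
   it equals the indicator of [ball2 t] for [t > 0]. *)
pose ind (p : L * R) : R := (if eucl_norm p.1 < p.2 then 1 else 0)%R.
pose g (p : L * R) : \bar R := (weight s p.2 * \1_(`[r, +oo[) p.2 * ind p)%:E * V E p.1.
have indE (h : L) t : ind (h, t) = \1_(`]-oo, t[) (eucl_norm h).
  rewrite /ind /= indicE; case: ifPn => ht; first by rewrite mem_set//= in_itv.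
  by rewrite memNset//= in_itv/=; apply/negP.
have ind0 p : (0 <= ind p)%R by rewrite /ind; case: ifP.
have g0 p : 0 <= g p.
  apply: mule_ge0; last exact: V_ge0.
  rewrite lee_fin; apply: mulr_ge0; last exact: ind0.
  by apply: mulr_ge0; [exact: weight_ge0|rewrite indicE].
have mg : measurable_fun setT g.
  apply: emeasurable_funM; last first.
    apply: (measurableT_comp (measurable_V bE)); exact: measurable_fst.
  apply/measurable_EFinP; apply: measurable_funM; first apply: measurable_funM.
  - by apply: (measurableT_comp (measurable_weight s)); exact: measurable_snd.
  - apply: (measurableT_comp (measurable_indic _)); last exact: measurable_snd.
    exact: measurable_itv.
  - apply: measurable_fun_ifT; [|exact: measurable_cst|exact: measurable_cst].
    apply: measurable_fun_ltr; last exact: measurable_snd.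
    by apply: measurable_eucl_norm => i; apply: (measurableT_comp (measurable_coord i)); exact: measurable_fst.
transitivity (\int[leb]_h \int[mu]_t g (h, t)).
  apply: eq_integral => h _; rewrite kern_layer ?sqrtr_ge0//.
  rewrite muleC -ge0_integralZl.
  - rewrite integral_mkcond; apply: eq_integral => t _; rewrite patchE /g indE /= [X in (_ * X * _)%R]indicE.
    by case: ifPn => _; rewrite ?mulr1 ?mulr0 ?mul0r ?mul0e// muleC EFinM.
  - exact: measurable_itv.
  - apply: emeasurable_funM.
      by apply: measurable_funTS; apply/measurable_EFinP; exact: measurable_weight.
    apply: measurable_funTS; apply/measurable_EFinP.
    rewrite (_ : (fun t => _) = \1_(`]eucl_norm h, +oo[)); first by apply: measurable_indic; exact: measurable_itv.
    by apply/funext => t; apply: indic_iff; rewrite /= !in_itv/= andbT.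
  - by move=> t _; rewrite mule_ge0// lee_fin weight_ge0.
  - exact: V_ge0.
rewrite (@fubini_tonelli _ _ _ _ _ leb mu g mg g0).
rewrite [RHS]integral_mkcond; apply: eq_integral => t _; rewrite patchE.
case: ifPn => rt; last first.
  by apply: integral0_eq => h _; rewrite /g /= indicE (negbTE rt) mulr0 mul0r mul0e.
have t0 : (0 < t)%R by move: rt; rewrite inE/= in_itv/= andbT; exact: lt_le_trans.
rewrite -(ge0_integralZl _ measurableT (measurable_Aint t bE) (fun h _ => Aint_ge0 E t h));
  last by rewrite lee_fin weight_ge0.
by apply: eq_integral => h _; rewrite /g /= indE indic_ball_norm// indicE rt mulr1 EFinM muleA.
Qed.

End layer_cake.

(** * Energy estimates and their limits *)

Section energy_bounds.
Context {R : realType} (d : nat).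
Local Notation L := (@LRd R d).
Local Notation leb := (@leb R d).
Local Notation mu := (@lebesgue_measure R).
Implicit Types (E : set 'rV[R]_d) (r s t : R).
Local Open Scope ereal_scope.

(** Measurability of parameter integrals applies to the joint function coded by [eucl_norm h < t];
    positivity of [t] on [D] identifies it with the integrand of [A]. *)
Lemma measurable_A E (D : set R) : borel E -> measurable D -> (forall t, D t -> 0 < t)%R ->
  measurable_fun D (A E).
Proof.
move=> bE mD D0.
pose g (p : L * R) : \bar R := (if (eucl_norm p.1 < p.2)%R then 1%R else 0%R : R)%:E * V E p.1.
have g0 p : 0 <= g p by rewrite /g mule_ge0 ?V_ge0// lee_fin; case: ifP.
have mg : measurable_fun setT g.
  apply: emeasurable_funM; last first.
    apply: (measurableT_comp (measurable_V bE)); exact: measurable_fst.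
  apply/measurable_EFinP.
  apply: measurable_fun_ifT; [|exact: measurable_cst|exact: measurable_cst].
  apply: measurable_fun_ltr; last exact: measurable_snd.
  by apply: measurable_eucl_norm => i; apply: (measurableT_comp (measurable_coord i)); exact: measurable_fst.
have mG := @measurable_fun_fubini_tonelli_G _ _ _ _ _ leb g mg g0.
apply: (eq_measurable_fun (fubini_G leb g)); last exact: measurable_funTS.
move=> t; rewrite inE => /D0 t0; apply: eq_integral => h _; rewrite /g /=.
rewrite indicE; congr (_%:E * _); case: ifPn => ht.
  by rewrite mem_set// /ball2/= -eucl_norm_ltE.
by rewrite memNset// /ball2/= -eucl_norm_ltE//; exact/negP.
Qed.

(** With [m] the integer part of [t0 / t], the multiple [m t] lies above [t0 - t >= (1 - e) t0], and
    [m <= t0 / t] bounds the factor of [A_scale]. *)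
Lemma A_quasi E t t0 e : borel E -> (0 < e < 1)%R -> (0 < t <= e * t0)%R ->
  A E ((1 - e) * t0)%R <= ((t0 / t) ^+ d.+1)%:E * A E t.
Proof.
move=> bE /andP[e0 e1] /andP[t_gt0 te].
have t00 : (0 < t0)%R by rewrite -(pmulr_rgt0 _ e0); exact: lt_le_trans te.
have tt0 : (t <= t0)%R by apply: (le_trans te); rewrite ger_pMl// ltW.
pose m := Num.truncn (t0 / t).
have /andP[m1 m2] : (m%:R <= t0 / t < m.+1%:R)%R by apply: truncn_itv; rewrite divr_ge0// ltW.
have m0 : (0 < m)%N by rewrite truncn_gt0 ler_pdivlMr// mul1r.
apply: (@le_trans _ _ (A E (m%:R * t)%R)).
  apply: A_mono => //; apply/andP; split; first by apply: mulr_ge0; [rewrite subr_ge0 ltW|exact: ltW].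
  have : (t0 < m.+1%:R * t)%R by rewrite -ltr_pdivrMr.
  by rewrite -natr1 mulrDl mul1r mulrBl mul1r; lra.
apply: (le_trans (A_scale t bE m0)).
rewrite lee_wpmul2r ?A_ge0// lee_fin ler_pXn2r ?nnegrE ?divr_ge0 ?(ltW t00) ?(ltW t_gt0)//.
Qed.

Lemma weight_pow s t : (0 < t)%R ->
  (weight d s t * t ^+ d.+1 = (d%:R + s) * t `^ (- s))%R.
Proof.
move=> t0; rewrite /weight -mulrA; congr (_ * _)%R.
rewrite -powR_mulrn ?(ltW t0)// -powRD ?(gt_eqF t0) ?implybT//.
by congr (_ `^ _)%R; rewrite -natr1; ring.
Qed.

(** Keep only the layers in [[r, e t0]]. There [A_quasi] bounds [A E t] below by [(t / t0)^(d+1)]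
    times the value at [(1 - e) t0], and the weight times t^(d+1) is [(d + s)] t^(-s), which
    integrates explicitly. *)
Lemma Jt_lower E r s e t0 : borel E -> (0 < r)%R -> (1 < s)%R -> (0 < e < 1)%R ->
  (r < e * t0)%R ->
  ((d%:R + s) * ((r `^ (1 - s) - (e * t0) `^ (1 - s)) / (s - 1)) / t0 ^+ d.+1)%:E *
  A E ((1 - e) * t0)%R <= Jt r s E.
Proof.
move=> bE r0 s1 e01 re; have /andP[e0 e1] := e01.
have s0 : (0 < s)%R by apply: lt_trans s1.
have t00 : (0 < t0)%R by rewrite -(pmulr_rgt0 _ e0); exact: lt_trans re.
rewrite Jt_layer//.
have sub : `[r, (e * t0)%R] `<=` `[r, +oo[%classic.
  by move=> t /=; rewrite !in_itv/= andbT => /andP[].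
have mwA : measurable_fun `[r, +oo[ (fun t => (weight d s t)%:E * A E t).
  apply: emeasurable_funM.
    by apply: measurable_funTS; apply/measurable_EFinP; exact: measurable_weight.
  apply: measurable_A => // t; rewrite /= in_itv/= andbT; exact: lt_le_trans.
apply: (@le_trans _ _ (\int[mu]_(t in `[r, (e * t0)%R]) ((weight d s t)%:E * A E t))); last first.
  apply: ge0_subset_integral => //.
  by move=> t _; rewrite mule_ge0 ?A_ge0// lee_fin weight_ge0.
have [c cE] : exists c, c = A E ((1 - e) * t0)%R by eexists.
rewrite -cE; have c0 : 0 <= c by rewrite cE A_ge0.
set k := ((d%:R + s) / t0 ^+ d.+1)%R.
have k0 : (0 <= k)%R by rewrite divr_ge0 ?exprn_ge0// ?(ltW t00)// addr_ge0// ltW.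
rewrite [X in X%:E * _](_ : _ = k * ((r `^ (1 - s) - (e * t0) `^ (1 - s)) / (s - 1)))%R; last first.
  by rewrite /k; ring.
have mp : measurable_fun setT (fun t : R => t `^ (- s))%R by exact: measurable_powR.
have mpE (D : set R) : measurable_fun D (fun t : R => (t `^ (- s))%:E)%R.
  by apply: measurable_funTS; apply/measurable_EFinP.
rewrite EFinM -integral_powR// -ge0_integralZl; first last.
- by rewrite lee_fin.
- by move=> t _; rewrite lee_fin powR_ge0.
- exact: mpE.
- exact: measurable_itv.
rewrite muleC -ge0_integralZl; first last.
- exact: c0.
- by move=> t _; rewrite mule_ge0// lee_fin// powR_ge0.
- by apply: emeasurable_funM; [exact: measurable_cst|exact: mpE].
- exact: measurable_itv.
apply: ge0_le_integral.
- exact: measurable_itv.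
- by move=> t _; rewrite !mule_ge0// lee_fin ?powR_ge0.
- apply: emeasurable_funM; first exact: measurable_cst.
  by apply: emeasurable_funM; [exact: measurable_cst|exact: mpE].
- exact: measurable_funS mwA.
move=> t; rewrite /= in_itv/= => /andP[rt te].
have t_gt0 : (0 < t)%R by exact: lt_le_trans rt.
have := A_quasi bE e01 (introT andP (conj t_gt0 te)); rewrite -cE => ct.
rewrite muleC; apply: (@le_trans _ _ ((k * t `^ (- s))%:E * (((t0 / t) ^+ d.+1)%:E * A E t))).
  by rewrite -EFinM lee_wpmul2l// lee_fin mulr_ge0// powR_ge0.
rewrite muleA -EFinM lee_wpmul2r ?A_ge0// lee_fin.
have -> : (k * t `^ (- s) = weight d s t * t ^+ d.+1 / t0 ^+ d.+1)%R.
  by rewrite weight_pow// /k; ring.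
rewrite expr_div_n le_eqVlt; apply/orP; left; apply/eqP.
by rewrite mulrA divfK ?mulfK// gt_eqF// exprn_gt0.
Qed.

(** The bound of order t^(d+1) is used on the layers below 1 and the bound of order t^d above 1,
    where the first one is not integrable enough. *)
Lemma Jt_upper E r s (k M : R) : borel E -> (0 < r < 1)%R -> (1 < s)%R ->
  (0 <= k)%R -> (0 <= M)%R ->
  (forall t, (0 < t)%R -> A E t <= (k * t ^+ d.+1)%:E) ->
  (forall t, (0 < t)%R -> A E t <= (M * t ^+ d)%:E) ->
  Jt r s E <= (k * ((d%:R + s) * ((r `^ (1 - s) - 1) / (s - 1))) + M * ((d%:R + s) / s))%:E.
Proof.
move=> bE /andP[r0 r1] s1 k0 M0 Ak AM.
have s0 : (0 < s)%R by apply: lt_trans s1.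
have ds0 : (0 <= d%:R + s :> R)%R by rewrite addr_ge0// ltW.
rewrite Jt_layer// integral_mkcond.
pose f1 := (fun t => (k * (d%:R + s))%:E * (t `^ (- s))%:E) \_ `[r, 1%R].
pose f2 := (fun t => (M * (d%:R + s))%:E * (t `^ (- s - 1))%:E) \_ `[1%R, +oo[.
have mp p (D : set R) : measurable_fun D (fun t : R => (t `^ p)%:E)%R.
  by apply: measurable_funTS; apply/measurable_EFinP; exact: measurable_powR.
have f10 t : 0 <= f1 t.
  by rewrite /f1 patchE; case: ifP => // _; rewrite -EFinM lee_fin !mulr_ge0// powR_ge0.
have f20 t : 0 <= f2 t.
  by rewrite /f2 patchE; case: ifP => // _; rewrite -EFinM lee_fin !mulr_ge0// powR_ge0.
have mf1 : measurable_fun setT f1.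
  apply/(measurable_restrictT _ _).1; first exact: measurable_itv.
  by apply: emeasurable_funM; [exact: measurable_cst|exact: mp].
have mf2 : measurable_fun setT f2.
  apply/(measurable_restrictT _ _).1; first exact: measurable_itv.
  by apply: emeasurable_funM; [exact: measurable_cst|exact: mp].
apply: (@le_trans _ _ (\int[mu]_t (f1 t + f2 t))).
  apply: ge0_le_integral.
  - exact: measurableT.
  - move=> t _; rewrite patchE; case: ifP => // _.
    by rewrite mule_ge0 ?A_ge0// lee_fin weight_ge0.
  - apply/(measurable_restrictT _ _).1; first exact: measurable_itv.
    apply: emeasurable_funM.
      by apply: measurable_funTS; apply/measurable_EFinP; exact: measurable_weight.
    apply: measurable_A => // t; rewrite /= in_itv/= andbT; exact: lt_le_trans.
  - exact: emeasurable_funD.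
  move=> t _; rewrite [leLHS]patchE; case: ifPn => [rt|_]; last by rewrite adde_ge0.
  move: rt; rewrite inE/= in_itv/= andbT => rt; have t0 : (0 < t)%R by exact: lt_le_trans rt.
  have w0 : 0 <= (weight d s t)%:E by rewrite lee_fin weight_ge0.
  have [t1|t1] := leP t 1%R.
    apply: (@le_trans _ _ (f1 t)); last by rewrite leeDl.
    rewrite /f1 patchE mem_set/=; last by rewrite in_itv/= rt.
    apply: (le_trans (lee_wpmul2l w0 (Ak _ t0))); rewrite -!EFinM lee_fin.
    by rewrite mulrCA weight_pow// mulrA.
  apply: (@le_trans _ _ (f2 t)); last by rewrite leeDr.
  rewrite /f2 patchE mem_set/=; last by rewrite in_itv/= (ltW t1).
  apply: (le_trans (lee_wpmul2l w0 (AM _ t0))); rewrite -!EFinM lee_fin.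
  rewrite powRB ?(gt_eqF t0) ?implybT// powRr1 ?(ltW t0)// mulrCA -[leRHS]mulrA; apply: ler_wpM2l => //.
  by rewrite mulrA -weight_pow// exprSr mulrA mulfK// gt_eqF.
rewrite ge0_integralD//.
rewrite EFinD -!integral_mkcond !ge0_integralZl.
- rewrite integral_powR// integral_powR_y// !powR1 -!EFinM -EFinD lee_fin.
  by rewrite le_eqVlt; apply/orP; left; apply/eqP; ring.
- exact: measurable_itv.
- exact: mp.
- by move=> t _; rewrite lee_fin powR_ge0.
- by rewrite lee_fin mulr_ge0.
- exact: measurable_itv.
- exact: mp.
- by move=> t _; rewrite lee_fin powR_ge0.
- by rewrite lee_fin mulr_ge0.
Qed.

End energy_bounds.

(** * Asymptotics of the normalising factor *)

Section beta_asymptotics.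
Context {R : realType} (d : nat).
Implicit Types (r s k K : R).

(** The integral of t^(-s) over [[r, 1]], a perturbation of [- ln r]. *)
Let X r s : R := (r `^ (1 - s) - 1) / (s - 1).

(** From [1 + z <= exp z] at [z = (1 - s) ln r]. The bound is uniform in [s], so [beta] diverges
    whatever the relative speeds of [r_n] and [s_n]. *)
Lemma oppr_ln_le_X r s : 0 < r -> 1 < s -> - ln r <= X r s.
Proof.
move=> r0 s1; rewrite /X ler_pdivlMr ?subr_gt0// lerBrDl.
rewrite /powR gt_eqF//; apply: le_trans (expR_ge1Dx _).
by rewrite lerD2l; lra.
Qed.

(** Uniform in [s]: factor out k^(1-s), which is at most [1 / k], and use [1 + z <= exp z] for the
    rest. *)
Lemma X_le k s : 0 < k <= 1 -> 1 < s <= 2 -> X k s <= - ln k / k.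
Proof.
move=> /andP[k0 k1] /andP[s1 s2]; rewrite /X ler_pdivrMr ?subr_gt0//.
have kp : k `^ (1 - s) <= k^-1.
  rewrite -powR_inv1 ?(ltW k0)//; apply: ger_powR; rewrite ?k0//.
  by lra.
have h : 1 - k `^ (s - 1) <= (s - 1) * - ln k.
  rewrite /powR gt_eqF//.
  have := expR_ge1Dx ((s - 1) * ln k); lra.
have -> : k `^ (1 - s) - 1 = (1 - k `^ (s - 1)) * k `^ (1 - s).
  rewrite mulrBl mul1r -powRD ?(gt_eqF k0) ?implybT//.
  by rewrite addrA subrK subrr powRr0.
apply: (@le_trans _ _ ((s - 1) * - ln k * k `^ (1 - s))).
  by apply: ler_wpM2r => //; exact: powR_ge0.
have -> : - ln k / k * (s - 1) = (s - 1) * - ln k * k^-1 by ring.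
apply: ler_wpM2l => //; apply: mulr_ge0; first by rewrite subr_ge0 ltW.
by rewrite oppr_ge0 ln_le0.
Qed.

Lemma betaE r s : (d%:R + 1) * beta d r s = (d%:R + s) * X r s + 1.
Proof.
have d1 : (d%:R + 1 : R) != 0 by rewrite natr1 pnatr_eq0.
by rewrite /beta -/(X r s); move: (X r s) => x; field.
Qed.

Variables (r s : nat -> R).
Hypothesis r01 : forall n, 0 < r n < 1.
Hypothesis s1 : forall n, 1 < s n.
Hypothesis r_cvg : r @ \oo --> (0 : R).
Hypothesis s_cvg : s @ \oo --> (1 : R).

Lemma near_r k : 0 < k -> \forall n \near \oo, r n < k.
Proof. by move=> k0; apply: (cvgr_lt 0 r_cvg). Qed.

Lemma near_ln_r K : \forall n \near \oo, K <= - ln (r n).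
Proof.
near=> n; have /andP[r0 _] := r01 n.
rewrite lerNr -[leRHS]expRK ler_ln ?posrE ?expR_gt0//.
by apply: ltW; near: n; apply: near_r; exact: expR_gt0.
Unshelve. all: by end_near. Qed.

Lemma near_s : \forall n \near \oo, 1 < s n <= 2.
Proof.
near=> n; rewrite s1 /=; near: n; apply: (cvgr_le 1 s_cvg).
by rewrite ltr1n.
Unshelve. all: by end_near. Qed.

Lemma beta_gt0 n : 0 < beta d (r n) (s n).
Proof.
have /andP[r0 r1] := r01 n.
have d1 : 0 < (d%:R + 1 : R) by rewrite natr1 ltr0n.
rewrite -(pmulr_rgt0 _ d1) betaE.
rewrite ltr_wpDl// mulr_ge0//; first by rewrite addr_ge0// ltW// (lt_trans _ (s1 n)).
apply: le_trans (oppr_ln_le_X r0 (s1 n)); by rewrite oppr_ge0 ln_le0// ltW.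
Qed.

Lemma near_beta K : \forall n \near \oo, K <= beta d (r n) (s n).
Proof.
near=> n; have Kn : `|K| <= - ln (r n) by near: n; exact: near_ln_r.
have /andP[r0 r1] := r01 n.
have d1 : 0 < (d%:R + 1 : R) by rewrite natr1 ltr0n.
rewrite -(ler_pM2l d1) betaE.
have := le_trans Kn (oppr_ln_le_X r0 (s1 n)); set x := X _ _ => Kx.
have x0 : 0 <= x by apply: le_trans Kx.
apply: (@le_trans _ _ ((d%:R + 1) * x)).
  by rewrite ler_pM2l//; apply: le_trans Kx; exact: ler_norm.
have := s1 n; set y := s n => y1.
have : (d%:R + 1) * x <= (d%:R + y) * x by apply: ler_wpM2r => //; lra.
by lra.
Unshelve. all: by end_near. Qed.

(** Stopping the integral at [k] instead of 1 loses [X k (s n)], which stays bounded while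
    [X (r n) (s n)] diverges; hence any fraction [q < 1] of the normalisation survives. *)
Lemma near_beta_lower k q : 0 < k <= 1 -> 0 <= q < 1 ->
  \forall n \near \oo, r n < k /\
   q * ((d%:R + 1) * beta d (r n) (s n)) <=
   (d%:R + s n) * ((r n `^ (1 - s n) - k `^ (1 - s n)) / (s n - 1)).
Proof.
move=> k01 /andP[q0 q1]; have /andP[k0 k1] := k01.
have K0 : 0 <= - ln k / k by rewrite divr_ge0 ?(ltW k0)// oppr_ge0 ln_le0.
near=> n; split; first by near: n; exact: near_r.
have /andP[r0 r1] := r01 n.
have s12 : 1 < s n <= 2 by near: n; exact: near_s.
have /andP[s1n s2n] := s12.
have := X_le k01 s12; set y := X k (s n) => yK.
have -> : (r n `^ (1 - s n) - k `^ (1 - s n)) / (s n - 1) = X (r n) (s n) - y.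
  by rewrite /y /X -mulrBl; congr (_ / _); ring.
rewrite betaE.
(* The threshold makes [(1 - q) X] exceed the loss by 1; multiplied by [d + s_n >= 1], this surplus
   also absorbs the additive 1 in [betaE]. *)
have : ((- ln k / k) + 1) / (1 - q) <= X (r n) (s n).
  apply: le_trans (oppr_ln_le_X r0 s1n); near: n; exact: near_ln_r.
rewrite ler_pdivrMr ?subr_gt0//; set x := X (r n) (s n) => Kx.
set D := d%:R + s n; have D1 : 1 <= D by rewrite /D ler_wpDl// ltW.
have h1 : D * (- ln k / k + 1) <= D * (x * (1 - q)) by apply: ler_wpM2l => //; apply: le_trans D1.
have h2 : D * y <= D * (- ln k / k) by apply: ler_wpM2l => //; apply: le_trans D1.
lra.
Unshelve. all: by end_near. Qed.

End beta_asymptotics.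

(** * Eventual bounds and upper and lower limits *)

Section limn_einf_bounds.
Context {R : realType}.
Local Open Scope ereal_scope.

Lemma limn_esup_le_near (u : nat -> \bar R) x :
  (\forall n \near \oo, u n <= x) -> limn_esup u <= x.
Proof.
move=> ux; rewrite /limn_esup /limf_esup; apply: (@le_trans _ _ (ereal_sup (u @` [set n | u n <= x]))).
  by apply: ereal_inf_lbound; exists [set n | u n <= x].
by apply: ub_ereal_sup => _ [n /= un <-].
Qed.

Lemma le_limn_einf_near (u : nat -> \bar R) x :
  (\forall n \near \oo, x <= u n) -> x <= limn_einf u.
Proof.
move=> ux; rewrite /limn_einf leeNr; apply: limn_esup_le_near.
by apply: filterS ux => n; rewrite leeN2.
Qed.

End limn_einf_bounds.

(** * Bounds on the normalised energy at fixed scale *)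

Section gamma_bounds.
Context {R : realType} (d : nat).
Local Notation L := (@LRd R d).
Local Notation leb := (@leb R d).
Implicit Types (E : set 'rV[R]_d).

Lemma bernoulli_le (n : nat) (e : R) : 0 <= e <= 1 -> 1 - n%:R * e <= (1 - e) ^+ n.
Proof.
move=> /andP[e0 e1]; elim: n => [|n IH]; first by rewrite expr0 mul0r subr0.
rewrite exprS -natr1.
have h : (1 - e) * (1 - n%:R * e) <= (1 - e) * (1 - e) ^+ n.
  by apply: ler_wpM2l => //; rewrite subr_ge0.
have : 0 <= n%:R * e ^+ 2 by rewrite mulr_ge0// sqr_ge0.
by move: h; nra.
Qed.

(** Lets [e] tend to 0: by Bernoulli the loss is at most [n e a], which the choice of [e] keeps
    below the tolerance [k]. *)
Lemma ler_pow_onem (n : nat) (a b : R) : 0 <= a ->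
  (forall e, 0 < e < 2^-1 -> (1 - e) ^+ n * a <= b) -> a <= b.
Proof.
move=> a0 H; apply/ler_addgt0Pr => k k0.
pose e := Num.min (4^-1) (k / (n%:R * a + 1)).
have p0 : 0 < n%:R * a + 1 by rewrite ltr_wpDl// mulr_ge0.
have e0 : 0 < e by rewrite lt_min invr_gt0 ltr0n/= divr_gt0.
have e4 : e <= 4^-1 by rewrite ge_min lexx.
have ek : e * (n%:R * a + 1) <= k by rewrite -ler_pdivlMr// ge_min lexx orbT.
have := H e; rewrite e0 /= (le_lt_trans e4); last by lra.
move=> /(_ isT) h; have e01 : 0 <= e <= 1 by apply/andP; split; lra.
have := bernoulli_le n e01 => h2.
have h3 : (1 - n%:R * e) * a <= (1 - e) ^+ n * a by apply: ler_wpM2r.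
by move: ek h h3 e0; nra.
Qed.

Lemma A_fin E t : borel E -> (leb E < +oo)%E -> A E t \is a fin_num.
Proof.
move=> bE Eoo; rewrite ge0_fin_numE ?A_ge0//.
apply: le_lt_trans (A_le t bE) _.
by apply: lte_mul_pinfty; rewrite ?measure_ge0 ?leb_ball2_lty// ge0_fin_numE// measure_ge0.
Qed.

Variables (r s : nat -> R).
Hypothesis r01 : forall n, 0 < r n < 1.
Hypothesis s1 : forall n, 1 < s n.
Hypothesis r_cvg : r @ \oo --> (0 : R).
Hypothesis s_cvg : s @ \oo --> (1 : R).

Local Notation J F := (fun n => Jt (r n) (s n) (F n) * ((beta d (r n) (s n))^-1)%:E)%E.

(** The threshold in [n] comes before the quantifier over [E], so the bound may be applied to sets
    varying with [n]. It is [Jt_lower] at the scale [t / (1 - e)]: changing scale costs [d.+1]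
    factors [1 - e], the fraction of [beta] retained costs the last one. *)
Lemma near_energy_lower (e t : R) : 0 < e < 2^-1 -> 0 < t <= 1 ->
  \forall n \near \oo, forall E, borel E ->
   (((1 - e) ^+ d.+2 * (d.+1%:R / t ^+ d.+1))%R%:E * A E t <=
     Jt (r n) (s n) E * ((beta d (r n) (s n))^-1)%:E)%E.
Proof.
move=> /andP[e0 e2] /andP[t0 t1].
have e1 : 0 < 1 - e by lra.
pose t' := t / (1 - e).
have tE : t = (1 - e) * t' by rewrite /t' mulrC divfK// gt_eqF.
have t'0 : 0 < t' by rewrite divr_gt0.
have k01 : 0 < e * t' <= 1.
  rewrite mulr_gt0//= /t' mulrA ler_pdivrMr// mul1r.
  by apply: (@le_trans _ _ (e * 1)); [rewrite ler_pM2l|lra].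
have q01 : 0 <= 1 - e < 1 by apply/andP; split; lra.
have := near_beta_lower d r01 s1 r_cvg s_cvg k01 q01; apply: filterS => n [rn bn] E bE.
have b0 := beta_gt0 d r01 s1 n.
have /andP[r0 r1] := r01 n.
have e01 : 0 < e < 1 by apply/andP; split; lra.
have := Jt_lower bE r0 (s1 n) e01 rn; rewrite -tE => Jl.
rewrite muleC lee_pdivlMr//; apply: le_trans Jl.
rewrite -muleA -EFinM muleC; apply: lee_wpmul2r; first exact: A_ge0.
rewrite lee_fin ler_pdivlMr ?exprn_gt0//; apply: le_trans bn.
rewrite le_eqVlt; apply/orP; left; apply/eqP.
rewrite {1}tE exprMn -natr1 exprS; field.
by rewrite !expf_neq0 ?gt_eqF.
Qed.

(** At a fixed scale [t] the quantity [A] is continuous for L^1 convergence, so the bound from below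
    on the energy of [En n] becomes one in terms of [A E t]. *)
Lemma gamma_lower (E : set 'rV[R]_d) (En : nat -> set 'rV[R]_d) (l t : R) :
  borel E -> (leb E < +oo)%E -> (forall n, borel (En n)) ->
  (forall k : R, 0 < k -> \forall n \near \oo,
     (leb (E `\` En n) + leb (En n `\` E) <= k%:E)%E) ->
  (limn_einf (J En) <= l%:E)%E -> 0 < t <= 1 ->
  (A E t <= (l / d.+1%:R * t ^+ d.+1)%:E)%E.
Proof.
move=> bE Eoo bEn cvgE Jl t01; have /andP[t0 t1] := t01.
have td : 0 < t ^+ d.+1 by rewrite exprn_gt0.
have fA := A_fin t bE Eoo.
rewrite -(fineK fA) lee_fin; set a := fine (A E t).
have a0 : 0 <= a by rewrite fine_ge0// A_ge0.
have b0 : 0 < fine (leb (ball2 t)).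
  by rewrite fine_gt0// leb_ball2_gt0//= leb_ball2_lty.
have fb : leb (ball2 t) \is a fin_num by rewrite ge0_fin_numE ?leb_ball2_lty// measure_ge0.
apply: (ler_pow_onem (n := d.+2)) => // e e01.
apply/ler_addgt0Pr => k k0.
(* With this tolerance on the symmetric difference, [A_diff] changes [A] by at most [k]. *)
pose eta := k / fine (leb (ball2 t)).
have eta0 : 0 < eta by rewrite divr_gt0.
have pe : 0 <= (1 - e) ^+ d.+2 <= 1.
  have /andP[h1 h2] := e01.
  by rewrite exprn_ge0 ?exprn_ile1//; lra.
have /andP[pe0 pe1] := pe.
pose c := (1 - e) ^+ d.+2 * (d.+1%:R / t ^+ d.+1).
have c0 : 0 <= c by rewrite mulr_ge0// divr_ge0// ltW.
suff : ((c * (a - k))%:E <= l%:E)%E.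
  rewrite lee_fin /c => h.
  have h2 : (1 - e) ^+ d.+2 * (a - k) <= l / d.+1%:R * t ^+ d.+1.
    have -> : (1 - e) ^+ d.+2 * (a - k) = (1 - e) ^+ d.+2 * (d.+1%:R / t ^+ d.+1) * (a - k) / d.+1%:R * t ^+ d.+1.
      have D0 : d.+1%:R != 0 :> R by rewrite pnatr_eq0.
      have T0 : t ^+ d.+1 != 0 by rewrite gt_eqF.
      move: D0 T0; move: (d.+1%:R : R) (t ^+ d.+1) (_ ^+ d.+2) => D T P D0 T0.
      by field; rewrite D0.
    by apply: ler_wpM2r; [exact: ltW|apply: ler_wpM2r].
  have : (1 - e) ^+ d.+2 * k <= k by rewrite ger_pMl.
  move: h2; move: (l / _ * _) (_ ^+ d.+2) => Q P h2.
  by move: h2; rewrite [P * (a - k)]mulrBr; lra.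
apply: le_trans Jl; apply: le_limn_einf_near.
have h1 := near_energy_lower e01 t01.
near=> n.
have h2 : (leb (E `\` En n) + leb (En n `\` E) <= eta%:E)%E by near: n; exact: cvgE.
apply: (@le_trans _ _ (c%:E * A (En n) t)%E); last by have := bEn n; near: n; apply: filterS h1 => n /(_ (En n)).
rewrite EFinM; apply: lee_wpmul2l; first by rewrite lee_fin.
rewrite EFinB leeBlDr// /a fineK//.
apply: (le_trans (A_diff t bE (bEn n))); rewrite leeD2l//.
have -> : k%:E = (eta%:E * leb (ball2 t))%E.
  by rewrite -(fineK fb) -EFinM /eta divfK// gt_eqF.
by apply: lee_wpmul2r; rewrite ?measure_ge0.
Unshelve. all: by end_near. Qed.

(** The layers below 1 give at most [k d.+1] times [beta]; those above 1 give a bounded term,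
    negligible after division by [beta]. *)
Lemma gamma_upper (E : set 'rV[R]_d) (k : R) :
  borel E -> (leb E < +oo)%E -> 0 <= k ->
  (forall t, 0 < t -> (A E t <= (k * t ^+ d.+1)%:E)%E) ->
  (limn_esup (J (fun=> E)) <= (k * d.+1%:R)%:E)%E.
Proof.
move=> bE Eoo k0 Ak.
pose M := fine (leb E) * fine (leb (ball2 1)).
have fE : leb E \is a fin_num by rewrite ge0_fin_numE ?measure_ge0.
have fb : leb (ball2 1) \is a fin_num by rewrite ge0_fin_numE ?leb_ball2_lty// measure_ge0.
have M0 : 0 <= M by rewrite mulr_ge0// fine_ge0// measure_ge0.
have AM t : 0 < t -> (A E t <= (M * t ^+ d)%:E)%E.
  move=> t0; apply: (le_trans (A_le t bE)).
  rewrite -[X in (_ * X <= _)%E]/(@Defs.leb R d (ball2 t)) leb_ball2_scale//.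
  rewrite -(fineK fE) -[X in (_ * (_ * X) <= _)%E](fineK fb) -!EFinM lee_fin /M.
  by rewrite le_eqVlt; apply/orP; left; apply/eqP; ring.
apply/lee_addgt0Pr => e e0; apply: limn_esup_le_near.
near=> n.
have b0 := beta_gt0 d r01 s1 n; have /andP[r0 r1] := r01 n.
have s12 : 1 < s n <= 2 by near: n; exact: near_s.
have /andP[s1n s2n] := s12.
have s0 : 0 < s n by exact: lt_trans s1n.
rewrite -EFinD lee_pdivrMr//.
apply: (le_trans (Jt_upper bE (r01 n) s1n k0 M0 Ak AM)); rewrite -EFinM lee_fin.
have bE1 := betaE d (r n) (s n).
(* Since [(d + s) / s <= d + 2], this makes the bounded term at most [e] times [beta]. *)
have : M * d.+2%:R / e <= beta d (r n) (s n) by near: n; exact: near_beta.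
rewrite ler_pdivrMr// => h1.
have h2 : M * ((d%:R + s n) / s n) <= M * d.+2%:R.
  apply: ler_wpM2l => //; rewrite ler_pdivrMr//.
  have : d%:R * 1 <= d%:R * s n by apply: ler_wpM2l => //; exact: ltW.
  by rewrite -addn2 natrD; nra.
have h3 : (d%:R + s n) * ((r n `^ (1 - s n) - 1) / (s n - 1)) <= d.+1%:R * beta d (r n) (s n).
  by rewrite -natr1 bE1 lerDl.
have h4 := ler_wpM2l k0 h3.
have -> : (k * d.+1%:R + e) * beta d (r n) (s n) =
    k * (d.+1%:R * beta d (r n) (s n)) + beta d (r n) (s n) * e by ring.
by apply: lerD => //; exact: le_trans h1.
Unshelve. all: by end_near. Qed.

End gamma_bounds.

(** * Functions of class C^{1,1} and mollification *)

Section taylor.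
Context {R : realType} (d : nat).
Implicit Types (g : 'rV[R]_d -> R) (Dg : 'rV[R]_d -> 'rV[R]_d) (C : R) (x h k : 'rV[R]_d).

(* a global quadratic bound makes g of class C^{1,1} with gradient Dg *)
Definition taylor g Dg C :=
  forall x h, `|g (x + h) - g x - dot (Dg x) h| <= C * nsq h.

Lemma nsq_le_norm h : nsq h <= d%:R * `|h| ^+ 2.
Proof.
have -> : d%:R * `|h| ^+ 2 = \sum_(i < d) `|h| ^+ 2 by rewrite sumr_const card_ord mulr_natl.
apply: ler_sum => i _; rewrite -(real_normK (num_real (h ord0 i))) ler_pXn2r ?nnegrE//.
by rewrite [leRHS]mx_normrE; apply: le_trans (le_bigmax _ _ (ord0, i)).
Qed.

Lemma taylor_ge0 g Dg C h : taylor g Dg C -> 0 <= C * nsq h.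
Proof. by move=> /(_ 0 h); apply: le_trans. Qed.

(** With [l] of length [|k|] along the i-th axis, compare the expansions from [x] to [x + k], from
    [x + k] to [x + k + l] and from [x] to [x + k + l]. The errors are [1], [1] and [4] times
    [C |k|^2], whence the constant 6 after division by [|k|]. *)
Lemma taylor_lipschitz g Dg C x k i : taylor g Dg C ->
  `|Dg (x + k) ord0 i - Dg x ord0 i| <= 6 * C * eucl_norm k.
Proof.
move=> T; set m := eucl_norm k.
have [k0|k0] := eqVneq (nsq k) 0.
  by rewrite /m eucl_normE k0 sqrtr0 mulr0 (nsq_eq0 k0) addr0 subrr normr0.
have m0 : 0 < m by rewrite sqrtr_gt0 lt_neqAle eq_sym k0 nsq_ge0.
pose l : 'rV[R]_d := m *: delta_mx ord0 i.
have nl : nsq l = m ^+ 2.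
  by rewrite nsqZ -dotxx dot_delta mxE !eqxx mulr1.
have nk : nsq k = m ^+ 2 by rewrite eucl_norm_sq.
have C0 : 0 <= C.
  by have := taylor_ge0 k T; rewrite pmulr_lge0// nk exprn_gt0.
have nkl : nsq (k + l) <= 4 * m ^+ 2.
  rewrite nsqD nl nk; have := cauchy_schwarz k l.
  by rewrite [eucl_norm l]eucl_normE nl sqrtr_sqr gtr0_norm// -/m; nra.
have h1 := T (x + k) l; have h2 := T x (k + l); have h3 := T x k.
move: h1 h2 h3; rewrite addrA nl nk dotDr => h1 h2 h3.
have h4 : C * nsq (k + l) <= C * (4 * m ^+ 2) by exact: ler_wpM2l.
have dl (v : 'rV[R]_d) : dot v l = m * v ord0 i by rewrite dotZr dot_delta.
move: h1 h2 h3; rewrite !dl => h1 h2 h3.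
rewrite -(ler_pM2l m0) -[X in X * `|_|](gtr0_norm m0) -normrM.
have -> : m * (6 * C * m) = C * m ^+ 2 + C * (4 * m ^+ 2) + C * m ^+ 2 by ring.
move: h1 (le_trans h2 h4) h3; rewrite !ler_norml => /andP[? ?] /andP[? ?] /andP[? ?].
by apply/andP; split; lra.
Qed.

Lemma eucl_norm_le_norm h : eucl_norm h <= (d%:R + 1) * `|h|.
Proof.
rewrite -(@ler_pXn2r _ 2)// ?nnegrE ?eucl_norm_ge0// ?mulr_ge0//.
rewrite eucl_norm_sq exprMn; apply: (le_trans (nsq_le_norm h)).
apply: ler_wpM2r; first exact: sqr_ge0.
have : 0 <= (d%:R : R) by []. by nra.
Qed.

Lemma taylor_continuousD g Dg C i : taylor g Dg C -> continuous (fun x => Dg x ord0 i).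
Proof.
move=> T x; apply/(@cvgrPdist_le _ _ _ (nbhs x)) => e e0.
pose K : R := 6 * `|C| * (d%:R + 1) + 1.
have K0 : 0 < K by rewrite /K ltr_wpDl// mulr_ge0// mulr_ge0.
have TK y : `|Dg x ord0 i - Dg y ord0 i| <= K * `|x - y|.
  rewrite distrC -[in Dg y](subrK x y) (addrC _ x).
  apply: (le_trans (taylor_lipschitz _ _ _ T)).
  apply: (@le_trans _ _ (6 * `|C| * ((d%:R + 1) * `|x - y|))).
    apply: (@le_trans _ _ (6 * `|C| * eucl_norm (y - x))).
      by apply: ler_wpM2r; [exact: eucl_norm_ge0|rewrite ler_pM2l// ler_norm].
    apply: ler_wpM2l; first by rewrite mulr_ge0.
    by rewrite (distrC x); exact: eucl_norm_le_norm.
  by rewrite mulrA; apply: ler_wpM2r => //; rewrite lerDl.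
near=> y; apply: (le_trans (TK y)).
rewrite -ler_pdivlMl//; near: y; apply: cvgr_dist_le => //.
by rewrite mulrC divr_gt0.
Unshelve. all: by end_near. Qed.

(** Applied to [g] minus its linear part at [x], so that only a zero differential has to be
    recognised. *)
Lemma quadratic_differentiable (r : 'rV[R]_d -> R) C x :
  (forall h, `|r (h + x) - r x| <= C * nsq h) -> differentiable r x.
Proof.
move=> rC.
have C0 h : 0 <= C * nsq h by exact: le_trans (rC h).
pose df : {linear 'rV[R]_d -> R} := \0.
have cdf : continuous df by move=> z; exact: (@cst_continuous _ _ (0 : R)).
have rE : r \o shift x = cst (r x) + df +o_ (0 : 'rV[R]_d) id.
  apply/eqaddoP => _/posnumP[e]; near=> h.
  rewrite /= fctE/= fctE/= addr0; apply: (le_trans (rC h)).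
  apply: (@le_trans _ _ (`|C| * (d%:R * `|h| ^+ 2))).
    apply: (@le_trans _ _ (`|C| * nsq h)).
      by apply: ler_wpM2r; [exact: nsq_ge0|exact: ler_norm].
    by apply: ler_wpM2l => //; exact: nsq_le_norm.
  rewrite mulrA expr2 mulrA; apply: ler_wpM2r => //.
  apply: (@le_trans _ _ ((`|C| * d%:R + 1) * `|h|)).
    by apply: ler_wpM2r => //; rewrite lerDl.
  have p0 : 0 < `|C| * d%:R + 1 by rewrite ltr_wpDl// mulr_ge0.
  rewrite -ler_pdivlMl//; near: h; exact: nbhs0_le.
have := diff_unique cdf rE => dE.
by apply/diff_locallyP; rewrite dE.
Unshelve. all: by end_near. Qed.

Lemma dot_differentiable v x : differentiable (fun y => dot y v : R) x.
Proof.
rewrite /dot (_ : (fun y => _) = \sum_(i < d) (v ord0 i \*: (fun y : 'rV[R]_d => y ord0 i))).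
  by apply: differentiable_sum => i; apply: differentiableZ; exact: differentiable_coord.
by apply/funext => y; rewrite fct_sumE; apply: eq_bigr => i _; rewrite mulrC.
Qed.

Lemma taylor_differentiable g Dg C x : taylor g Dg C -> differentiable g x.
Proof.
move=> T; rewrite (_ : g = (fun y => g y - dot y (Dg x)) + (fun y => dot y (Dg x))); last first.
  by apply/funext => y; rewrite fctE subrK.
apply: differentiableD; last exact: dot_differentiable.
apply: (@quadratic_differentiable _ C) => h.
rewrite dotDl (_ : _ - _ = g (x + h) - g x - dot (Dg x) h) ?T//.
by rewrite (addrC h) (dotC h); ring.
Qed.

Lemma taylor_derive g Dg C x i : taylor g Dg C ->
  'D_(delta_mx ord0 i) g x = Dg x ord0 i.
Proof.
move=> T; apply: cvg_lim => //.
apply/(@cvgrPdist_le _ _ _ (0^')) => e e0; near=> h.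
have h0 : h != 0 by near: h; exact: nbhs_dnbhs_neq.
have := T x (h *: delta_mx ord0 i); rewrite dotZr dot_delta nsqZ -dotxx dot_delta mxE !eqxx mulr1.
move=> Th; rewrite /= -(ler_pM2l (x := `|h|)) ?normr_gt0// -normrM.
rewrite [X in `|X|](_ : _ = - (g (x + h *: delta_mx ord0 i) - g x - h * Dg x ord0 i)); last first.
  rewrite /GRing.scale/= mulrBr mulrA mulfV// mul1r (addrC _ x); ring.
rewrite normrN; apply: (le_trans Th).
rewrite -(real_normK (num_real h)) expr2 mulrA [leRHS]mulrC; apply: ler_wpM2r => //.
apply: (@le_trans _ _ ((`|C| + 1) * `|h|)).
  by apply: ler_wpM2r => //; apply: (le_trans (ler_norm C)); rewrite lerDl.
have p0 : 0 < `|C| + 1 by rewrite ltr_wpDl.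
rewrite -ler_pdivlMl//; near: h; apply: dnbhs0_le.
by rewrite mulrC divr_gt0.
Unshelve. all: by end_near. Qed.

Lemma taylor_translate g Dg C v : taylor g Dg C ->
  taylor (fun x => g (x + v)) (fun x => Dg (x + v)) C.
Proof. by move=> T x h; rewrite (addrAC x h v); exact: T. Qed.

Lemma taylor_reflect g Dg C y : taylor g Dg C ->
  taylor (fun x => g (y - x)) (fun x => - Dg (y - x)) C.
Proof.
move=> T x h; have := T (y - x) (- h).
by rewrite nsqN dotNr dotNl opprD addrA.
Qed.

Lemma taylorZ g Dg C a : taylor g Dg C -> taylor (fun x => a * g x) (fun x => a *: Dg x) (`|a| * C).
Proof.
move=> T x h; rewrite dotZl -!mulrBr normrM -mulrA; apply: ler_wpM2l => //; exact: T.
Qed.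

Lemma taylor_sum n (g : 'I_n -> 'rV[R]_d -> R) (Dg : 'I_n -> 'rV[R]_d -> 'rV[R]_d) C :
  (forall i, taylor (g i) (Dg i) C) ->
  taylor (fun x => \sum_(i < n) g i x) (fun x => \sum_(i < n) Dg i x) (n%:R * C).
Proof.
move=> T x h; have -> : dot (\sum_(i < n) Dg i x) h = \sum_(i < n) dot (Dg i x) h.
  rewrite /dot exchange_big/=; apply: eq_bigr => i _.
  by rewrite summxE mulr_suml.
rewrite -!sumrB; apply: (le_trans (ler_norm_sum _ _ _)).
apply: (@le_trans _ _ (\sum_(i < n) C * nsq h)); first by apply: ler_sum => i _; exact: T.
by rewrite sumr_const card_ord -[X in X <= _]mulr_natl mulrA.
Qed.

(** The bridge from quadratic bounds to admissible test fields: the bound gives differentiability,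
    Lipschitz partial derivatives and the formula for the divergence. *)
Lemma C1c_field_taylor (p : 'I_d -> 'rV[R]_d -> R) (Dp : 'I_d -> 'rV[R]_d -> 'rV[R]_d) C M :
  (forall i, taylor (p i) (Dp i) C) -> (forall i x, M < `|x| -> p i x = 0) ->
  C1c_field (fun x => \row_i p i x) /\
  forall x, divergence (fun x => \row_i p i x) x = \sum_(i < d) Dp i x ord0 i.
Proof.
move=> T supp; have pE j : (fun y : 'rV[R]_d => (\row_i p i y) ord0 j) = p j.
  by apply/funext => y; rewrite mxE.
split; last first.
  by move=> x; apply: eq_bigr => i _; rewrite pE (taylor_derive _ _ (T i)).
split.
- move=> x; rewrite (_ : (fun x => _) = \sum_(i < d) (fun y : 'rV[R]_d => p i y *: (delta_mx ord0 i : 'rV[R]_d))).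
    apply: differentiable_sum => i; apply: differentiableZl; exact: taylor_differentiable (T i).
  apply/funext => y; rewrite fct_sumE; apply/rowP => j; rewrite !mxE summxE.
  rewrite (bigD1 j)//= big1 ?addr0 ?mxE ?eqxx ?mulr1// => i ij.
  by rewrite !mxE eqxx (eq_sym j i) (negbTE ij) mulr0.
- move=> i j; rewrite pE.
  rewrite (_ : (fun x => _) = (fun x => Dp j x ord0 i)); first exact: taylor_continuousD (T j).
  by apply/funext => x; rewrite (taylor_derive _ _ (T j)).
- apply: bounded_closed_compact; last exact: closed_closure.
  have cM : closed [set x : 'rV[R]_d | `|x| <= M].
    apply: (@closed_comp _ _ (fun x : 'rV[R]_d => `|x|) [set y | y <= M]); last exact: closed_le.
    by move=> x _; exact: norm_continuous.
  have sub : closure [set x | \row_i p i x != 0] `<=` [set x : 'rV[R]_d | `|x| <= M].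
    rewrite [X in _ `<=` X](iffLR (closure_id _) cM); apply: closure_subset => x /= /negP px; rewrite leNgt.
    by apply/negP => Mx; apply: px; apply/eqP/rowP => i; rewrite !mxE supp.
  exists M; split; first exact: num_real.
  by move=> M' MM' x /sub /= xM; exact: (le_trans xM (ltW MM')).
Qed.
End taylor.

(** * Real integrals of bounded measurable functions *)

Section bounded_measurable.
Context d (T : measurableType d) (R : realType) (m : {measure set T -> \bar R}).
Variable D : set T.
Hypotheses (mD : measurable D) (Doo : (m D < +oo)%E).
Implicit Types f g : T -> R.

(** On a set of finite measure this class is integrable and closed under sums and products, so
    linearity and monotonicity hold for real-valued integrals without further conditions. *)
Definition bmf f := measurable_fun D f /\ exists M, forall x, D x -> `|f x| <= M.

Lemma bmf_integrable f : bmf f -> m.-integrable D (EFin \o f).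
Proof.
move=> [mf [M fM]]; apply: measurable_bounded_integrable => //.
exists M; split; first exact: num_real.
by move=> M' MM' x /fM xM; exact: (le_trans xM (ltW MM')).
Qed.

Lemma bmf_cst c : bmf (fun=> c).
Proof. by split; [exact: measurable_cst|exists `|c|]. Qed.

Lemma bmfD f g : bmf f -> bmf g -> bmf (fun x => f x + g x).
Proof.
move=> [mf [M fM]] [mg [N gN]]; split; first exact: measurable_funD.
exists (M + N) => x Dx; apply: (le_trans (ler_normD _ _)); apply: lerD; [exact: fM|exact: gN].
Qed.

Lemma bmfM f g : bmf f -> bmf g -> bmf (fun x => f x * g x).
Proof.
move=> [mf [M fM]] [mg [N gN]]; split; first exact: measurable_funM.
exists (M * N) => x Dx; rewrite normrM; apply: ler_pM => //; [exact: fM|exact: gN].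
Qed.

Lemma bmfZ c f : bmf f -> bmf (fun x => c * f x).
Proof. by move=> bf; apply: (bmfM (bmf_cst c) bf). Qed.

Lemma bmfB f g : bmf f -> bmf g -> bmf (fun x => f x - g x).
Proof.
move=> bf bg; have := bmfD bf (bmfZ (-1) bg).
by congr bmf; apply/funext => x; rewrite mulN1r.
Qed.

Lemma bmf_sum n (f : 'I_n -> T -> R) : (forall i, bmf (f i)) -> bmf (fun x => \sum_(i < n) f i x).
Proof.
move=> bf; elim: n f bf => [|n IH] f bf.
  by rewrite (_ : (fun x => _) = fun=> 0); [exact: bmf_cst|apply/funext => x; rewrite big_ord0].
rewrite (_ : (fun x => _) = fun x => f ord0 x + \sum_(i < n) f (lift ord0 i) x).
  by apply: bmfD => //; apply: IH.
by apply/funext => x; rewrite big_ord_recl.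
Qed.

Local Notation RI f := (Rintegral m D f).

Lemma RI_D f g : bmf f -> bmf g -> RI (fun x => f x + g x) = RI f + RI g.
Proof. by move=> bf bg; apply: RintegralD => //; exact: bmf_integrable. Qed.

Lemma RI_B f g : bmf f -> bmf g -> RI (fun x => f x - g x) = RI f - RI g.
Proof. by move=> bf bg; apply: RintegralB => //; exact: bmf_integrable. Qed.

Lemma RI_Z c f : bmf f -> RI (fun x => c * f x) = c * RI f.
Proof. by move=> bf; apply: RintegralZl => //; exact: bmf_integrable. Qed.

Lemma RI_sum n (f : 'I_n -> T -> R) : (forall i, bmf (f i)) ->
  RI (fun x => \sum_(i < n) f i x) = \sum_(i < n) RI (f i).
Proof.
elim: n f => [|n IH] f bf.
  rewrite big_ord0 (_ : (fun x => _) = fun=> 0); last by apply/funext => x; rewrite big_ord0.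
  by rewrite Rintegral_cst// mul0r.
rewrite big_ord_recl (_ : (fun x => _) = fun x => f ord0 x + \sum_(i < n) f (lift ord0 i) x); last first.
  by apply/funext => x; rewrite big_ord_recl.
rewrite RI_D ?IH//; exact: bmf_sum.
Qed.

Lemma RI_le f g : bmf f -> bmf g -> (forall x, D x -> f x <= g x) -> RI f <= RI g.
Proof. by move=> bf bg; apply: le_Rintegral => //; exact: bmf_integrable. Qed.

Lemma RI_cst c : RI (fun=> c) = c * fine (m D).
Proof. exact: Rintegral_cst. Qed.

Lemma RI_norm_le f M : bmf f -> (forall x, D x -> `|f x| <= M) -> `|RI f| <= M * fine (m D).
Proof.
move=> bf fM; rewrite -RI_cst ler_norml; apply/andP; split.
  rewrite -mulN1r -(RI_Z _ (bmf_cst M)); apply: RI_le => //; first exact/bmfZ/bmf_cst.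
  by move=> x /fM; rewrite ler_norml mulN1r => /andP[].
by apply: RI_le => //; [exact: bmf_cst|move=> x /fM; rewrite ler_norml => /andP[]].
Qed.

Lemma RI_E f : bmf f -> (\int[m]_(x in D) (f x)%:E = (RI f)%:E)%E.
Proof.
move=> bf; rewrite /Rintegral fineK//; apply: integrable_fin_num => //.
exact: bmf_integrable.
Qed.

End bounded_measurable.

(** * Fubini for bounded functions *)

Section fubini_bounded.
Context d1 d2 (T1 : measurableType d1) (T2 : measurableType d2) (R : realType).
Variables (m1 : {sigma_finite_measure set T1 -> \bar R}) (m2 : {sigma_finite_measure set T2 -> \bar R}).
Variables (D1 : set T1) (D2 : set T2).
Hypotheses (mD1 : measurable D1) (mD2 : measurable D2).
Hypotheses (D1oo : (m1 D1 < +oo)%E) (D2oo : (m2 D2 < +oo)%E).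
Variables (u : T1 * T2 -> R) (M : R).
Hypotheses (mu : measurable_fun setT u) (uM : forall p, `|u p| <= M).

Let bmf1 y : bmf D1 (fun x => u (x, y)).
Proof.
split; last by exists M.
apply: measurable_funTS; exact: (measurableT_comp mu (pair2_measurable y)).
Qed.

Let bmf2 x : bmf D2 (fun y => u (x, y)).
Proof.
split; last by exists M.
apply: measurable_funTS; exact: (measurableT_comp mu (pair1_measurable x)).
Qed.

(** Adding the bound [M] makes the integrand nonnegative, so that Tonelli applies; the added
    constant has the same integral in both orders and is removed at the end. *)
Let v (p : T1 * T2) : R := \1_D1 p.1 * \1_D2 p.2 * (u p + M).

Let M0 p : 0 <= u p + M.
Proof. by have := uM p; rewrite ler_norml => /andP[h _]; rewrite -lerBlDr sub0r. Qed.

Let mv : measurable_fun setT v.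
Proof.
apply: measurable_funM; last by apply: measurable_funD; [exact: mu|exact: measurable_cst].
apply: measurable_funM.
  exact: (measurableT_comp (measurable_indic mD1) measurable_fst).
exact: (measurableT_comp (measurable_indic mD2) measurable_snd).
Qed.

Let v0 p : (0 <= (v p)%:E)%E.
Proof. by rewrite lee_fin mulr_ge0. Qed.

Let inner1 x : (\int[m2]_y (v (x, y))%:E =
  (\1_D1 x * (Rintegral m2 D2 (fun y => u (x, y)) + M * fine (m2 D2)))%:E)%E.
Proof.
rewrite -(RI_cst m2 mD2) -RI_D//; last exact: bmf_cst.
rewrite EFinM -RI_E//; last by apply: bmfD => //; exact: bmf_cst.
rewrite -ge0_integralZl//.
- rewrite [RHS]integral_mkcond; apply: eq_integral => y _; rewrite patchE /v /= [\1_D2 y]indicE.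
  by case: ifPn => _; rewrite ?mulr1 ?mulr0 ?mul0r.
- apply/measurable_EFinP; apply: measurable_funD; [exact: (bmf2 x).1|exact: measurable_cst].
- by move=> y _; rewrite lee_fin.
Qed.

Let inner2 y : (\int[m1]_x (v (x, y))%:E =
  (\1_D2 y * (Rintegral m1 D1 (fun x => u (x, y)) + M * fine (m1 D1)))%:E)%E.
Proof.
rewrite -(RI_cst m1 mD1) -RI_D//; last exact: bmf_cst.
rewrite EFinM -RI_E//; last by apply: bmfD => //; exact: bmf_cst.
rewrite -ge0_integralZl//.
- rewrite [RHS]integral_mkcond; apply: eq_integral => x _; rewrite patchE /v /= [\1_D1 x]indicE.
  by case: ifPn => _; rewrite ?mulr1 ?mulr0 ?mul0r ?mul1r// mulr0 mul0r.
- apply/measurable_EFinP; apply: measurable_funD; [exact: (bmf1 y).1|exact: measurable_cst].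
- by move=> x _; rewrite lee_fin.
Qed.

Lemma bmf_inner1 : bmf D1 (fun x => Rintegral m2 D2 (fun y => u (x, y))).
Proof.
split; last first.
  exists (M * fine (m2 D2)) => x _; exact: RI_norm_le.
have := @measurable_fun_fubini_tonelli_F _ _ _ _ _ m2 _ ((measurable_EFinP _ _).2 mv) v0.
rewrite /fubini_F => mF.
have mF' : measurable_fun setT (fun x => \1_D1 x * (Rintegral m2 D2 (fun y => u (x, y)) + M * fine (m2 D2))).
  apply/measurable_EFinP; move: mF; congr measurable_fun; apply/funext => x; exact: inner1.
apply: (eq_measurable_fun (fun x => \1_D1 x * (Rintegral m2 D2 (fun y => u (x, y)) + M * fine (m2 D2)) - M * fine (m2 D2))).
  by move=> x xD; rewrite indicE xD mul1r addrK.
by apply: measurable_funTS; apply: measurable_funB; [exact: mF'|exact: measurable_cst].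
Qed.

Lemma bmf_inner2 : bmf D2 (fun y => Rintegral m1 D1 (fun x => u (x, y))).
Proof.
split; last first.
  exists (M * fine (m1 D1)) => y _; exact: RI_norm_le.
have := @measurable_fun_fubini_tonelli_G _ _ _ _ _ m1 _ ((measurable_EFinP _ _).2 mv) v0.
rewrite /fubini_G => mF.
have mF' : measurable_fun setT (fun y => \1_D2 y * (Rintegral m1 D1 (fun x => u (x, y)) + M * fine (m1 D1))).
  apply/measurable_EFinP; move: mF; congr measurable_fun; apply/funext => y; exact: inner2.
apply: (eq_measurable_fun (fun y => \1_D2 y * (Rintegral m1 D1 (fun x => u (x, y)) + M * fine (m1 D1)) - M * fine (m1 D1))).
  by move=> y yD; rewrite indicE yD mul1r addrK.
by apply: measurable_funTS; apply: measurable_funB; [exact: mF'|exact: measurable_cst].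
Qed.

Lemma fubini_bounded :
  Rintegral m1 D1 (fun x => Rintegral m2 D2 (fun y => u (x, y))) =
  Rintegral m2 D2 (fun y => Rintegral m1 D1 (fun x => u (x, y))).
Proof.
have := @fubini_tonelli _ _ _ _ _ m1 m2 _ ((measurable_EFinP _ _).2 mv) v0.
under eq_integral do rewrite /= inner1.
under [in RHS]eq_integral do rewrite /= inner2.
have E1 : (\int[m1]_x (\1_D1 x * (Rintegral m2 D2 (fun y => u (x, y)) + M * fine (m2 D2)))%:E)%E =
    (Rintegral m1 D1 (fun x => Rintegral m2 D2 (fun y => u (x, y))) + M * fine (m2 D2) * fine (m1 D1))%:E.
  rewrite -(RI_cst m1 mD1) -RI_D//; [|exact: bmf_inner1|exact: bmf_cst].
  rewrite -RI_E//; last by apply: bmfD; [exact: bmf_inner1|exact: bmf_cst].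
  rewrite [RHS]integral_mkcond; apply: eq_integral => x _; rewrite patchE indicE.
  by case: ifPn => _; rewrite ?mul1r ?mul0r.
have E2 : (\int[m2]_y (\1_D2 y * (Rintegral m1 D1 (fun x => u (x, y)) + M * fine (m1 D1)))%:E)%E =
    (Rintegral m2 D2 (fun y => Rintegral m1 D1 (fun x => u (x, y))) + M * fine (m1 D1) * fine (m2 D2))%:E.
  rewrite -(RI_cst m2 mD2) -RI_D//; [|exact: bmf_inner2|exact: bmf_cst].
  rewrite -RI_E//; last by apply: bmfD; [exact: bmf_inner2|exact: bmf_cst].
  rewrite [RHS]integral_mkcond; apply: eq_integral => y _; rewrite patchE indicE.
  by case: ifPn => _; rewrite ?mul1r ?mul0r.
by rewrite E1 E2 => -[] /eqP; rewrite (mulrAC M) => /eqP/addIr.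
Qed.

End fubini_bounded.

Section taylor_integral.
Context {R : realType} (d : nat) dT (T : measurableType dT) (m : {measure set T -> \bar R}).
Variable D : set T.
Hypotheses (mD : measurable D) (Doo : (m D < +oo)%E).

(** Differentiation under the integral sign: with a uniform constant, the quadratic bound is simply
    integrated over [D]. *)
Lemma taylor_Rintegral (u : 'rV[R]_d -> T -> R) (Du : 'rV[R]_d -> T -> 'rV[R]_d) C :
  (forall x, bmf D (u x)) -> (forall x i, bmf D (fun y => Du x y ord0 i)) ->
  (forall y, D y -> taylor (u^~ y) (Du^~ y) C) ->
  taylor (fun x => Rintegral m D (u x))
    (fun x => \row_i Rintegral m D (fun y => Du x y ord0 i)) (C * fine (m D)).
Proof.
move=> bu bDu Tu x h.
have bDh i : bmf D (fun y => Du x y ord0 i * h ord0 i).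
  rewrite (_ : (fun y => _) = (fun y => h ord0 i * Du x y ord0 i)); first exact: bmfZ.
  by apply/funext => y; rewrite mulrC.
have bS : bmf D (fun y => dot (Du x y) h) by exact: bmf_sum.
rewrite (_ : _ - _ = Rintegral m D (fun y => u (x + h) y - u x y - dot (Du x y) h)); last first.
  rewrite RI_B//; last exact: bmfB.
  rewrite RI_B// RI_sum//; congr (_ - _); apply: eq_bigr => i _.
  rewrite mxE mulrC -RI_Z//; congr Rintegral; apply/funext => y; exact: mulrC.
rewrite mulrAC; apply: RI_norm_le => //; first by apply: bmfB => //; exact: bmfB.
by move=> y Dy; exact: Tu.
Qed.

End taylor_integral.

(** * Mollification of indicators *)

Section mollifier.
Context {R : realType} (d : nat).
Local Notation L := (@LRd R d).
Local Notation leb := (@leb R d).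
Implicit Types (x h y : 'rV[R]_d) (F : set 'rV[R]_d).

(** Expand over a unit step along the i-th axis. *)
Lemma taylor_bound_grad g (Dg : 'rV[R]_d -> 'rV[R]_d) C M x i :
  taylor g Dg C -> (forall z, `|g z| <= M) -> `|Dg x ord0 i| <= 2 * M + C.
Proof.
move=> /(_ x (delta_mx ord0 i)) + gM; rewrite dot_delta -dotxx dot_delta mxE !eqxx mulr1.
have := gM x; have := gM (x + delta_mx ord0 i).
by rewrite !ler_norml => /andP[? ?] /andP[? ?] /andP[? ?]; apply/andP; split; lra.
Qed.

Lemma dot_sq_le x y : dot x y ^+ 2 <= nsq x * nsq y.
Proof.
rewrite -!eucl_norm_sq -exprMn -[leLHS](real_normK (num_real _)).
rewrite ler_pXn2r ?nnegrE ?mulr_ge0 ?eucl_norm_ge0// ler_norml cauchy_schwarz andbT lerNl.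
by rewrite -dotNl (le_trans (cauchy_schwarz _ _))// eucl_normN.
Qed.

(** The squared positive part of a quadratic polynomial: it vanishes to second order at the sphere
    of radius [e], which yields a global quadratic Taylor bound. *)
Definition bump (e : R) x : R := Num.max (e ^+ 2 - nsq x) 0 ^+ 2.
Definition dbump (e : R) x : 'rV[R]_d := (- 4 * Num.max (e ^+ 2 - nsq x) 0) *: x.

Lemma sq_max_taylor (a b : R) :
  `|Num.max b 0 ^+ 2 - Num.max a 0 ^+ 2 - 2 * Num.max a 0 * (b - a)| <= (b - a) ^+ 2.
Proof.
have [b0|/ltW b0] := leP b 0; have [a0|/ltW a0] := leP a 0;
  rewrite ?expr0n/= ?mulr0 ?mul0r ?subr0 ?sub0r ?normr0 ?sqr_ge0// ler_norml; apply/andP; split.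
all: have := sqr_ge0 (b - a); rewrite !expr2; nra.
Qed.

(** Three regimes, with a constant that is not sharp. For [|h| > 1] all terms are controlled by
    [|h|^2]; for [|h| <= 1] and [|x| > 2] both points lie outside the ball; otherwise
    [sq_max_taylor] is used. *)
Lemma bump_taylor (e : R) : 0 < e <= 1 -> taylor (bump e) (dbump e) 40.
Proof.
move=> /andP[e0 e1] x h; have := nsq_ge0 (x + h); rewrite /bump /dbump dotZl nsqD.
have := dot_sq_le x h; have := nsq_ge0 x; have := nsq_ge0 h.
move: (nsq x) (nsq h) (dot x h) => X H p H0 X0 pXH S0.
have e2 : 0 <= e ^+ 2 <= 1 by rewrite exprn_ge0 ?exprn_ile1// ltW.
move: (e ^+ 2) e2 => q /andP[q0 q1].
set a : R := q - X; set b : R := q - (X + 2 * p + H).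
have a1 : 0 <= Num.max a 0 <= 1 by rewrite le_max lexx orbT ge_max ler01 andbT /=; rewrite /a; lra.
have b1 : 0 <= Num.max b 0 <= 1.
  by rewrite le_max lexx orbT ge_max ler01 andbT /= /b; lra.
have [H1|H1] := leP H 1; last first.
  have : `|Num.max a 0 * p| <= H.
    have [aneg|apos] := leP a 0; first by rewrite mul0r normr0.
    rewrite normrM (le_trans (y := 1 * `|p|))//.
      by apply: ler_wpM2r => //; rewrite gtr0_norm// /a; lra.
    rewrite mul1r -(@ler_pXn2r _ 2)// ?nnegrE// real_normK ?num_real//.
    by apply: (le_trans pXH); rewrite /a in apos; nra.
  case/andP: a1 => a0 a1; case/andP: b1 => b0 b1.
  move: (Num.max a 0) (Num.max b 0) a0 a1 b0 b1 => u v u0 u1 v0 v1.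
  by rewrite !ler_norml => /andP[p1 p2]; apply/andP; split; nra.
have [X4|X4] := leP X 4; last first.
  have a0 : a <= 0 by rewrite /a; lra.
  have b0 : b <= 0.
    rewrite /b; suff : 1 <= X + 2 * p + H by lra.
    have pX : - p <= X / 2.
      rewrite (le_trans (ler_norm _))// normrN -(@ler_pXn2r _ 2)// ?nnegrE//; last by lra.
      by rewrite real_normK ?num_real//; nra.
    have p2 : (X / 2) ^+ 2 <= (X + p) ^+ 2 by rewrite ler_pXn2r// ?nnegrE; lra.
    have X0' : 0 < X by lra.
    by rewrite -(ler_pM2l X0'); nra.
  by rewrite !max_r// !(mulr0, mul0r, subr0, expr0n) normr0 mulr_ge0.
have := sq_max_taylor a b.
(* Here [b - a = - (2 p + H)] with [p^2 <= 4 H] and [H <= 1], so its square is at most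
   [8 p^2 + 2 H^2 <= 34 H]. The term linear in [H] adds [2 H]. *)
have bb : (b - a) ^+ 2 <= 34 * H.
  have p4 : p ^+ 2 <= 4 * H by apply: (le_trans pXH); exact: ler_wpM2r.
  have HH : H ^+ 2 <= H by rewrite expr2 -[leRHS]mul1r; exact: ler_wpM2r.
  have := sqr_ge0 (2 * p - H).
  rewrite (_ : (b - a) ^+ 2 = 8 * p ^+ 2 + 2 * H ^+ 2 - (2 * p - H) ^+ 2); last by rewrite /a /b; ring.
  by move: (_ ^+ 2) (p ^+ 2) (H ^+ 2) p4 HH => ? ? ?; lra.
have ba : b - a = - (2 * p + H) by rewrite /a /b; ring.
move: bb; rewrite ba.
case/andP: a1 => a0 a1; move: (Num.max a 0) (Num.max b 0) a0 a1 => u v u0 u1 bb.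
by rewrite !ler_norml => /andP[p1 p2]; apply/andP; split; nra.
Qed.

Lemma bump_ge0 (e : R) x : 0 <= bump e x. Proof. exact: sqr_ge0. Qed.

Lemma bump_out (e : R) x : ~ ball2 e x -> bump e x = 0.
Proof.
rewrite /ball2/= => /negP; rewrite -leNgt => h.
by rewrite /bump max_r ?expr0n// subr_le0.
Qed.

Lemma bump_le1 (e : R) x : 0 < e <= 1 -> bump e x <= 1.
Proof.
move=> /andP[e0 e1]; rewrite /bump exprn_ile1//; first by rewrite le_max lexx orbT.
rewrite ge_max ler01 andbT; have := nsq_ge0 x; have : e ^+ 2 <= 1 by rewrite exprn_ile1// ltW.
lra.
Qed.

Lemma measurable_comp_continuous dT (T : measurableType dT) (g : 'rV[R]_d -> R) (f : T -> 'rV[R]_d) :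
  continuous g -> (forall i, measurable_fun setT (fun z => f z ord0 i)) ->
  measurable_fun setT (fun z => g (f z)).
Proof.
move=> cg mf.
exact: (measurableT_comp (continuous_measurableB cg) (measurable_to_BRd mf)).
Qed.

Lemma taylor_continuous g (Dg : 'rV[R]_d -> 'rV[R]_d) C : taylor g Dg C -> continuous g.
Proof. by move=> Tg x; apply: differentiable_continuous; apply: taylor_differentiable Tg. Qed.

Definition mollifier (e : R) (rho : 'rV[R]_d -> R) (Drho : 'rV[R]_d -> 'rV[R]_d) (C M : R) :=
  [/\ taylor rho Drho C, (forall x, 0 <= rho x <= M), (forall x, rho (- x) = rho x),
      (forall x, ~ ball2 e x -> rho x = 0) & (\int[leb]_x (rho x)%:E = 1)%E].

Lemma mollifier_exists (e : R) : 0 < e <= 1 -> exists rho Drho C M, mollifier e rho Drho C M.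
Proof.
move=> e01; have /andP[e0 e1] := e01.
have Tb := bump_taylor e01.
have mb : measurable_fun setT (fun x : L => (bump e x)%:E).
  apply/measurable_EFinP; apply: measurable_comp_continuous (taylor_continuous Tb) _ => i.
  exact: measurable_coord.
have b0 (x : L) : setT x -> (0 <= (bump e x)%:E)%E by rewrite lee_fin bump_ge0.
set Z := (\int[leb]_x (bump e x)%:E)%E.
have Z1 : (Z <= leb (ball2 e))%E.
  rewrite -[ball2 e]setIT -integral_indic//; last exact: measurable_ball2.
  apply: ge0_le_integral; first exact: measurableT.
  - exact: b0.
  - exact: mb.
  - by apply/measurable_EFinP; apply: measurable_indic; exact: measurable_ball2.
  - move=> x _; rewrite lee_fin indicE; case: (boolP (x \in _)) => xb; first exact: bump_le1.
    by rewrite bump_out//; move/negP: xb; rewrite inE.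
have e20 : 0 < e / 2 by rewrite divr_gt0.
have Z0 : (0 < Z)%E.
  (* On the ball of radius [e / 2] the bump is at least [(e^2 / 2)^2], so its integral is
     positive. *)
  pose c := 4^-1 * e ^+ 4.
  have c0 : 0 < c by rewrite mulr_gt0// exprn_gt0.
  apply: (@lt_le_trans _ _ (c%:E * leb (ball2 (e / 2)))%E).
    by rewrite mule_gt0// leb_ball2_gt0.
  rewrite -[ball2 _]setIT -integral_indic//; last exact: measurable_ball2.
  rewrite -(@ge0_integralZl _ _ _ leb _ measurableT (fun x => (\1_(ball2 (e / 2)) x)%:E)); last 3 first.
  - by apply/measurable_EFinP; apply: measurable_indic; exact: measurable_ball2.
  - by move=> x _; rewrite lee_fin.
  - exact: ltW.
  apply: ge0_le_integral; first exact: measurableT.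
  - by move=> x _; rewrite -EFinM lee_fin mulr_ge0// ltW.
  - apply/measurable_EFinP; apply: measurable_funM; first exact: measurable_cst.
    by apply: measurable_indic; exact: measurable_ball2.
  - exact: mb.
  - move=> x _; rewrite -EFinM lee_fin indicE; case: (boolP (x \in _)) => xb; last by rewrite mulr0 bump_ge0.
    move: xb; rewrite inE /ball2/= mulr1 /bump => xb.
    rewrite (_ : c = (e ^+ 2 / 2) ^+ 2); last by rewrite /c; field.
    have p2 : 0 <= e ^+ 2 by rewrite exprn_ge0// ltW.
    rewrite ler_pXn2r// ?nnegrE ?le_max ?lexx ?orbT//; last by rewrite divr_ge0.
    by apply/orP; left; move: xb p2; rewrite exprMn; lra.
have Zfin : Z \is a fin_num by rewrite ge0_fin_numE ?ltW// (le_lt_trans Z1)// leb_ball2_lty.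
have z0 : 0 < fine Z by rewrite fine_gt0// Z0 -ge0_fin_numE// ltW.
exists (fun x => (fine Z)^-1 * bump e x), (fun x => (fine Z)^-1 *: dbump e x), (`|(fine Z)^-1| * 40), (fine Z)^-1.
split.
- exact: taylorZ.
- move=> x; rewrite mulr_ge0 ?bump_ge0 ?invr_ge0 ?(ltW z0)//=.
  by rewrite -[leRHS]mulr1; apply: ler_wpM2l; [rewrite invr_ge0 (ltW z0)|exact: bump_le1].
- by move=> x; rewrite /bump nsqN.
- by move=> x xe; rewrite bump_out// mulr0.
- under eq_integral do rewrite EFinM.
  rewrite ge0_integralZl//; last by rewrite lee_fin invr_ge0 ltW.
  by rewrite -/Z -(fineK Zfin) -EFinM mulVf// gt_eqF.
Qed.

Section mollify.
Variables (e : R) (rho : 'rV[R]_d -> R) (Drho : 'rV[R]_d -> 'rV[R]_d) (C M : R).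
Hypothesis rhoP : mollifier e rho Drho C M.

Let rhoT : taylor rho Drho C. Proof. by case: rhoP. Qed.
Let rho0 x : 0 <= rho x. Proof. by case: rhoP => _ /(_ x)/andP[]. Qed.
Let rhoN x : rho (- x) = rho x. Proof. by case: rhoP. Qed.
Let rho1 : (\int[leb]_x (rho x)%:E = 1)%E. Proof. by case: rhoP. Qed.
Let rhoM x : `|rho x| <= M. Proof. by case: rhoP => _ /(_ x)/andP[? ?] _ _ _; rewrite ger0_norm. Qed.

Lemma measurable_mollifier dT (T : measurableType dT) (f : T -> 'rV[R]_d) :
  (forall i, measurable_fun setT (fun z => f z ord0 i)) ->
  measurable_fun setT (fun z => rho (f z)).
Proof. exact: measurable_comp_continuous (taylor_continuous rhoT). Qed.

Lemma measurable_shift x i : measurable_fun setT (fun y : L => (y - x) ord0 i).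
Proof.
under eq_fun do rewrite !mxE.
by apply: measurable_funB; [exact: measurable_coord|exact: measurable_cst].
Qed.

Lemma measurable_rho_shift x : measurable_fun setT (fun y : L => rho (y - x)).
Proof. by apply: measurable_mollifier => i; exact: measurable_shift. Qed.

Lemma bmf_rho (D : set L) x : bmf D (fun y => rho (y - x)).
Proof. by split; [exact/measurable_funTS/measurable_rho_shift|exists M]. Qed.

Lemma bmf_Drho (D : set L) x i : bmf D (fun y => - Drho (y - x) ord0 i).
Proof.
split; last first.
  exists (2 * M + C) => y _; rewrite normrN; exact: taylor_bound_grad rhoT rhoM.
apply/measurable_funTS; apply: measurable_funN.
by apply: (measurable_comp_continuous (taylor_continuousD (i := i) rhoT)) => j; exact: measurable_shift.
Qed.

(** The convolution of the indicator of [F] with the even kernel [rho], written as an integral over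
    [F] so that the calculus on sets of finite measure applies. *)
Definition mollify F x := Rintegral leb F (fun y => rho (y - x)).
Definition dmollify F x : 'rV[R]_d := \row_i Rintegral leb F (fun y => - Drho (y - x) ord0 i).

Lemma integral_rho_shift x : (\int[leb]_y (rho (y - x))%:E = 1)%E.
Proof.
have mr : measurable_fun setT (fun h : L => (rho h)%:E).
  apply/measurable_EFinP; apply: measurable_mollifier; exact: measurable_coord.
have r0 (h : L) : (0 <= (rho h)%:E)%E by rewrite lee_fin.
by rewrite -[RHS]rho1 -(ge0_integral_translate (- x) mr r0).
Qed.

Variable F : set 'rV[R]_d.
Hypotheses (bF : borel F) (Foo : (leb F < +oo)%E).
Let mF : measurable (F : set L). Proof. exact: borel_measurable. Qed.

Lemma mollify_taylor : taylor (mollify F) (dmollify F) (C * fine (leb F)).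
Proof.
have := @taylor_Rintegral _ d _ _ leb F mF Foo (fun x y => rho (y - x)) (fun x y => - Drho (y - x)) C.
move=> TR.
have -> : dmollify F = fun x => \row_i Rintegral leb F (fun y => (- Drho (y - x)) ord0 i).
  apply/funext => x; apply/rowP => i; rewrite !mxE; congr Rintegral; apply/funext => y; by rewrite mxE.
apply: TR => [x|x i|y Fy].
- exact: bmf_rho.
- under eq_fun do rewrite mxE. exact: bmf_Drho.
- exact: taylor_reflect.
Qed.

Lemma mollifyE x : ((mollify F x)%:E = \int[leb]_(y in (F : set L)) (rho (y - x))%:E)%E.
Proof. by rewrite (RI_E mF Foo (bmf_rho F x)). Qed.

Lemma mollify_compl x :
  ((mollify F x)%:E + \int[leb]_(y in (~` F : set L)) (rho (y - x))%:E = 1)%E.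
Proof.
rewrite mollifyE -(integral_rho_shift x) -(setUv F).
rewrite (@ge0_integral_setU _ _ _ leb F (~` F) mF (measurableC mF) (fun y => (rho (y - x))%:E)).
- by [].
- by rewrite setUv; apply/measurable_EFinP; exact: measurable_rho_shift.
- by move=> y _; rewrite lee_fin.
- by rewrite disj_set2E setICr.
Qed.

Lemma mollify_ge0 x : 0 <= mollify F x.
Proof. by rewrite -lee_fin mollifyE; apply: integral_ge0 => y _; rewrite lee_fin. Qed.

Lemma mollify_le1 x : mollify F x <= 1.
Proof.
rewrite -lee_fin -(mollify_compl x) leeDl//.
by apply: integral_ge0 => y _; rewrite lee_fin.
Qed.

Lemma mollify_complE x :
  (\int[leb]_(y in (~` F : set L)) (rho (y - x))%:E = (1 - mollify F x)%:E)%E.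
Proof. by rewrite EFinB -(mollify_compl x) addeAC subee// add0e. Qed.

Variable eta : R.
Hypotheses (eta0 : 0 <= eta) (VF : forall h, ball2 e h -> (V F h <= eta%:E)%E).

(** The double integral is the average of [V G] against [rho], whose support is the ball of radius
    [e]. The set is a parameter because the complement of [F] is also used. *)
Lemma mollify_mean G : borel G -> (forall h, ball2 e h -> (V G h <= eta%:E)%E) ->
  (\int[leb]_(x in (G : set L)) \int[leb]_(y in (~` G : set L)) (rho (y - x))%:E <= eta%:E)%E.
Proof.
move=> bG VG; rewrite double_integral_shift//; last first.
  exact: continuous_measurableB (taylor_continuous rhoT).
have mr : measurable_fun setT (fun h : L => (rho h)%:E).
  apply/measurable_EFinP; apply: measurable_mollifier; exact: measurable_coord.
have r0 (h : L) : setT h -> (0 <= (rho h)%:E)%E by rewrite lee_fin.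
rewrite -[leRHS]mule1 -rho1 -(ge0_integralZl leb measurableT mr r0)//.
apply: ge0_le_integral; first exact: measurableT.
- by move=> h _; rewrite mule_ge0 ?lee_fin// V_ge0.
- by apply: emeasurable_funM; [exact: mr|exact: measurable_V].
- by apply: emeasurable_funM; [exact: measurable_cst|exact: mr].
- move=> h _; rewrite [leRHS]muleC; have [hb|hb] := pselect (ball2 e h).
    by apply: lee_wpmul2l; [rewrite lee_fin|exact: VG].
  by case: rhoP => _ _ _ -> // _; rewrite !mul0e.
Qed.

Lemma mollify_in : (\int[leb]_(x in (F : set L)) (1 - mollify F x)%:E <= eta%:E)%E.
Proof.
apply: le_trans (mollify_mean bF VF); rewrite le_eqVlt; apply/orP; left; apply/eqP.
by apply: eq_integral => x _; rewrite mollify_complE.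
Qed.

Lemma mollify_out : (\int[leb]_(x in (~` F : set L)) (mollify F x)%:E <= eta%:E)%E.
Proof.
apply: le_trans (@mollify_mean (~` F) (borelC bF) _).
  rewrite le_eqVlt; apply/orP; left; apply/eqP.
  by apply: eq_integral => x _; rewrite setCK mollifyE.
(* A point outside [F] that [h] brings into [F] is, seen from its image, a point of [F] that [- h]
   takes out. *)
move=> h hb; rewrite (_ : V _ h = V F (- h)); first by apply: VF; rewrite /ball2/= nsqN.
rewrite /V -[RHS](leb_translate h); congr (_ _); apply/seteqP; split => x.
  by move=> [xF xhF]; split; [exact: contrapT xhF|rewrite addrK].
by move=> [xhF]; rewrite addrK => xF; split => // nF; exact: nF.
Qed.

End mollify.
End mollifier.

(** * Continuity of translations and Borel hulls *)

Section continuity_of_translation.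
Context {R : realType} (d : nat).
Local Notation L := (@LRd R d).
Local Notation leb := (@leb R d).
Implicit Types (E F X : set 'rV[R]_d) (h x a b : 'rV[R]_d).
Local Open Scope ereal_scope.

(** A nearly optimal cover has finite total volume, which forces each member to be a box. *)
Lemma box_cover X (eta : R) : leb X < +oo -> (0 < eta)%R ->
  exists B : nat -> set 'rV[R]_d, [/\ forall k, is_box (B k), X `<=` \bigcup_k B k &
    leb (\bigcup_k B k) <= leb X + eta%:E].
Proof.
move=> Xoo eta0.
have Xfin : leb X \is a fin_num by rewrite ge0_fin_numE// measure_ge0.
have [_ [B [_ XB] <-]] := lb_ereal_inf_adherent eta0 Xfin.
rewrite -/(mu_ext _ _) => sB.
have Boo k : boxvol (B k) < +oo.
  apply: le_lt_trans (lt_le_trans sB (leey _)).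
  rewrite (nneseries_split 0%N k.+1) ?add0n; last by move=> n _; exact: boxvol_ge0.
  rewrite big_nat_recr//=; apply: (@le_trans _ _ (\sum_(0 <= n < k) boxvol (B n) + boxvol (B k))).
    by apply: leeDr; apply: sume_ge0 => n _; exact: boxvol_ge0.
  by apply: leeDl; apply: nneseries_ge0 => n _ _; exact: boxvol_ge0.
exists B; split => // [k|]; first exact: boxvol_lty.
apply: le_trans (ltW sB); apply: (@le_trans _ _ (\sum_(k <oo) leb (B k))).
  apply: outer_measure_sigma_subadditive.
apply: lee_nneseries => // k _; exact: lebesgue_outer_le_boxvol.
Qed.

Lemma decreasing_small (F : nat -> set 'rV[R]_d) (eta : R) :
  (forall n, borel (F n)) -> leb (F 0%N) < +oo -> (forall m n, (m <= n)%N -> F n `<=` F m) ->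
  (forall x, exists n, ~ F n x) -> (0 < eta)%R -> \forall n \near \oo, leb (F n) <= eta%:E.
Proof.
move=> bF Foo mono Fcap eta0.
have capE : \bigcap_n F n = set0.
  by rewrite -subset0 => x xF; have [n] := Fcap x; apply; exact: xF.
have : leb \o F @ \oo --> leb (\bigcap_n F n).
  apply: nonincreasing_cvg_mu => //.
  - by move=> i; exact/borel_measurable.
  - by rewrite capE; exact: measurable0.
  - by move=> m n mn; apply/subsetPset/mono.
rewrite capE measure0 => /fine_cvgP[Ffin] /cvgrPdist_le /(_ _ eta0) Fc.
near=> n; have Fn : leb (F n) \is a fin_num by near: n.
rewrite -(fineK Fn) lee_fin.
have : (`|0 - fine (leb (F n))| <= eta)%R by near: n.
by rewrite sub0r normrN ger0_norm// fine_ge0// measure_ge0.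
Unshelve. all: by end_near. Qed.

Definition shift_small E := forall eta : R, (0 < eta)%R ->
  exists2 del : R, (0 < del)%R & forall h, (forall i, `|h ord0 i| <= del)%R -> V E h <= eta%:E.

Lemma V_union E F h : borel E -> borel F -> V (E `|` F) h <= V E h + V F h.
Proof.
move=> bE bF; apply: (@le_trans _ _ (leb (Vset E h `|` Vset F h))).
  apply: le_outer_measure => x [[Ex|Fx] nEF].
    by left; split => // Exh; apply: nEF; left.
  by right; split => // Fxh; apply: nEF; right.
by apply: measureU2; exact: measurable_Vset.
Qed.

(* Shifts with nonpositive coordinates only affect points near the lower faces, which the
   half-open box excludes; the other shifts reduce to them by [V_sub] and [V_opp]. *)
Lemma shift_small_box a b : shift_small (box a b).
Proof.
move=> eta eta0.
have bB : borel (box a b) by exact: borel_box.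
(* The part of the box within [1 / n.+1] of some lower face; since the lower inequalities are
   strict, these layers decrease to the empty set. *)
pose F n := box a b `\` box (a + const_mx n.+1%:R^-1)%R b.
have F0 : leb (F 0%N) < +oo.
  apply: le_lt_trans (le_lt_trans (leb_box_le a b) (ltry _)).
  by apply: le_outer_measure; exact: subDsetl.
have bF n : borel (F n) by apply: borelD; exact: borel_box.
have eta2 : (0 < eta / 2)%R by rewrite divr_gt0.
have Fmono m n : (m <= n)%N -> F n `<=` F m.
  move=> mn x [xB xF]; split => //; apply: contra_not xF => xF i.
  have /andP[h1 ->] := xF i; rewrite andbT; apply: le_lt_trans h1.
  by rewrite !mxE lerD2l lef_pV2 ?posrE// ler_nat.
have Fcap x : exists n, ~ F n x.
  have [xB|xB] := pselect (box a b x); last by exists 0%N => -[].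
  have [n nP] : exists n : 'I_d -> nat, forall i, (a ord0 i + (n i).+1%:R^-1 < x ord0 i)%R.
    apply: (@fin_all_exists _ (fun=> nat) (fun i n => (a ord0 i + n.+1%:R^-1 < x ord0 i)%R)) => i.
    by apply: ltr_add_invr; case/andP: (xB i).
  exists (\max_i n i)%N => -[_]; apply => i; have /andP[_ ->] := xB i; rewrite andbT.
  apply: le_lt_trans (nP i); rewrite !mxE lerD2l lef_pV2 ?posrE// ler_nat ltnS.
  exact: leq_bigmax.
have [n _ Fn] := decreasing_small bF F0 Fmono Fcap eta2.
exists (n.+1%:R^-1)%R; first by rewrite invr_gt0.
have key h : (forall i, - n.+1%:R^-1 <= h ord0 i <= 0)%R -> V (box a b) h <= (eta / 2)%:E.
  move=> hn; apply: le_trans (Fn n (leqnn n)).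
  apply: le_outer_measure => x [xB xh]; split => //; apply: contra_not xh => xF i.
  have := hn i; have := xF i; have := xB i; rewrite !mxE.
  move: (n.+1%:R^-1 : R)%R (a ord0 i) (b ord0 i) (x ord0 i) (h ord0 i) => q a' b' x' h'.
  by move=> /andP[? ?] /andP[? ?] /andP[? ?]; apply/andP; split; lra.
move=> h hn.
pose p : 'rV[R]_d := (\row_i Num.max (h ord0 i) 0)%R.
pose q : 'rV[R]_d := (\row_i Num.min (h ord0 i) 0)%R.
have hE : h = (p + q)%R by apply/rowP => i; rewrite !mxE addr_max_min addr0.
rewrite hE (splitr eta) EFinD; apply: (le_trans (V_sub _ _ bB)); apply: leeD.
  rewrite -V_opp//; last exact: le_lt_trans (leb_box_le a b) (ltry _).
  apply: key => i; have := hn i; rewrite !mxE ler_norml => /andP[? ?].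
  by rewrite lerN2 ge_max oppr_le0 le_max lexx orbT andbT; apply/andP; split => //.
apply: key => i; have := hn i; rewrite !mxE ler_norml => /andP[? ?].
by rewrite ge_min lexx orbT andbT le_min; apply/andP; split; rewrite // oppr_le0.
Qed.

Lemma shift_smallU E F : borel E -> borel F -> shift_small E -> shift_small F ->
  shift_small (E `|` F).
Proof.
move=> bE bF sE sF eta eta0; have eta2 : (0 < eta / 2)%R by rewrite divr_gt0.
have [de de0 dE] := sE _ eta2; have [df df0 dF] := sF _ eta2.
exists (Num.min de df); first by rewrite lt_min de0.
move=> h hd; apply: (le_trans (V_union _ bE bF)).
rewrite (splitr eta) EFinD; apply: leeD; [apply: dE|apply: dF] => i;
  by have := hd i; rewrite le_min => /andP[].
Qed.

Lemma borel_bigcup (F : nat -> set 'rV[R]_d) : (forall n, borel (F n)) -> borel (\bigcup_n F n).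
Proof. by move=> bF; apply: bigcup_measurable => n _; exact: bF. Qed.

(** Approximate [E] by a finite union [G] of boxes. By [V_diff] three terms of size [eta / 3]
    remain: [V G], the part of [E] outside [G], and the part of [G] outside [E]. *)
Lemma V_small E : borel E -> leb E < +oo -> shift_small E.
Proof.
move=> bE Eoo eta eta0.
have eta4 : (0 < eta / 3)%R by rewrite divr_gt0.
have [B [boxB EB Bm]] := box_cover Eoo eta4.
pose G n := \big[setU/set0]_(k < n) B k.
have bB k : borel (B k) by exact: is_box_borel.
have GS n : borel (G n) /\ shift_small (G n).
  rewrite /G; elim: n => [|n [IH1 IH2]].
    rewrite big_ord0; split; first exact: measurable0.
    by move=> e e0; exists 1%R => // h _; rewrite /V (_ : Vset _ h = set0) ?measure0 ?lee_fin ?ltW// -subset0 => x [].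
  rewrite big_ord_recr; split; first exact: borelU.
  apply: shift_smallU => //.
  have [->|[a [b ->]]] := boxB n; last exact: shift_small_box.
  by move=> e e0; exists 1%R => // h _; rewrite /V (_ : Vset _ h = set0) ?measure0 ?lee_fin ?ltW// -subset0 => x [].
have GE n : G n = \bigcup_(k < n) B k by rewrite /G bigcup_mkord.
have D0 : leb (E `\` G 0%N) < +oo by apply: le_lt_trans Eoo; apply: le_outer_measure; exact: subDsetl.
have bD n : borel (E `\` G n) by apply: borelD => //; exact: (GS n).1.
have Dmono m n : (m <= n)%N -> E `\` G n `<=` E `\` G m.
  move=> mn x [Ex Gx]; split => //; apply: contra_not Gx; rewrite !GE => -[k /= km Bk].
  by exists k => //=; exact: leq_trans mn.
have Dcap x : exists n, ~ (E `\` G n) x.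
  have [Ex|Ex] := pselect (E x); last by exists 0%N => -[].
  have [k _ Bk] := EB _ Ex; exists k.+1 => -[_]; apply; rewrite GE; by exists k => /=.
have [n _ Dn] := decreasing_small bD D0 Dmono Dcap eta4.
have [del del0 dP] := (GS n).2 _ eta4.
exists del => // h /dP VG.
apply: (le_trans (V_diff h bE (GS n).1)).
rewrite (_ : eta = eta / 3 + (eta / 3 + eta / 3))%R; last by field.
rewrite !EFinD; apply: leeD => //; apply: leeD; first exact: Dn (leqnn n).
apply: (@le_trans _ _ (leb ((\bigcup_k B k) `\` E))).
  by apply: le_outer_measure; apply: setSD; rewrite GE => x [k _ Bk]; exists k.
have bU := borel_bigcup bB.
have Efin : leb E \is a fin_num by rewrite ge0_fin_numE// measure_ge0.
rewrite measureD; [|exact: borel_measurable|exact: borel_measurable|]; last first.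
  by apply: (le_lt_trans Bm); rewrite -(fineK Efin) -EFinD ltry.
rewrite (setIidr EB) leeBlDr//; by rewrite addeC.
Qed.

Lemma V_small_ball E (eta : R) : borel E -> leb E < +oo -> (0 < eta)%R ->
  exists2 e : R, (0 < e <= 1)%R & forall h, ball2 e h -> V E h <= eta%:E.
Proof.
move=> bE Eoo eta0; have [del del0 dP] := V_small bE Eoo eta0.
exists (Num.min del 1%R); first by rewrite lt_min del0 ltr01 ge_min lexx orbT.
have m0 : (0 < Num.min del 1%R)%R by rewrite lt_min del0 ltr01.
move=> h /(ball2_cube m0) hc; apply: dP => i; have := hc i; rewrite !mxE => /andP[h1 h2].
apply: (@le_trans _ _ (Num.min del 1%R)); last by rewrite ge_min lexx.
by rewrite ler_norml h2 ltW.
Qed.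

(** Intersect countably many covers by boxes with excess [1 / n.+1]. *)
Lemma borel_hull X : leb X < +oo ->
  exists B : set 'rV[R]_d, [/\ borel B, X `<=` B & leb B = leb X].
Proof.
move=> Xoo.
have BX (n : nat) : exists B : set 'rV[R]_d,
    [/\ borel B, X `<=` B & leb B <= leb X + (n.+1%:R^-1)%:E].
  have [|B [boxB XB Bm]] := @box_cover X (n.+1%:R^-1) Xoo; first by rewrite invr_gt0.
  exists (\bigcup_k B k); split => //; apply: borel_bigcup => k; exact: is_box_borel.
have [B BP] := choice BX.
have XC : X `<=` \bigcap_n B n by move=> x Xx n _; have [_ + _] := BP n; exact.
exists (\bigcap_n B n); split => //.
  by apply: bigcap_measurable => [|n _]; [by exists 0%N|have [] := BP n].
apply/eqP; rewrite eq_le; apply/andP; split; last exact: le_outer_measure.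
have Xfin : leb X \is a fin_num by rewrite ge0_fin_numE// measure_ge0.
apply/lee_addgt0Pr => e e0.
have [n] := ltr_add_invr e0; rewrite add0r => ne.
have [_ _ Bn] := BP n.
apply: (@le_trans _ _ (leb (B n))); first by apply: le_outer_measure => x; exact.
by apply: (le_trans Bn); rewrite leeD2l// lee_fin ltW.
Qed.

End continuity_of_translation.

(** * Comparison of the translation variation with the perimeter *)

Section telescoping_field.
Context {R : realType} (d : nat).
Hypothesis d0 : (0 < d)%N.
Local Notation L := (@LRd R d.+1).
Local Notation leb := (@leb R d.+1).
Implicit Types (x h : 'rV[R]_d.+1).

Lemma taylor_weaken n (g : 'rV[R]_n -> R) Dg (C C' : R) : C <= C' -> taylor g Dg C -> taylor g Dg C'.
Proof. by move=> CC Tg x h; apply: (le_trans (Tg x h)); apply: ler_wpM2r; first exact: nsq_ge0. Qed.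

Lemma nsq_delta n i : nsq (delta_mx ord0 i : 'rV[R]_n) = 1.
Proof. by rewrite -dotxx dot_delta mxE !eqxx. Qed.

Lemma taylor_C_ge0 (g : 'rV[R]_d.+1 -> R) Dg C : taylor g Dg C -> 0 <= C.
Proof. by move=> /(taylor_ge0 (delta_mx ord0 ord0)); rewrite nsq_delta mulr1. Qed.

Lemma ball2_coord n (t : R) (h : 'rV[R]_n) i : 0 < t -> ball2 t h -> `|h ord0 i| <= t.
Proof.
move=> t0 /(ball2_cube t0)/(_ i); rewrite !mxE => /andP[h1 h2].
by rewrite ler_norml h2 ltW.
Qed.

Lemma ball2_norm n (t : R) (h : 'rV[R]_n) : 0 < t -> ball2 t h -> `|h| <= t.
Proof.
move=> t0 ht; rewrite [leLHS]mx_normrE; apply/bigmax_leP; split; first exact: ltW.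
by move=> [i j] _ /=; rewrite (ord1 i); exact: ball2_coord.
Qed.

Variables (g : 'rV[R]_d.+1 -> R) (Dg : 'rV[R]_d.+1 -> 'rV[R]_d.+1) (C N : R).
Hypotheses (gT : taylor g Dg C) (g01 : forall x, 0 <= g x <= 1).
Hypothesis g_out : forall x, N < `|x| -> g x = 0.
Variable t : R.
Hypothesis t0 : 0 < t.
Local Notation Bt := (ball2 t : set L).
Local Notation kap := (@omega R d / d.+2%:R * t ^+ d.+2).

Let mBt : measurable Bt. Proof. exact: measurable_ball2. Qed.
Let Btoo : (leb Bt < +oo)%E. Proof. exact: leb_ball2_lty. Qed.
Let g1 x : `|g x| <= 1. Proof. by have /andP[? ?] := g01 x; rewrite ger0_norm. Qed.

Lemma kappa_gt0 : 0 < kap.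
Proof. by rewrite mulr_gt0 ?exprn_gt0// divr_gt0// omega_gt0. Qed.

Lemma measurable_line x (c : R) i : measurable_fun setT (fun h : L => (x - c *: h) ord0 i).
Proof.
under eq_fun do rewrite !mxE.
apply: measurable_funB; first exact: measurable_cst.
by apply: measurable_funM; [exact: measurable_cst|exact: measurable_coord].
Qed.

Lemma bmf_line x (c : R) (D : set L) : bmf D (fun h : L => g (x - c *: h)).
Proof.
split; last by exists 1.
apply/measurable_funTS; apply: measurable_comp_continuous (taylor_continuous gT) _ => i.
exact: measurable_line.
Qed.

Lemma bmf_Dline x (c : R) (D : set L) i : bmf D (fun h : L => Dg (x - c *: h) ord0 i).
Proof.
split; last by exists (2 * 1 + C) => h _; exact: (taylor_bound_grad _ _ gT g1).
apply/measurable_funTS.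
by apply: (measurable_comp_continuous (taylor_continuousD (i := i) gT)) => j; exact: measurable_line.
Qed.

Lemma bmf_coord i : bmf Bt (fun h : L => h ord0 i).
Proof.
split; first by apply/measurable_funTS; exact: measurable_coord.
by exists t => h hB; exact: ball2_coord.
Qed.

Lemma bmf_dot v : bmf Bt (fun h : L => dot h v).
Proof.
apply: bmf_sum => i.
by have := bmfM (bmf_coord i) (bmf_cst Bt (v ord0 i)).
Qed.

Lemma bmf_dot_pos v : bmf Bt (fun h : L => Num.max (dot h v) 0).
Proof.
have [md [K KP]] := bmf_dot v; split; last first.
  exists K => h /KP; apply: le_trans.
  by rewrite ger0_norm ?le_max ?lexx ?orbT// ge_max normr_ge0 ler_norm.
exact: (@measurable_maxr _ L R Bt (fun h : L => dot h v) (fun=> 0) md (measurable_cst _)).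
Qed.

Lemma Rintegral_dot_pos v : Rintegral leb Bt (fun h => Num.max (dot h v) 0) = kap * eucl_norm v.
Proof.
apply: EFin_inj; rewrite -(RI_E mBt Btoo (bmf_dot_pos v)).
rewrite -dirintE// integral_mkcond; apply: eq_integral => h _.
by rewrite patchE indicE; case: ifPn => _; rewrite ?mul1r ?mul0r.
Qed.

Variable m : nat.
Hypothesis m0 : (0 < m)%N.

Let mR : 0 < m%:R :> R. Proof. by rewrite ltr0n. Qed.
(* The test field is int_{B_t} h G(x,h) / (m kap) dh. Since 0 <= G <= m, pairing it
   with v gives at most int (h.v)_+ = kap |v|; its divergence telescopes to
   g x - g (x - h) up to O(1/m). *)
Let c (j : nat) : R := j%:R / m%:R.
Let G x h : R := \sum_(j < m) g (x - c j.+1 *: h).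
Let u (i : 'I_d.+1) x h : R := h ord0 i * m%:R^-1 * G x h.
Let Du (i : 'I_d.+1) x h : 'rV[R]_d.+1 :=
  (h ord0 i * m%:R^-1) *: \sum_(j < m) Dg (x - c j.+1 *: h).
Let p i x := kap^-1 * Rintegral leb Bt (u i x).
Let Dp i x := kap^-1 *: (\row_k Rintegral leb Bt (fun h => Du i x h ord0 k)).

Let bmf_hm i : bmf Bt (fun h : L => h ord0 i * m%:R^-1).
Proof. exact: (bmfM (bmf_coord i) (bmf_cst Bt _)). Qed.

Let bmf_u i x : bmf Bt (u i x).
Proof. by apply: bmfM; [exact: bmf_hm|apply: bmf_sum => j; exact: bmf_line]. Qed.

Let bmf_Du i x k : bmf Bt (fun h => Du i x h ord0 k).
Proof.
under eq_fun do rewrite mxE summxE.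
by apply: bmfM; [exact: bmf_hm|apply: bmf_sum => j; exact: bmf_Dline].
Qed.

Let p_taylor i : taylor (p i) (Dp i) (`|kap^-1| * (t * C * fine (leb Bt))).
Proof.
apply: taylorZ.
apply: (@taylor_Rintegral _ _ _ _ leb Bt mBt Btoo (u i) (Du i)) => [x|x k|h hB].
- exact: bmf_u.
- exact: bmf_Du.
have C0 := taylor_C_ge0 gT.
have := taylorZ (h ord0 i * m%:R^-1) (taylor_sum (fun j : 'I_m => taylor_translate (- (c j.+1 *: h)) gT)).
apply: taylor_weaken.
rewrite normrM (@gtr0_norm _ m%:R^-1) ?invr_gt0// -mulrA mulKf ?gt_eqF//.
by apply: ler_wpM2r => //; exact: ball2_coord.
Qed.

Let p_out i x : N + t < `|x| -> p i x = 0.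
Proof.
move=> Nx; rewrite /p (_ : Rintegral _ _ _ = 0) ?mulr0//.
rewrite -[RHS](mul0r (fine (leb Bt))) -(RI_cst leb mBt); apply: eq_Rintegral => h.
rewrite inE => hB; rewrite /u /G big1 ?mulr0// => j _; apply: g_out.
have ht := ball2_norm t0 hB.
have cj : `|c j.+1| <= 1.
  by rewrite ger0_norm ?divr_ge0// ler_pdivrMr// mul1r ler_nat.
have : `|x| <= `|x - c j.+1 *: h| + `|c j.+1 *: h|.
  by rewrite -[X in `|X| <= _](subrK (c j.+1 *: h)) ler_normD.
have : `|c j.+1 *: h| <= t by rewrite normrZ -[leRHS]mul1r ler_pM.
lra.
Qed.

Let field x : 'rV[R]_d.+1 := \row_i p i x.

Let field_C1c : C1c_field field /\ forall x, divergence field x = \sum_i Dp i x ord0 i.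
Proof. exact: C1c_field_taylor p_taylor p_out. Qed.

Let field_le1 x : eucl_norm (field x) <= 1.
Proof.
pose v : 'rV[R]_d.+1 := \row_i Rintegral leb Bt (u i x).
have k0 := kappa_gt0.
(* The vector [v] is paired with itself; dividing by [|v|] then gives [|v| <= kap]. *)
have nv : nsq v <= kap * eucl_norm v.
  rewrite -Rintegral_dot_pos.
  have bvu i : bmf Bt (fun h => v ord0 i * u i x h) by apply: bmfZ; exact: bmf_u.
  have -> : nsq v = Rintegral leb Bt (fun h => \sum_i v ord0 i * u i x h).
    rewrite (RI_sum mBt Btoo bvu).
    by apply: eq_bigr => i _; rewrite (RI_Z mBt Btoo _ (bmf_u i x)) expr2 {2}mxE.
  apply: (RI_le mBt Btoo).
  - exact: bmf_sum.
  - exact: bmf_dot_pos.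
  - move=> h _.
    have G01 : 0 <= m%:R^-1 * G x h <= 1.
      apply/andP; split.
        by rewrite mulr_ge0 ?invr_ge0 ?ler0n// sumr_ge0// => j _; case/andP: (g01 (x - c j.+1 *: h)).
      rewrite ler_pdivrMl// mulr1 -[leRHS]mulr1 mulr_natl -[X in _ *+ X]card_ord -sumr_const.
      by apply: ler_sum => j _; case/andP: (g01 (x - c j.+1 *: h)).
    rewrite (_ : \sum_i _ = dot h v * (m%:R^-1 * G x h)); last first.
      by rewrite /dot mulr_suml; apply: eq_bigr => i _; rewrite /u; ring.
    case/andP: G01 => G0 G1.
    apply: (@le_trans _ _ (Num.max (dot h v) 0 * (m%:R^-1 * G x h))).
      by apply: ler_wpM2r => //; rewrite le_max lexx.
    by rewrite -[leRHS]mulr1; apply: ler_wpM2l => //; rewrite le_max lexx orbT.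
have vk : eucl_norm v <= kap.
  have := eucl_norm_ge0 v; rewrite le_eqVlt => /orP[/eqP <-|v0]; first exact: ltW.
  by rewrite -(ler_pM2r v0) -expr2 eucl_norm_sq.
have -> : field x = kap^-1 *: v by apply/rowP => i; rewrite !mxE.
rewrite -(@ler_pXn2r _ 2)// ?nnegrE ?eucl_norm_ge0// eucl_norm_sq nsqZ expr1n.
rewrite exprVn mulrC ler_pdivrMr ?exprn_gt0// mul1r -eucl_norm_sq.
by rewrite ler_pXn2r// ?nnegrE ?eucl_norm_ge0// ltW.
Qed.

(** Each of the [m] segments of [[x - h, x]] is expanded from the node [x - c j.+1 h], with error
    [C |h|^2 / m^2]. Summing leaves [C t^2 / m]. *)
Lemma telescoping_lower x h : ball2 t h ->
  g x - g (x - h) - C * t ^+ 2 / m%:R <= m%:R^-1 * \sum_(j < m) dot (Dg (x - c j.+1 *: h)) h.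
Proof.
move=> hB; have C0 := taylor_C_ge0 gT.
pose f k := - g (x - c k *: h).
have -> : g x - g (x - h) = \sum_(j < m) (f j.+1 - f j).
  rewrite -(big_mkord xpredT (fun j => f j.+1 - f j)) telescope_sumr//.
  by rewrite /f /c mulfV ?gt_eqF// mul0r scale1r scale0r subr0 opprK addrC.
have -> : C * t ^+ 2 / m%:R = \sum_(j < m) (C * t ^+ 2 / m%:R ^+ 2).
  by rewrite sumr_const card_ord -mulr_natl; field; rewrite gt_eqF.
rewrite -sumrB mulr_sumr; apply: ler_sum => j _.
have := gT (x - c j.+1 *: h) (m%:R^-1 *: h).
rewrite (_ : x - c j.+1 *: h + m%:R^-1 *: h = x - c j *: h); last first.
  rewrite -addrA -scaleNr -scalerDl -[in RHS]scaleNr; congr (_ + _ *: _).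
  by rewrite /c -addn1 natrD; field; rewrite gt_eqF.
rewrite dotZr nsqZ ler_norml => /andP[_ H].
have ht : C * (m%:R^-1 ^+ 2 * nsq h) <= C * t ^+ 2 / m%:R ^+ 2.
  rewrite exprVn mulrCA mulrC; apply: ler_wpM2r; first by rewrite invr_ge0 exprn_ge0.
  by apply: ler_wpM2l => //; exact: ltW.
by rewrite /f opprK; lra.
Qed.

(** Integrated over [E], the right-hand side is at most [kap] times the perimeter, while the
    left-hand side becomes, after Fubini, an integral over [h] close to [A E t]. *)
Lemma telescoping_field : exists q : 'rV[R]_d.+1 -> 'rV[R]_d.+1,
  [/\ C1c_field q, (forall x, eucl_norm (q x) <= 1),
      (forall D : set L, bmf D (divergence q)) &
      forall x, Rintegral leb Bt (fun h => g x - g (x - h)) - C * t ^+ 2 / m%:R * fine (leb Bt) <=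
        kap * divergence q x].
Proof.
have [qC qdiv] := field_C1c; exists field; split => //.
- move=> D; rewrite (_ : divergence field = fun x => \sum_i Dp i x ord0 i); last exact/funext.
  apply: bmf_sum => i; split.
    by apply/measurable_funTS; apply: continuous_measurable; apply: taylor_continuousD (p_taylor i).
  exists (2 * 1 + (`|kap^-1| * (t * C * fine (leb Bt)))) => x _; apply: taylor_bound_grad (p_taylor i) _ => z.
  apply: le_trans (field_le1 z).
  have -> : p i z = field z ord0 i by rewrite mxE.
  rewrite -(@ler_pXn2r _ 2)// ?nnegrE ?eucl_norm_ge0// real_normK ?num_real// eucl_norm_sq.
  by rewrite /nsq (bigD1 i)//= lerDl sumr_ge0// => k _; exact: sqr_ge0.
- move=> x; rewrite qdiv /Dp.
  under eq_bigr do rewrite mxE mxE.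
  rewrite -mulr_sumr mulVKf ?gt_eqF ?kappa_gt0//.
  rewrite -(RI_sum mBt Btoo (fun i => bmf_Du i x i)) -(RI_cst leb mBt).
  have bg : bmf Bt (fun h : L => g x - g (x - h)).
    apply: bmfB; first exact: bmf_cst.
    by have := bmf_line x 1 Bt; under eq_fun do rewrite scale1r.
  rewrite -(RI_B mBt Btoo bg (bmf_cst Bt _)).
  apply: (RI_le mBt Btoo); [by apply: bmfB; [exact: bg|exact: bmf_cst]|by apply: bmf_sum|].
  move=> h /(telescoping_lower x) => H; apply: (le_trans H).
  rewrite le_eqVlt; apply/orP; left; apply/eqP.
  rewrite mulr_sumr; under [RHS]eq_bigr do rewrite mxE summxE mulr_sumr.
  rewrite exchange_big; apply: eq_bigr => j _ /=.
  by rewrite /dot mulr_sumr; apply: eq_bigr => i _; ring.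
Qed.

End telescoping_field.

Section perimeter_nonneg.
Context {R : realType} (d : nat).
Local Open Scope ereal_scope.

(** Tested with the zero field; this excludes [-oo] in later case distinctions. *)
Lemma Per_ge0 (E : set (@LRd R d)) : 0 <= Per E.
Proof.
apply: ereal_sup_ubound; exists (fun=> 0%R).
  split; last by move=> x; rewrite eucl_normE -[0%R : 'rV[R]_d](scale0r 0%R) nsqZ expr0n mul0r sqrtr0.
  have [|c _] := @C1c_field_taylor R d (fun _ _ => 0%R) (fun _ _ => 0%R) 0%R 0%R _ (fun _ _ _ => erefl).
    by move=> i x h; rewrite subr0 sub0r /dot big1 ?mul0r ?oppr0 ?normr0// => j _; rewrite mxE mul0r.
  by move: c; congr C1c_field; apply/funext => x; apply/rowP => i; rewrite !mxE.
rewrite integral0_eq// => x _; rewrite /divergence big1// => i _.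
under eq_fun do rewrite mxE. by rewrite derive_cst.
Qed.

End perimeter_nonneg.

(** * The translation variation is bounded by the perimeter *)

Section perimeter_upper.
Context {R : realType} (d : nat).
Hypothesis d0 : (0 < d)%N.
Local Notation L := (@LRd R d.+1).
Local Notation leb := (@leb R d.+1).
Implicit Types (x h : 'rV[R]_d.+1) (E : set 'rV[R]_d.+1).

Lemma chain_le (X Y a c k p e : R) : X - k <= Y -> a - c <= X -> Y <= p ->
  k <= e / 2 -> c <= e / 2 -> a <= p + e.
Proof. by move=> ? ? ? ? ?; lra. Qed.

Lemma cube_norm n (N : R) (x : 'rV[R]_n) : 0 <= N -> cube N x -> `|x| <= N.
Proof.
move=> N0 xN; rewrite [leLHS]mx_normrE; apply/bigmax_leP; split => // -[i j] _ /=.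
by have := xN j; rewrite (ord1 i) !mxE ler_norml => /andP[/ltW -> ->].
Qed.

Lemma borel_cube n (N : R) : borel (@cube R n N). Proof. exact: borel_box. Qed.

Lemma cube_exhaust n (E : set 'rV[R]_n) (eta : R) : borel E -> (@Defs.leb R n E < +oo)%E -> 0 < eta ->
  \forall N \near \oo, (@Defs.leb R n (E `\` cube N%:R) <= eta%:E)%E.
Proof.
move=> bE Eoo eta0; apply: decreasing_small => //.
- by move=> N; apply: borelD => //; exact: borel_cube.
- by apply: le_lt_trans Eoo; apply: le_outer_measure; exact: subDsetl.
- move=> m k mk x [Ex xk]; split => //; apply: contra_not xk => xm i.
  have := xm i; rewrite !mxE => /andP[h1 h2]; have : m%:R <= k%:R :> R by rewrite ler_nat.
  by move: (m%:R : R) (k%:R : R) h1 h2 => ? ? ? ? ?; apply/andP; split; lra.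
- move=> x; have : (\bigcup_N @cube R n N%:R) x by rewrite bigcup_cube.
  by move=> [N _ xN]; exists N => -[].
Qed.

(** Truncating [E] by a large cube gives bounded support at the cost of one [eta] inside [E];
    mollifying at a radius where [V] is below [eta] costs one [eta] on each side. *)
Lemma smooth_indicator E (eta : R) : borel E -> (leb E < +oo)%E -> 0 < eta ->
  exists g Dg C N, [/\ taylor g Dg C, (forall x, 0 <= g x <= 1),
    (forall x, N < `|x| -> g x = 0),
    (\int[leb]_(x in (E : set L)) (1 - g x)%:E <= (2 * eta)%:E)%E &
    (\int[leb]_(x in (~` E : set L)) (g x)%:E <= eta%:E)%E].
Proof.
move=> bE Eoo eta0.
have [n _ /(_ n (leqnn n)) nE] := cube_exhaust bE Eoo eta0.
pose F := E `&` cube n%:R.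
have bF : borel F by apply: borelI => //; exact: borel_cube.
have FE : F `<=` E by exact: subIsetl.
have Foo : (leb F < +oo)%E by apply: le_lt_trans Eoo; exact: le_outer_measure.
have [e e01 VF] := V_small_ball bF Foo eta0; have /andP[e0 e1] := e01.
have [rho [Drho [C [M rhoP]]]] := @mollifier_exists R d.+1 e e01.
have Tg := mollify_taylor rhoP bF Foo.
have g0 x : 0 <= mollify rho F x by exact: (mollify_ge0 rhoP bF Foo x).
have g1 x : mollify rho F x <= 1 by exact: (mollify_le1 rhoP bF Foo x).
have mE : measurable (E : set L) by exact: borel_measurable.
have mF : measurable (F : set L) by exact: borel_measurable.
have mg : measurable_fun setT (mollify rho F : L -> R).
  exact: continuous_measurable (taylor_continuous Tg).
have m1g : measurable_fun setT (fun x : L => (1 - mollify rho F x)%:E).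
  by apply/measurable_EFinP; apply: measurable_funB; [exact: measurable_cst|exact: mg].
exists (mollify rho F), (dmollify Drho F), (C * fine (leb F)), (n%:R + 1); split => //.
- by move=> x; rewrite g0 g1.
- move=> x xn; rewrite /mollify -[RHS](mul0r (fine (leb F))) -(RI_cst leb mF); apply: eq_Rintegral => y.
  rewrite inE => -[_ /(cube_norm (ler0n _ _)) yn].
  case: rhoP => _ _ _ rout _; apply: rout => /(ball2_norm e0) xye.
  have : `|x| <= `|y - x| + `|y|.
    by rewrite -[X in `|X| <= _](subKr y) (addrC `|y - x|) ler_normB.
  move: xn yn xye e1; move: `|x| `|y| `|y - x| (n%:R : R) => a b k l.
  by clear -a b k l => ? ? ? ? ?; lra.
- have EF : E = F `|` (E `\` F) by rewrite setDUK.
  have mD : measurable (E `\` F : set L) by exact: measurableD.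
  rewrite [X in (\int[_]_(x in X) _)%E]EF.
  rewrite (@ge0_integral_setU _ _ _ leb F (E `\` F) mF mD (fun x => (1 - mollify rho F x)%:E)); last 3 first.
  + exact: measurable_funTS.
  + by move=> x _; rewrite lee_fin subr_ge0.
  + by rewrite disj_set2E setDE setICA setICr setI0.
  rewrite mulr_natl mulr2n EFinD; apply: leeD.
    exact: (mollify_in rhoP bF Foo (ltW eta0) VF).
  have ED : E `\` F = E `\` cube n%:R.
    by apply/seteqP; split => x [Ex xF]; split => //; [apply: contra_not xF|apply: contra_not xF => -[]].
  apply: le_trans nE; rewrite -ED -[leRHS]mul1e -integral_cst//.
  apply: ge0_le_integral; first exact: mD.
  + by move=> x _; rewrite lee_fin subr_ge0.
  + exact: measurable_funTS.
  + exact: measurable_cst.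
  + by move=> x _; rewrite lee_fin gerBl.
- apply: le_trans (mollify_out rhoP bF Foo (ltW eta0) VF).
  apply: ge0_subset_integral.
  + exact: measurableC.
  + exact: measurableC.
  + by apply/measurable_funTS/measurable_EFinP.
  + by move=> x _; rewrite lee_fin.
  + exact: subsetC.
Qed.

(** The integral of [g] over [E] is at least [|E| - eta1]. That of [g (x - h)] is, by translation,
    an integral of [g] over the set where [x + h] is in [E], hence at most the measure of its part
    in [E] plus [eta2]. The difference of the two measures is [V E h]. *)
Lemma shift_lower E g Dg (C eta1 eta2 : R) h : borel E -> (leb E < +oo)%E ->
  taylor g Dg C -> (forall x, 0 <= g x <= 1) ->
  (\int[leb]_(x in (E : set L)) (1 - g x)%:E <= eta1%:E)%E ->
  (\int[leb]_(x in (~` E : set L)) (g x)%:E <= eta2%:E)%E ->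
  fine (V E h) - (eta1 + eta2) <= Rintegral leb E (fun x => g x - g (x - h)).
Proof.
move=> bE Eoo Tg g01 H1 H2.
have mE : measurable (E : set L) by exact: borel_measurable.
have g0 x : 0 <= g x by case/andP: (g01 x).
have bg v : bmf (E : set L) (fun x => g (x - v)).
  split; last by exists 1 => x _; have /andP[? ?] := g01 (x - v); rewrite ger0_norm.
  apply/measurable_funTS; apply: measurable_comp_continuous (taylor_continuous Tg) _ => i.
  exact: measurable_shift.
have bg0 : bmf (E : set L) g by have := bg 0; under eq_fun do rewrite subr0.
rewrite (RI_B mE Eoo bg0 (bg h)).
have mg : measurable_fun setT (fun x : L => (g x)%:E).
  by apply/measurable_EFinP; exact: continuous_measurable (taylor_continuous Tg).
have b1g : bmf (E : set L) (fun x => 1 - g x) by apply: bmfB; [exact: bmf_cst|exact: bg0].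
move: H1; rewrite (RI_E mE Eoo b1g) lee_fin (RI_B mE Eoo (bmf_cst _ 1) bg0) (RI_cst leb mE) mul1r => H1.
pose Eh : set L := [set x | E (x + h)].
have mEh : measurable Eh by exact: measurable_translate_borel.
have DI : (leb E = V E h + leb (E `&` Eh))%E by rewrite (measureDI leb mE mEh).
have Vfin : V E h \is a fin_num.
  by rewrite ge0_fin_numE ?V_ge0// (le_lt_trans _ Eoo)// V_le.
have Ifin : leb (E `&` Eh) \is a fin_num.
  rewrite ge0_fin_numE ?measure_ge0// (le_lt_trans _ Eoo)//; apply: le_outer_measure; exact: subIsetl.
have H3 : ((Rintegral leb E (fun x => g (x - h)))%:E <= leb (E `&` Eh) + eta2%:E)%E.
  rewrite -(RI_E mE Eoo (bg h)) integral_mkcond.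
  have mI : measurable (E `&` Eh : set L) by exact: measurableI.
  have mC : measurable (~` E : set L) by exact: measurableC.
  have m1 : measurable_fun setT (fun x : L => (\1_(E `&` Eh) x : R)%:E).
    by apply/measurable_EFinP; exact: measurable_indic.
  have m2 : measurable_fun setT (fun x : L => (\1_(~` E) x * g x)%:E).
    apply/measurable_EFinP; apply: measurable_funM; first exact: measurable_indic.
    exact: continuous_measurable (taylor_continuous Tg).
  have m3 : measurable_fun setT (fun x : L => (\1_Eh x * g x)%:E).
    apply/measurable_EFinP; apply: measurable_funM; first exact: measurable_indic.
    exact: continuous_measurable (taylor_continuous Tg).
  have -> : (\int[leb]_x ((fun x => (g (x - h))%:E) \_ E) x = \int[leb]_x (\1_Eh x * g x)%:E)%E.
    rewrite -[RHS](ge0_integral_translate (- h) m3); last by move=> x; rewrite lee_fin mulr_ge0.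
    apply: eq_integral => x _; rewrite patchE indicE.
    have -> : (x - h \in Eh) = (x \in (E : set L)) by rewrite /Eh; apply/idP/idP; rewrite !inE/= subrK.
    by case: ifPn => _; rewrite ?mul1r ?mul0r.
  apply: (@le_trans _ _ (\int[leb]_x ((\1_(E `&` Eh) x : R)%:E + (\1_(~` E) x * g x)%:E))%E).
    apply: ge0_le_integral; first exact: measurableT.
    - by move=> x _; rewrite lee_fin mulr_ge0.
    - exact: m3.
    - by apply: emeasurable_funD; [exact: m1|exact: m2].
    - move=> x _; rewrite -EFinD lee_fin !indicE in_setI in_setC.
      have /andP[? ?] := g01 x.
      by case: (x \in (E : set L)); case: (x \in Eh); rewrite /= ?mul0r ?mul1r ?addr0 ?add0r.
  rewrite (@ge0_integralD _ _ _ leb _ measurableT _ _ _ m1 _ m2); last 2 first.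
  - by move=> x _; rewrite lee_fin.
  - by move=> x _; rewrite lee_fin mulr_ge0.
  rewrite integral_indic// setIT; apply: leeD => //.
  apply: le_trans H2; rewrite [leRHS]integral_mkcond le_eqVlt; apply/orP; left; apply/eqP.
  by apply: eq_integral => x _; rewrite patchE indicE; case: ifPn => _; rewrite ?mul1r ?mul0r.
have DI' : fine (leb E) = fine (V E h) + fine (leb (E `&` Eh)) by rewrite DI fineD.
move: H3; rewrite -(fineK Ifin) -EFinD lee_fin.
by move: H1; rewrite DI'; lra.
Qed.

Lemma bmf_fineV E (D : set L) : borel E -> (leb E < +oo)%E -> bmf D (fun h => fine (V E h)).
Proof.
move=> bE Eoo; split.
  by apply/measurable_funTS; exact: (measurableT_comp (fine_measurable measurableT) (measurable_V bE)).
exists (fine (leb E)) => h _; rewrite ger0_norm ?fine_ge0 ?V_ge0// fine_le ?V_le//.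
- by rewrite ge0_fin_numE ?V_ge0// (le_lt_trans _ Eoo)// V_le.
- by rewrite ge0_fin_numE ?measure_ge0.
Qed.

Lemma A_Rintegral E t : borel E -> (leb E < +oo)%E ->
  A E t = (Rintegral leb (ball2 t : set L) (fun h => fine (V E h)))%:E.
Proof.
move=> bE Eoo; rewrite -(RI_E (@measurable_ball2 R d.+1 t) (leb_ball2_lty _ t) (bmf_fineV _ bE Eoo)).
rewrite integral_mkcond; apply: eq_integral => h _; rewrite patchE indicE.
case: ifPn => _; rewrite ?mul1e ?mul0e// fineK// ge0_fin_numE ?V_ge0// (le_lt_trans _ Eoo)//.
exact: V_le.
Qed.

Lemma perimeter_upper E (t : R) : borel E -> (leb E < +oo)%E -> 0 < t ->
  (A E t <= (@omega R d / d.+2%:R * t ^+ d.+2)%:E * Per (E : set L))%E.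
Proof.
move=> bE Eoo t0; have k0 := kappa_gt0 d t0.
set kap := (X in X%:E) in k0 *.
have Per0 : (0 <= Per (E : set L))%E := Per_ge0 _.
case Poo : (Per (E : set L)) Per0 => [P| |]// P0; last by rewrite gt0_muley ?lte_fin// leey.
rewrite -EFinM (A_Rintegral _ bE Eoo) lee_fin.
set Bt := (ball2 t : set L).
have mBt : measurable Bt by exact: measurable_ball2.
have Btoo : (leb Bt < +oo)%E by exact: leb_ball2_lty.
have mE : measurable (E : set L) by exact: borel_measurable.
set b := fine (leb Bt); have b0 : 0 <= b by rewrite fine_ge0// measure_ge0.
have e0 : 0 <= fine (leb E) by rewrite fine_ge0// measure_ge0.
apply/ler_addgt0Pr => eps eps0.
(* The approximation costs [2 eta + eta] for each [h], hence [3 eta b <= eps / 2] after integration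
   over the ball. *)
pose eta : R := eps / (6 * (b + 1)).
have eta0 : 0 < eta by rewrite divr_gt0// mulr_gt0// ltr_wpDl.
have [g [Dg [C [N [Tg g01 gout gin gex]]]]] := smooth_indicator bE Eoo eta0.
have C0 := taylor_C_ge0 Tg.
pose K := C * t ^+ 2 * b * fine (leb E).
have K0 : 0 <= K by do 3![apply: mulr_ge0 => //]; exact: sqr_ge0.
(* The number of segments makes the Taylor error [K / m] at most [eps / 2]. *)
pose m := (Num.truncn (2 * K / eps)).+1.
have mK : K / m%:R <= eps / 2.
  rewrite ler_pdivrMr ?ltr0n// mulrC -ler_pdivrMr ?divr_gt0// ltW//.
  by rewrite (_ : K / (eps / 2) = 2 * K / eps) ?truncnS_gt//; field; rewrite gt_eqF.
have [q [qC q1 bq qdiv]] := telescoping_field d0 Tg g01 gout t0 (ltn0Sn _ : 0 < m)%N.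
have qP : Rintegral leb E (divergence q) <= P.
  rewrite -lee_fin -Poo -(RI_E mE Eoo (bq _)); apply: ereal_sup_ubound; exists q => //; split => //.
have mu : measurable_fun setT (fun p : L * L => g p.1 - g (p.1 - p.2)).
  apply: measurable_funB; apply: measurable_comp_continuous (taylor_continuous Tg) _ => i.
    exact: mfst.
  under eq_fun do rewrite !mxE.
  by apply: measurable_funB; [exact: mfst|exact: msnd].
have uM p : `|g p.1 - g (p.1 - p.2)| <= 1.
  have /andP[? ?] := g01 p.1; have /andP[? ?] := g01 (p.1 - p.2).
  by rewrite ler_norml; apply/andP; split; lra.
have bi1 := bmf_inner1 (m2 := leb) mE mBt Btoo mu uM.
have bi2 := bmf_inner2 (m1 := leb) mE mBt Eoo mu uM.
have fub := fubini_bounded (m1 := leb) (m2 := leb) mE mBt Eoo Btoo mu uM.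
have step1 : Rintegral leb E (fun x => Rintegral leb Bt (fun h => g x - g (x - h))) - K / m%:R <=
    kap * Rintegral leb E (divergence q).
  rewrite -(RI_Z mE Eoo _ (bq _)).
  rewrite (_ : K / m%:R = Rintegral leb E (fun=> C * t ^+ 2 / m%:R * b)); last first.
    by rewrite (RI_cst leb mE) /K; ring.
  rewrite -(RI_B mE Eoo bi1 (bmf_cst _ _)); apply: (RI_le mE Eoo).
  - by apply: bmfB; [exact: bi1|exact: bmf_cst].
  - by apply: bmfZ; exact: bq.
  - by move=> x _; exact: qdiv.
have step2 : Rintegral leb Bt (fun h => fine (V E h)) - 3 * eta * b <=
    Rintegral leb Bt (fun h => Rintegral leb E (fun x => g x - g (x - h))).
  rewrite -(RI_cst leb mBt) -(RI_B mBt Btoo (bmf_fineV _ bE Eoo) (bmf_cst _ _)).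
  apply: (RI_le mBt Btoo).
  - by apply: bmfB; [exact: bmf_fineV|exact: bmf_cst].
  - exact: bi2.
  - move=> h _; have := shift_lower h bE Eoo Tg g01 gin gex; apply: le_trans.
    rewrite (_ : 3 = 2 + 1 :> R); last by rewrite -natr1.
    by rewrite mulrDl mul1r lexx.
move: fub step2 => /= <- step2.
have step3 : kap * Rintegral leb E (divergence q) <= kap * P by rewrite ler_pM2l.
apply: chain_le step1 step2 step3 mK _.
rewrite /eta (_ : 3 * _ * b = eps / 2 * (b / (b + 1))); last by field; rewrite gt_eqF// ltr_wpDl.
by rewrite -[leRHS]mulr1 ler_wpM2l ?divr_ge0 ?(ltW eps0)// ler_pdivrMr ?mul1r ?lerDl// ltr_wpDl.
Qed.

End perimeter_upper.

(** * Uniform estimates for test fields *)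

Section test_fields.
Context {R : realType} (d : nat).
Local Notation L := (@LRd R d).
Implicit Types (x y : 'rV[R]_d) (phi : 'rV[R]_d -> 'rV[R]_d).
Local Notation e_ i := (delta_mx ord0 i : 'rV[R]_d).
Local Notation partial phi i := (fun x => 'D_(e_ i) (fun y => phi y ord0 i) x).

(** Compactness gives one radius for all [x] in [K] and arbitrary [y]. If only [y] lies in [K] the
    roles are exchanged; if neither does, both values vanish. *)
Lemma uniform_continuity (q : 'rV[R]_d -> R) (K : set 'rV[R]_d) (eps : R) :
  compact K -> continuous q -> (forall x, ~ K x -> q x = 0) -> 0 < eps ->
  \forall del \near 0^'+, forall x y, `|x - y| < del -> `|q x - q y| <= eps.
Proof.
move=> cK cq q0 eps0.
have : \forall del \near 0^'+, K `<=` (fun x => forall y, `|x - y| < del -> `|q x - q y| <= eps).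
  move/compact_near_coveringP : cK; apply => x Kx.
  have e2 : 0 < eps / 2 by rewrite divr_gt0.
  have /(@cvgrPdist_le _ _ _ (nbhs x)) /(_ _ e2) := cq x.
  move=> /nbhs_ballP[r /= r0 rP].
  have r2 : 0 < r / 2 by rewrite divr_gt0.
  exists (ball x (r / 2), [set del | del < r / 2]); first split => /=.
  - exact: nbhsx_ballx.
  - exact: nbhs_right_lt.
  - move=> [x' del] /= [xx' dr] y x'y.
    have h1 : `|q x - q x'| <= eps / 2.
      by apply: rP; apply: le_ball xx'; rewrite ler_pdivrMr// ler_pMr// ler1n.
    have h2 : `|q x - q y| <= eps / 2.
      apply: rP; rewrite -ball_normE/=; rewrite -ball_normE/= in xx'.
      have := ler_normD (x - x') (x' - y); rewrite subrKA => h.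
      by apply: (le_lt_trans h); rewrite (splitr r); apply: ltrD => //; exact: lt_trans dr.
    have := ler_normB (q x - q y) (q x - q x'); rewrite opprB addrC subrKA => h.
    by apply: (le_trans h); rewrite (splitr eps) lerD.
apply: filterS => del dP x y xy.
have [Kx|Kx] := pselect (K x); first exact: dP.
have [Ky|Ky] := pselect (K y); first by rewrite distrC; apply: dP => //; rewrite distrC.
by rewrite !q0// subrr normr0 ltW.
Qed.

Lemma norm_delta (s : R) i : 0 <= s -> `|s *: e_ i| <= s.
Proof.
move=> s0; rewrite [leLHS]mx_normrE; apply/bigmax_leP; split => // -[k j] _ /=.
by rewrite !mxE normrM ger0_norm//; case: (_ && _); rewrite ?normr1 ?normr0 ?mulr1 ?mulr0.
Qed.

Lemma field_support phi : C1c_field phi -> exists K : set 'rV[R]_d,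
  [/\ compact K, forall x, ~ K x -> phi x = 0 & forall x i, ~ K x -> partial phi i x = 0].
Proof.
move=> [_ _ cK]; set K := closure _ in cK; exists K.
have phi0 x : ~ K x -> phi x = 0.
  by move=> Kx; apply/eqP/negPn/negP => px; apply: Kx; exact: subset_closure.
split => // x i Kx.
have near0 : \forall y \near x, phi y ord0 i = 0.
  have oK : open (~` K) by apply: closed_openC; exact: closed_closure.
  have : \forall y \near x, (~` K) y by apply: open_nbhs_nbhs.
  by apply: filterS => y /phi0 ->; rewrite mxE.
have -> : 'D_(e_ i) (fun y => phi y ord0 i) x = 'D_(e_ i) (cst (0 : R)) x.
  exact: near_eq_derive near0.
exact: derive_cst.
Qed.

Lemma differentiable_component phi x i :
  differentiable phi x -> differentiable (fun y => phi y ord0 i) x.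
Proof. move=> dphi; have dc : differentiable (fun v : 'rV[R]_d => v ord0 i) (phi x) by exact: differentiable_coord.
exact: (differentiable_comp dphi dc). Qed.

Lemma line_derive (q : 'rV[R]_d -> R) x v (r : R) : differentiable q (x + r *: v) ->
  is_derive r 1 (fun r => q (x + r *: v)) ('D_v q (x + r *: v)).
Proof.
move=> dq; have dv : derivable q (x + r *: v) v by exact: diff_derivable.
have E : (fun h : R => h^-1 *: (((fun r => q (x + r *: v)) \o shift r) (h *: 1) - q (x + r *: v))) =
  (fun h : R => h^-1 *: ((q \o shift (x + r *: v)) (h *: v) - q (x + r *: v))).
  apply/funext => h /=; congr (_ *: (q _ - _)).
  by rewrite [h *: 1]mulr1 scalerDl addrCA.
by split; rewrite /derivable /derive E.
Qed.

(** The mean value theorem along the i-th axis and uniform continuity of the partial derivative. The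
    point [y] is kept apart from [x] because increments will be averaged over all [x] near a fixed
    [y]. *)
Lemma field_increment phi (eps : R) : C1c_field phi -> 0 < eps ->
  exists2 del : R, 0 < del <= 1 & forall i x y s, 0 < s <= del -> `|x - y| <= del ->
    `|phi (x + s *: e_ i) ord0 i - phi x ord0 i - s * partial phi i y| <= s * eps.
Proof.
move=> phiC eps0; have [K [cK _ K0]] := field_support phiC; have [dphi cphi _] := phiC.
have : \forall del \near 0^'+, forall i x y, `|x - y| < del ->
    `|partial phi i x - partial phi i y| <= eps.
  apply: filter_forall => i; exact: (uniform_continuity cK (cphi i i) (fun x => @K0 x i) eps0).
move=> near_del.
have : \forall del \near (0 : R)^'+, 0 < del <= 1 by near=> del; apply/andP; split; near: del;
  [exact: nbhs_right_gt|exact: nbhs_right_le].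
move=> /(filterI near_del)/filter_ex[del [dP /andP[del0 del1]]].
(* The intermediate point is within [|x - y| + s <= 2 del / 3 < del] of [y]. *)
exists (del / 3).
  by rewrite divr_gt0//= ler_pdivrMr// mul1r (le_trans del1)// ler1n.
move=> i x y s /andP[s0 sdel] xy.
pose F (r : R) := phi (x + r *: e_ i) ord0 i.
have dF (r : R) : is_derive r 1 F (partial phi i (x + r *: e_ i)).
  by apply: line_derive; exact: differentiable_component.
have Fc : {within `[0, s], continuous F}.
  by apply: derivable_within_continuous => r _; have [] := dF r.
have [r + ] := MVT_segment (ltW s0) (fun r _ => dF r) Fc.
rewrite in_itv/= => /andP[r0 rs].
rewrite /F scale0r addr0 subr0 => ->.
rewrite mulrC -mulrBr normrM gtr0_norm// ler_pM2l//; apply: dP.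
have : `|x + r *: e_ i - y| <= `|x - y| + `|r *: e_ i| by rewrite addrAC ler_normD.
by have := norm_delta i r0; lra.
Unshelve. all: by end_near. Qed.

Lemma bmf_divergence phi (D : set L) : C1c_field phi -> bmf D (divergence phi).
Proof.
move=> phiC; have [K [cK _ K0]] := field_support phiC; have [dphi cphi _] := phiC.
apply: bmf_sum => i; split.
  by apply/measurable_funTS; apply: continuous_measurable; exact: cphi.
have : compact ((partial phi i) @` K).
  by apply: continuous_compact => //; apply: continuous_subspaceT; exact: cphi.
move=> /compact_bounded[M [_ /(_ (`|M| + 1)) MP]]; exists (`|M| + 1) => x _.
have [Kx|Kx] := pselect (K x); last by rewrite K0// normr0 addr_ge0.
by apply: MP; [rewrite (le_lt_trans (ler_norm _))// ltrDl|exists x].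
Qed.

End test_fields.

(** * The perimeter is bounded by the translation variation *)

Section perimeter_lower.
Context {R : realType} (d : nat).
Hypothesis d0 : (0 < d)%N.
Local Notation L := (@LRd R d.+1).
Local Notation leb := (@leb R d.+1).
Local Notation e_ i := (delta_mx ord0 i : 'rV[R]_d.+1).
Local Notation partial phi i := (fun x => 'D_(e_ i) (fun y => phi y ord0 i) x).
Implicit Types (x y h : 'rV[R]_d.+1) (E : set 'rV[R]_d.+1).

Lemma max0_le (a b c : R) : 0 <= c -> a <= b + c -> Num.max a 0 <= Num.max b 0 + c.
Proof.
move=> c0 abc; rewrite ge_max addr_ge0 ?le_max ?lexx ?orbT// andbT.
by apply: (le_trans abc); rewrite lerD2r le_max lexx.
Qed.

Lemma le_of_dist (a b c c' : R) : `|b - a| <= c -> c <= c' -> a <= b + c'.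
Proof. by rewrite ler_norml => /andP[? ?] ?; lra. Qed.

Lemma V_fin_num E h : borel E -> (leb E < +oo)%E -> V E h \is a fin_num.
Proof. by move=> bE Eoo; rewrite ge0_fin_numE ?V_ge0// (le_lt_trans _ Eoo)// V_le. Qed.

Lemma fine_leb_ball2 (t : R) : 0 < t ->
  fine (leb (ball2 t)) = t ^+ d.+1 * fine (leb (ball2 1)).
Proof.
move=> t0; rewrite (leb_ball2_scale _ t0) fineM//.
by rewrite ge0_fin_numE ?measure_ge0// leb_ball2_lty.
Qed.

Lemma norm_cube n (N : R) (x : 'rV[R]_n) : `|x| < N -> cube N x.
Proof.
move=> xN i; have xi : `|x ord0 i| <= `|x|.
  by rewrite [leRHS]mx_normrE; apply: le_trans (le_bigmax _ _ (ord0, i)).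
by have := le_lt_trans xi xN; rewrite !mxE ltr_norml => /andP[-> /ltW ->].
Qed.

Lemma Rintegral_translate v (u : L -> R) : measurable_fun setT u ->
  Rintegral leb setT (fun x => u (x + v)) = Rintegral leb setT u.
Proof.
move=> mu; have mEu : measurable_fun setT (EFin \o u) by exact/measurable_EFinP.
rewrite /Rintegral integralE [in RHS]integralE; congr (fine (_ - _)).
  have H := ge0_integral_translate v (measurable_funepos mEu) (funepos_ge0 _).
  by rewrite -[RHS]H; apply: eq_integral => x _; rewrite !funeposE.
have H := ge0_integral_translate v (measurable_funeneg mEu) (funeneg_ge0 _).
by rewrite -[RHS]H; apply: eq_integral => x _; rewrite !funenegE.
Qed.

Lemma Rintegral_support (D : set L) (u : L -> R) : (forall x, ~ D x -> u x = 0) ->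
  Rintegral leb setT u = Rintegral leb D u.
Proof.
move=> u0; rewrite [in RHS]/Rintegral integral_mkcond; congr fine; apply: eq_integral => x _.
by rewrite patchE; case: ifPn => //; rewrite notin_setE => /u0 /= ->.
Qed.

Variables (e : R) (rho : 'rV[R]_d.+1 -> R) (Drho : 'rV[R]_d.+1 -> 'rV[R]_d.+1) (C M : R).
Hypotheses (e01 : 0 < e <= 1) (rhoP : mollifier e rho Drho C M).

Let rhoT : taylor rho Drho C. Proof. by case: rhoP. Qed.
Let rho0 x : 0 <= rho x. Proof. by case: rhoP => _ /(_ x)/andP[]. Qed.
Let rhoN x : rho (- x) = rho x. Proof. by case: rhoP. Qed.
Let rhoM x : `|rho x| <= M. Proof. by case: rhoP => _ /(_ x)/andP[? ?] _ _ _; rewrite ger0_norm. Qed.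
Let C0 : 0 <= C. Proof. exact: taylor_C_ge0 rhoT. Qed.

Let rhoB x y : rho (y - x) = rho (x - y). Proof. by rewrite -opprB rhoN. Qed.

Let mshift h i : measurable_fun setT (fun x : L => (x + h) ord0 i).
Proof.
under eq_fun do rewrite mxE.
by apply: measurable_funD; [exact: measurable_coord|exact: measurable_cst].
Qed.

Let bmf_rhoB (D : set L) y : bmf D (fun x => rho (y - x)).
Proof. by under eq_fun do rewrite rhoB; exact: (bmf_rho rhoP D y). Qed.

Let bmf_DrhoB (D : set L) y i : bmf D (fun x => Drho (y - x) ord0 i).
Proof.
split; last by exists (2 * M + C) => x _; exact: (taylor_bound_grad _ _ rhoT rhoM).
apply/measurable_funTS.
apply: (measurable_comp_continuous (taylor_continuousD (i := i) rhoT)) => j.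
under eq_fun do rewrite !mxE.
by apply: measurable_funB; [exact: measurable_cst|exact: measurable_coord].
Qed.

Section mollified_field.
Variables (phi : 'rV[R]_d.+1 -> 'rV[R]_d.+1) (N del eps : R).
Hypotheses (phiC : C1c_field phi) (phi1 : forall x, eucl_norm (phi x) <= 1).
Hypotheses (phi_out : forall x, ~ cube N x -> phi x = 0).
Hypotheses (edel : e <= del) (del0 : 0 < del).
Hypothesis phi_incr : forall i x y s, 0 < s <= del -> `|x - y| <= del ->
    `|phi (x + s *: e_ i) ord0 i - phi x ord0 i - s * partial phi i y| <= s * eps.
Local Notation K := (cube N : set L).

Let mK : measurable K. Proof. apply: borel_measurable; exact: borel_cube. Qed.
Let Koo : (leb K < +oo)%E. Proof. exact: le_lt_trans (leb_box_le _ _) (ltry _). Qed.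

Lemma component_le x i : `|x ord0 i| <= eucl_norm x.
Proof.
rewrite -(@ler_pXn2r _ 2)// ?nnegrE ?eucl_norm_ge0// real_normK ?num_real// eucl_norm_sq.
by rewrite /nsq (bigD1 i)//= lerDl sumr_ge0// => k _; exact: sqr_ge0.
Qed.

Lemma continuous_component i : continuous (fun x => phi x ord0 i).
Proof.
by move=> x; apply: differentiable_continuous; apply: differentiable_component; case: phiC.
Qed.

Lemma bmf_component (D : set L) v i : bmf D (fun x => phi (x + v) ord0 i).
Proof.
split; last by exists 1 => x _; exact: le_trans (component_le _ _) (phi1 _).
apply/measurable_funTS.
exact: (measurable_comp_continuous (continuous_component (i := i)) (mshift v)).
Qed.

Lemma bmf_component0 (D : set L) i : bmf D (fun x => phi x ord0 i).
Proof. by have := bmf_component D 0 i; under eq_fun do rewrite addr0. Qed.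

Let w i y := Rintegral leb K (fun x => phi x ord0 i * rho (y - x)).

(** The substitution moves the increment from the kernel to the field, where [phi_incr] can be
    used. *)
Let w_shift i y v (D : set L) : (forall x, ball2 e (y - x) -> D x) ->
  w i (y + v) = Rintegral leb D (fun x => phi (x + v) ord0 i * rho (y - x)).
Proof.
move=> yD; rewrite /w -Rintegral_support; last by move=> x xK; rewrite phi_out// mxE mul0r.
have mu := (bmfM (bmf_component0 setT i) (bmf_rhoB setT (y + v))).1.
rewrite -(Rintegral_translate v mu) -(@Rintegral_support D).
  by congr Rintegral; apply/funext => x; rewrite opprD addrACA subrr addr0.
move=> x xD; case: rhoP => _ _ _ -> //; first by rewrite mulr0.
by move=> /yD.
Qed.

(** Replaces an integration by parts. The integral is the derivative of the mollified component
    computed on the kernel; the difference quotients of that component, computed on the field, are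
    within [eps] of the partial derivative at [y]. *)
Lemma mollified_partial i y :
  `|Rintegral leb K (fun x => phi x ord0 i * Drho (y - x) ord0 i) - partial phi i y| <= eps.
Proof.
(* Contains the support of the kernel centred at [y], since [e <= 1]. *)
pose D : set L := cube (`|y| + 2).
have mD : measurable D by apply: borel_measurable; exact: borel_cube.
have Doo : (leb D < +oo)%E by exact: le_lt_trans (leb_box_le _ _) (ltry _).
have /andP[e0 e1] := e01.
have yD x : ball2 e (y - x) -> D x.
  move=> /(ball2_norm e0) yx; apply: norm_cube.
  have := ler_normB y (y - x); rewrite subKr; move: yx.
  by move: `|x| `|y| `|y - x| => a b c; lra.
set q := partial phi i y.
have rho_int : Rintegral leb D (fun x => rho (y - x)) = 1.
  rewrite -Rintegral_support; last by move=> x xD; case: rhoP => _ _ _ -> // /yD.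
  rewrite /Rintegral; under eq_integral do rewrite rhoB.
  by rewrite (integral_rho_shift rhoP).
have b1 v := bmfM (bmf_component D v i) (bmf_rhoB D y).
have incr s : 0 < s <= del -> `|w i (y + s *: e_ i) - w i y - s * q| <= s * eps.
  move=> /andP[s0 sdel].
  rewrite (w_shift _ _ yD) -[in w i y](addr0 y) (w_shift _ _ yD).
  rewrite -[s * q]mulr1 -rho_int -(RI_B mD Doo (b1 _) (b1 _)).
  rewrite -(RI_Z mD Doo _ (bmf_rhoB D y)) -(RI_B mD Doo (bmfB (b1 _) (b1 _)) (bmfZ _ (bmf_rhoB D y))).
  rewrite -[s * eps]mulr1 -rho_int -(RI_Z mD Doo _ (bmf_rhoB D y)).
  have bI := bmfB (bmfB (b1 (s *: e_ i)) (b1 0)) (bmfZ (s * q) (bmf_rhoB D y)).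
  have bR := bmfZ (s * eps) (bmf_rhoB D y).
  have key x : `|phi (x + s *: e_ i) ord0 i * rho (y - x) - phi (x + 0) ord0 i * rho (y - x) -
      s * q * rho (y - x)| <= s * eps * rho (y - x).
    rewrite -!mulrBl normrM (ger0_norm (rho0 _)); have [yx|yx] := pselect (ball2 e (y - x)); last first.
      by case: rhoP => _ _ _ -> // _; rewrite !mulr0.
    apply: ler_wpM2r => //; rewrite addr0; apply: phi_incr; first by rewrite s0.
    by rewrite distrC; apply: le_trans edel; exact: ball2_norm.
  rewrite ler_norml; apply/andP; split.
    rewrite lerNl -mulN1r -(RI_Z mD Doo _ bI); apply: (RI_le mD Doo) => [||x _].
    - exact: bmfZ bI.
    - exact: bR.
    - by rewrite mulN1r lerNl; have := key x; rewrite ler_norml => /andP[].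
  apply: (RI_le mD Doo) => [||x _].
  - exact: bI.
  - exact: bR.
  - by have := key x; rewrite ler_norml => /andP[].
have Tw : taylor (w i) (fun y => \row_k Rintegral leb K (fun x => phi x ord0 i * Drho (y - x) ord0 k)) (C * fine (leb K)).
  have := @taylor_Rintegral R d.+1 _ _ leb K mK Koo (fun y x => phi x ord0 i * rho (y - x))
    (fun y x => phi x ord0 i *: Drho (y - x)) C.
  have -> : (fun y => \row_k Rintegral leb K (fun x => (phi x ord0 i *: Drho (y - x)) ord0 k)) =
     (fun y => \row_k Rintegral leb K (fun x => phi x ord0 i * Drho (y - x) ord0 k)).
    by apply/funext => z; apply/rowP => k; rewrite !mxE; congr Rintegral; apply/funext => x; rewrite mxE.
  move=> TR; apply: TR => [z|z k|x _].
  - by apply: bmfM; [exact: bmf_component0|exact: bmf_rhoB].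
  - under eq_fun do rewrite mxE.
    by apply: bmfM; [exact: bmf_component0|exact: bmf_DrhoB].
  - apply: taylor_weaken (taylorZ _ (taylor_translate (- x) rhoT)).
    rewrite -[leRHS]mul1r; apply: ler_wpM2r => //.
    exact: le_trans (component_le _ _) (phi1 _).
set p := Rintegral _ _ _; set C' := C * fine (leb K) in Tw.
have C'0 : 0 <= C' by rewrite mulr_ge0// fine_ge0// measure_ge0.
(* The Taylor bound and the increment bound for the same step [s] are subtracted and divided by [s];
   then [s] tends to 0. *)
have step s : 0 < s <= del -> `|p - q| <= eps + C' * s.
  move=> sdel; have /andP[s0 _] := sdel.
  have := incr s sdel; have := Tw y (s *: e_ i).
  rewrite dotZr dot_delta mxE -/p nsqZ nsq_delta mulr1 => h1 h2.
  rewrite -(ler_pM2l s0) -[X in X * `|_|](gtr0_norm s0) -normrM.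
  move: h1 h2; rewrite !ler_norml => /andP[? ?] /andP[? ?].
  by apply/andP; split; nra.
apply/ler_addgt0Pr => a a0.
pose s := Num.min del (a / (C' + 1)).
have p0 : 0 < C' + 1 by rewrite ltr_wpDl.
have s0 : 0 < s by rewrite lt_min del0 divr_gt0.
have /step : 0 < s <= del by rewrite s0 ge_min lexx.
move/le_trans; apply; rewrite lerD2l.
apply: (@le_trans _ _ (C' * (a / (C' + 1)))).
  by apply: ler_wpM2l => //; rewrite ge_min lexx orbT.
by rewrite mulrCA -[leRHS]mulr1 ler_pM2l// ler_pdivrMr// mul1r lerDl.
Qed.

End mollified_field.

Section energy.
Variables (E : set 'rV[R]_d.+1) (S : R).
Hypotheses (bE : borel E) (Eoo : (leb E < +oo)%E).
Local Notation f := (mollify rho E).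
Local Notation Df := (dmollify Drho E).
Local Notation Cf := (C * fine (leb E)).

Let mE : measurable (E : set L). Proof. exact: borel_measurable. Qed.
Let fT : taylor f Df Cf. Proof. exact: (mollify_taylor rhoP bE Eoo). Qed.
Let f01 x : 0 <= f x <= 1.
Proof. by rewrite (mollify_ge0 rhoP bE Eoo) (mollify_le1 rhoP bE Eoo). Qed.
Let Cf0 : 0 <= Cf. Proof. exact: taylor_C_ge0 fT. Qed.

Let mrho : measurable_fun setT (fun p : L * L => rho (p.2 - p.1)).
Proof.
apply: (measurable_mollifier rhoP) => i; under eq_fun do rewrite !mxE.
by apply: measurable_funB; [exact: msnd|exact: mfst].
Qed.

(** The increment at [x] is at most the mollified indicator of [Q], the points outside [E] that [h]
    brings into [E]. As [rho] has mass 1 this integrates to the measure of [Q], which is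
    [V E (- h) = V E h]. *)
Lemma mollify_increment h :
  (\int[leb]_x (Num.max (f (x + h) - f x) 0)%:E <= V E h)%E.
Proof.
pose Q : set L := [set y | E (y + h) /\ ~ E y].
have mQ : measurable Q.
  by apply: measurableI; [exact: measurable_translate_borel|exact: measurableC].
have mind (X : set L) x : measurable X ->
    measurable_fun setT (fun y : L => (\1_X y * rho (y - x))%:E).
  move=> mX; apply/measurable_EFinP; apply: measurable_funM; first exact: measurable_indic.
  exact: (measurable_rho_shift rhoP).
have pos (X : set L) x y : (0 <= (\1_X y * rho (y - x))%:E)%E by rewrite lee_fin mulr_ge0.
have fE x : ((f x)%:E = \int[leb]_y (\1_E y * rho (y - x))%:E)%E.
  rewrite (mollifyE rhoP bE Eoo) integral_mkcond; apply: eq_integral => y _.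
  by rewrite patchE indicE; case: ifPn => _; rewrite ?mul1r ?mul0r.
pose W x := (\int[leb]_y (\1_Q y * rho (y - x))%:E)%E.
have W0 x : (0 <= W x)%E by apply: integral_ge0 => y _; exact: pos.
have fW x : ((Num.max (f (x + h) - f x) 0)%:E <= W x)%E.
  rewrite EFin_max ge_max W0 andbT EFinB leeBlDl; last by []. 
  rewrite fE.
  rewrite -(ge0_integral_translate h (mind _ (x + h) mE) (pos _ _)) fE.
  rewrite /W -(@ge0_integralD _ _ _ leb _ measurableT _ _ (fun y _ => pos _ x y) (mind _ x mE) (fun y _ => pos _ x y) (mind _ x mQ)).
  apply: ge0_le_integral; first exact: measurableT.
  - by move=> y _; exact: pos.
  - apply/measurable_EFinP; apply: measurable_funM.
      exact: (measurable_indic_borel bE (mshift h)).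
    apply: (measurable_mollifier rhoP) => i.
    by under eq_fun do rewrite -addrA; exact: mshift.
  - by apply: emeasurable_funD; exact: mind.
  - move=> y _; rewrite -EFinD lee_fin opprD addrACA subrr addr0 -mulrDl.
    apply: ler_wpM2r => //; rewrite !indicE.
    rewrite -natrD ler_nat; case: (boolP (y + h \in E)) => //; rewrite inE => yhE.
    by case: (boolP (y \in E)) => // yE; rewrite (_ : y \in Q)// inE; split => //; move/negP: yE; rewrite inE.
have mF : measurable_fun setT (fun p : L * L => (\1_Q p.2 * rho (p.2 - p.1))%:E).
  apply/measurable_EFinP; apply: measurable_funM; last exact: mrho.
  exact: (measurableT_comp (measurable_indic mQ) measurable_snd).
have F0 (p : L * L) : (0 <= (\1_Q p.2 * rho (p.2 - p.1))%:E)%E by exact: pos.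
apply: (@le_trans _ _ (\int[leb]_x W x)%E).
  apply: ge0_le_integral; first exact: measurableT.
  - by move=> x _; rewrite lee_fin le_max lexx orbT.
  - apply/measurable_EFinP.
    have mi : measurable_fun setT (fun x : L => f (x + h) - f x).
      apply: measurable_funB; last exact: continuous_measurable (taylor_continuous fT).
      exact: (measurable_comp_continuous (taylor_continuous fT) (mshift h)).
    exact: (@measurable_maxr _ L R setT (fun x : L => f (x + h) - f x) (fun=> 0) mi (measurable_cst _)).
  - exact: (@measurable_fun_fubini_tonelli_F _ _ _ _ _ leb _ mF F0).
  - by move=> x _; exact: fW.
rewrite /W (@fubini_tonelli _ _ _ _ _ leb leb _ mF F0) /=.
have inner y : (\int[leb]_x (\1_Q y * rho (y - x))%:E = (\1_Q y : R)%:E)%E.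
  under eq_integral do rewrite EFinM.
  rewrite ge0_integralZl; last 4 first.
  - exact: measurableT.
  - by apply/measurable_EFinP; exact: (bmf_rhoB setT y).1.
  - by move=> x _; rewrite lee_fin.
  - by rewrite lee_fin.
  under eq_integral do rewrite rhoB.
  by rewrite (integral_rho_shift rhoP) mule1.
under eq_integral do rewrite inner.
rewrite (integral_indic leb measurableT mQ) setIT -(V_opp h bE Eoo) /V -(leb_translate h (Vset E (- h))).
rewrite le_eqVlt; apply/orP; left; apply/eqP; congr (_ _); apply/seteqP; split => y.
  by move=> [yhE yE]; split => //; rewrite addrK.
by move=> [yhE]; rewrite addrK.
Qed.

Variables (N : R).
Local Notation K := (cube N : set L).
Hypothesis A_le : forall t : R, 0 < t <= 1 -> (A E t <= (S * t ^+ d.+2)%:E)%E.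

Let mK : measurable K. Proof. apply: borel_measurable; exact: borel_cube. Qed.
Let Koo : (leb K < +oo)%E. Proof. exact: le_lt_trans (leb_box_le _ _) (ltry _). Qed.

Lemma bmf_grad_norm : bmf K (fun x => eucl_norm (Df x)).
Proof.
split.
  apply/measurable_funTS; apply: measurable_eucl_norm => i.
  by apply: continuous_measurable; exact: taylor_continuousD fT.
have f1 x : `|f x| <= 1 by have /andP[? ?] := f01 x; rewrite ger0_norm.
exists ((d.+1%:R + 1) * (2 * 1 + Cf)) => x _; rewrite ger0_norm ?eucl_norm_ge0//.
apply: (le_trans (eucl_norm_le_norm _)); apply: ler_wpM2l; first by rewrite addr_ge0.
rewrite [leLHS]mx_normrE; apply/bigmax_leP; split => [|[k j] _ /=]; first by rewrite addr_ge0.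
by rewrite (ord1 k); exact: taylor_bound_grad fT f1.
Qed.

(** The left-hand side does not depend on [t]: the inequality at scale [t] is divided by t^(d+2),
    and the error left over, of order [t], is removed by letting [t] tend to 0. Restricting to a
    cube keeps this error finite. *)
Lemma gradient_energy :
  @omega R d / d.+2%:R * Rintegral leb K (fun x => eucl_norm (Df x)) <= S.
Proof.
set k1 := _ / _; set I := Rintegral _ _ _.
pose b1 := fine (leb (ball2 1)); have b10 : 0 <= b1 by rewrite fine_ge0// measure_ge0.
have lK0 : 0 <= fine (leb K) by rewrite fine_ge0// measure_ge0.
have main (t : R) : 0 < t <= 1 -> k1 * I <= S + Cf * fine (leb K) * b1 * t.
  move=> t01; have /andP[t0 t1] := t01.
  have mBt : measurable (ball2 t : set L) by exact: measurable_ball2.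
  have Btoo : (leb (ball2 t) < +oo)%E by exact: leb_ball2_lty.
  pose u (p : L * L) := Num.max (f (p.1 + p.2) - f p.1) 0 + Cf * t ^+ 2.
  have mi : measurable_fun setT (fun p : L * L => f (p.1 + p.2) - f p.1).
    apply: measurable_funB; apply: (measurable_comp_continuous (taylor_continuous fT)) => i.
      exact: madd.
    exact: mfst.
  have mx : measurable_fun setT (fun p : L * L => Num.max (f (p.1 + p.2) - f p.1) 0).
    exact: (@measurable_maxr _ (L * L)%type R setT (fun p : L * L => f (p.1 + p.2) - f p.1) (fun=> 0) mi (measurable_cst _)).
  have mu : measurable_fun setT u by apply: measurable_funD; [exact: mx|exact: measurable_cst].
  have m01 p : 0 <= Num.max (f (p.1 + p.2) - f p.1) 0 <= 1.
    have /andP[? ?] := f01 (p.1 + p.2); have /andP[? ?] := f01 p.1.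
    by rewrite le_max lexx orbT ge_max ler01 andbT /=; lra.
  have Ct0 : 0 <= Cf * t ^+ 2 by apply: mulr_ge0 => //; exact: sqr_ge0.
  have uM p : `|u p| <= 1 + Cf * t ^+ 2.
    by have /andP[? ?] := m01 p; rewrite ger0_norm /u ?lerD2r// addr_ge0.
  have bi1 := bmf_inner1 (m2 := leb) mK mBt Btoo mu uM.
  have bi2 := bmf_inner2 (m1 := leb) mK mBt Koo mu uM.
  have fub := fubini_bounded (m1 := leb) (m2 := leb) mK mBt Koo Btoo mu uM.
  have low : k1 * t ^+ d.+2 * I <= Rintegral leb K (fun x => Rintegral leb (ball2 t) (fun h => u (x, h))).
    rewrite -(RI_Z mK Koo _ bmf_grad_norm); apply: (RI_le mK Koo).
    - by apply: bmfZ; exact: bmf_grad_norm.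
    - exact: bi1.
    - move=> x _; rewrite -(Rintegral_dot_pos d0 t0); apply: (RI_le mBt Btoo).
      + exact: bmf_dot_pos.
      + split; last by exists (1 + Cf * t ^+ 2) => h _; exact: uM.
        by apply/measurable_funTS; exact: (measurableT_comp mu (pair1_measurable x)).
      + move=> h hB; apply: (@max0_le (dot h (Df x)) (f (x + h) - f x) _ Ct0).
        have hn : nsq h < t ^+ 2 := hB.
        have hC : Cf * nsq h <= Cf * t ^+ 2 := ler_wpM2l Cf0 (ltW hn).
        rewrite (dotC h); exact: le_of_dist (fT x h) hC.
  have up : Rintegral leb (ball2 t) (fun h => Rintegral leb K (fun x => u (x, h))) <=
      S * t ^+ d.+2 + Cf * t ^+ 2 * fine (leb K) * fine (leb (ball2 t)).
    have H : Rintegral leb (ball2 t) (fun h => fine (V E h)) <= S * t ^+ d.+2.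
      by have := A_le t01; rewrite (A_Rintegral _ bE Eoo) lee_fin.
    apply: (le_trans _ (lerD H (lexx _))).
    rewrite -(RI_cst leb mBt) -(RI_D mBt Btoo (bmf_fineV _ bE Eoo) (bmf_cst _ _)).
    apply: (RI_le mBt Btoo).
    - exact: bi2.
    - by apply: bmfD; [exact: bmf_fineV|exact: bmf_cst].
    - move=> h _; rewrite /u /=.
      have bm : bmf K (fun x => Num.max (f (x + h) - f x) 0).
        split; first by apply/measurable_funTS; exact: (measurableT_comp mx (pair2_measurable h)).
        by exists 1 => x _; have /andP[? ?] := m01 (x, h); rewrite ger0_norm.
      rewrite (RI_D mK Koo bm (bmf_cst _ _)) (RI_cst leb mK) lerD2r.
      rewrite -lee_fin -(RI_E mK Koo bm) fineK; last exact: (V_fin_num h bE Eoo).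
      apply: le_trans (mollify_increment h); apply: (ge0_subset_integral leb mK measurableT).
      - apply/measurable_EFinP; exact: (measurableT_comp mx (pair2_measurable h)).
      - by move=> x _; rewrite lee_fin le_max lexx orbT.
      - exact: subsetT.
  have := le_trans low (le_trans (_ : _ <= _) up); rewrite fub => /(_ (lexx _)).
  rewrite (fine_leb_ball2 t0) -/b1.
  have t20 : 0 < t ^+ d.+2 by rewrite exprn_gt0.
  have -> : S * t ^+ d.+2 + Cf * t ^+ 2 * fine (leb K) * (t ^+ d.+1 * b1) =
     (S + Cf * fine (leb K) * b1 * t) * t ^+ d.+2 by rewrite !exprS expr0; ring.
  by rewrite mulrAC ler_pM2r.
apply/ler_addgt0Pr => a a0.
set c := Cf * fine (leb K) * b1 in main.
have c0 : 0 <= c by rewrite /c; do 2![apply: mulr_ge0 => //].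
have p0 : 0 < c + 1 by rewrite ltr_wpDl.
pose t := Num.min 1 (a / (c + 1)).
have t0 : 0 < t by rewrite lt_min ltr01 divr_gt0.
have /main : 0 < t <= 1 by rewrite t0 ge_min lexx.
move/le_trans; apply; rewrite lerD2l.
apply: (@le_trans _ _ (c * (a / (c + 1)))).
  by apply: ler_wpM2l => //; rewrite ge_min lexx orbT.
by rewrite mulrCA -[leRHS]mulr1 ler_pM2l// ler_pdivrMr// mul1r lerDl.
Qed.

End energy.

Section field_energy.
Variables (phi : 'rV[R]_d.+1 -> 'rV[R]_d.+1) (N del eps : R) (E : set 'rV[R]_d.+1).
Hypotheses (phiC : C1c_field phi) (phi1 : forall x, eucl_norm (phi x) <= 1).
Hypotheses (phi_out : forall x, ~ cube N x -> phi x = 0).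
Hypotheses (edel : e <= del) (del0 : 0 < del).
Hypothesis phi_incr : forall i x y s, 0 < s <= del -> `|x - y| <= del ->
    `|phi (x + s *: e_ i) ord0 i - phi x ord0 i - s * partial phi i y| <= s * eps.
Hypotheses (bE : borel E) (Eoo : (leb E < +oo)%E).
Local Notation K := (cube N : set L).

Let mK : measurable K. Proof. apply: borel_measurable; exact: borel_cube. Qed.
Let Koo : (leb K < +oo)%E. Proof. exact: le_lt_trans (leb_box_le _ _) (ltry _). Qed.
Let mE : measurable (E : set L). Proof. exact: borel_measurable. Qed.

Let u (p : L * L) := \sum_i phi p.1 ord0 i * Drho (p.2 - p.1) ord0 i.

Let mu : measurable_fun setT u.
Proof.
apply: measurable_sum => i; apply: measurable_funM.
  exact: (measurable_comp_continuous (continuous_component phiC (i := i)) (@mfst R d.+1)).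
apply: (measurable_comp_continuous (taylor_continuousD (i := i) rhoT)) => j.
under eq_fun do rewrite !mxE.
by apply: measurable_funB; [exact: msnd|exact: mfst].
Qed.

Let uM p : `|u p| <= \sum_(i < d.+1) (2 * M + C).
Proof.
apply: (le_trans (ler_norm_sum _ _ _)); apply: ler_sum => i _; rewrite normrM -[leRHS]mul1r.
apply: ler_pM => //; first exact: le_trans (component_le _ _) (phi1 _).
exact: (taylor_bound_grad _ _ rhoT rhoM).
Qed.

(** Fubini for [phi x . Drho (y - x)]. Integrated in [x] it approximates the divergence of [phi] at
    [y], with error [eps] per coordinate; integrated in [y] over [E] it is [- phi x] paired with the
    gradient of the mollified indicator, at most the norm of the latter. *)
Lemma field_energy : Rintegral leb E (divergence phi) <=
  Rintegral leb K (fun x => eucl_norm (dmollify Drho E x)) + d.+1%:R * eps * fine (leb E).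
Proof.
have bi1 := bmf_inner1 (m2 := leb) mK mE Eoo mu uM.
have bi2 := bmf_inner2 (m1 := leb) mK mE Koo mu uM.
have fub := fubini_bounded (m1 := leb) (m2 := leb) mK mE Koo Eoo mu uM.
have up : Rintegral leb K (fun x => Rintegral leb E (fun y => u (x, y))) <=
    Rintegral leb K (fun x => eucl_norm (dmollify Drho E x)).
  apply: (RI_le mK Koo); [exact: bi1|exact: bmf_grad_norm|move=> x _].
  apply: (@le_trans _ _ (dot (- phi x) (dmollify Drho E x))); last first.
    apply: (le_trans (cauchy_schwarz _ _)); rewrite eucl_normN -[leRHS]mul1r.
    by apply: ler_wpM2r; [exact: eucl_norm_ge0|exact: phi1].
  have b i : bmf (E : set L) (fun y => - Drho (y - x) ord0 i) by exact: (bmf_Drho rhoP).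
  rewrite /dot; under [leRHS]eq_bigr do rewrite !mxE -(RI_Z mE Eoo _ (b _)).
  have bz i : bmf (E : set L) (fun y => - phi x ord0 i * - Drho (y - x) ord0 i) by exact: bmfZ (b i).
  rewrite -(RI_sum mE Eoo bz) le_eqVlt; apply/orP; left; apply/eqP.
  by congr Rintegral; apply/funext => y; apply: eq_bigr => i _; rewrite mulrNN.
have low : Rintegral leb E (divergence phi) - d.+1%:R * eps * fine (leb E) <=
    Rintegral leb E (fun y => Rintegral leb K (fun x => u (x, y))).
  rewrite -(RI_cst leb mE) -(RI_B mE Eoo (bmf_divergence _ phiC) (bmf_cst _ _)).
  apply: (RI_le mE Eoo); [|exact: bi2|move=> y _].
    by apply: bmfB; [exact: bmf_divergence|exact: bmf_cst].
  rewrite /u /=.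
  have bk i : bmf K (fun x => phi x ord0 i * Drho (y - x) ord0 i).
    by apply: bmfM; [exact: bmf_component0|exact: bmf_DrhoB].
  rewrite (RI_sum mK Koo bk) /divergence mulr_natl -[X in _ *+ X](card_ord d.+1) -sumr_const -sumrB.
  apply: ler_sum => i _; have := mollified_partial phiC phi1 phi_out edel del0 phi_incr i y.
  by rewrite ler_distl => /andP[].
by rewrite -lerBlDr; apply: (le_trans low); rewrite -fub.
Qed.

End field_energy.
End perimeter_lower.

Section perimeter_le.
Context {R : realType} (d : nat).
Hypothesis d0 : (0 < d)%N.
Local Notation L := (@LRd R d.+1).
Local Notation leb := (@leb R d.+1).

Lemma perimeter_lower (E : set 'rV[R]_d.+1) (S : R) : borel E -> (leb E < +oo)%E ->
  (forall t : R, 0 < t <= 1 -> (A E t <= (S * t ^+ d.+2)%:E)%E) ->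
  (Per (E : set L) <= (S / (@omega R d / d.+2%:R))%:E)%E.
Proof.
move=> bE Eoo AS; apply: ge_ereal_sup => _ [phi [phiC phi1] <-].
have mE : measurable (E : set L) by exact: borel_measurable.
rewrite (RI_E mE Eoo (bmf_divergence _ phiC)) lee_fin.
set k := omega d / _; have k0 : 0 < k by rewrite divr_gt0// omega_gt0.
apply/ler_addgt0Pr => a a0.
(* The error of [field_energy] is [c] times the tolerance [a / (c + 1)], hence at most [a]. The
   mollification radius is the increment radius [del] itself. *)
pose c : R := d.+1%:R * fine (leb E).
have c0 : 0 <= c by rewrite mulr_ge0// fine_ge0// measure_ge0.
have c1 : 0 < c + 1 by rewrite ltr_wpDl.
have eps0 : 0 < a / (c + 1) by rewrite divr_gt0.
have [del /andP[del0 del1] incr] := field_increment phiC eps0.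
have [K [cK phiK _]] := field_support phiC.
have [B [_ BP]] := compact_bounded cK.
pose N := `|B| + 2.
have phi_out x : ~ cube N x -> phi x = 0.
  move=> xN; apply: phiK => Kx; apply: xN; apply: norm_cube.
  apply: (@le_lt_trans _ _ (`|B| + 1)); last by rewrite ltrD2l ltr1n.
  by apply: BP => //; rewrite (le_lt_trans (ler_norm _))// ltrDl.
have del01 : 0 < del <= 1 by rewrite del0.
have [rho [Drho [C [M rhoP]]]] := @mollifier_exists R d.+1 del del01.
have H1 := field_energy del01 rhoP phiC phi1 phi_out (lexx _) del0 incr bE Eoo.
have H2 := gradient_energy d0 rhoP bE Eoo N AS.
apply: (le_trans H1); apply: lerD; first by rewrite ler_pdivlMr// mulrC.
rewrite mulrAC -/c mulrCA -[leRHS]mulr1 ler_pM2l// ler_pdivrMr// mul1r.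
by rewrite lerDl.
Qed.

End perimeter_le.

(** * Compactness *)

Section grid.
Context {R : realType} (d : nat).
Local Notation L := (@LRd R d).
Local Notation leb := (@leb R d).
Implicit Types (F G X : set 'rV[R]_d) (x y : 'rV[R]_d).
Variables (N : R) (m : nat).
Hypotheses (N0 : 0 < N) (m0 : (0 < m)%N).
Local Notation cell_index := {ffun 'I_d -> 'I_m}.
Let tau : R := 2 * N / m%:R.
Let mR : 0 < m%:R :> R. Proof. by rewrite ltr0n. Qed.

Lemma tau_gt0 : 0 < tau. Proof. by rewrite divr_gt0// mulr_gt0. Qed.

Definition cell (f : cell_index) : set 'rV[R]_d :=
  box (\row_i (- N + tau * (f i)%:R)) (\row_i (- N + tau * (f i).+1%:R)).

Lemma borel_cell f : borel (cell f). Proof. exact: borel_box. Qed.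

Lemma leb_cell f : leb (cell f) = (tau ^+ d)%:E.
Proof.
rewrite /cell leb_box /vol; congr EFin; rewrite -[in RHS](card_ord d) -prodr_const.
apply: eq_bigr => i _; rewrite !mxE -natr1 max_l; first by ring.
by rewrite (_ : _ - _ = tau) ?ltW ?tau_gt0//; ring.
Qed.

Lemma cell_inj f g x : cell f x -> cell g x -> f = g.
Proof.
move=> fx gx; apply/ffunP => i; apply/val_inj/eqP; rewrite eqn_leq.
have := fx i; have := gx i; rewrite !mxE => /andP[g1 g2] /andP[f1 f2].
have aux (a b : nat) (z : R) : - N + tau * b%:R < z -> z <= - N + tau * a.+1%:R -> (b <= a)%N.
  move=> h1 h2; rewrite leqNgt; apply/negP; rewrite -(ler_nat R) => /(ler_wpM2l (ltW tau_gt0)).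
  by move: (tau * b%:R) (tau * a.+1%:R) h1 h2 => ? ? ? ? ?; lra.
by rewrite (aux _ _ _ f1 g2) (aux _ _ _ g1 f2).
Qed.

Lemma cell_cover x : cube N x -> exists f, cell f x.
Proof.
move=> xN; have t0 := tau_gt0.
have [f fP] : exists f : 'I_d -> 'I_m, forall i,
    - N + tau * (f i)%:R < x ord0 i <= - N + tau * (f i).+1%:R.
  apply: (@fin_all_exists _ (fun=> 'I_m) (fun i (k : 'I_m) =>
    - N + tau * k%:R < x ord0 i <= - N + tau * k.+1%:R)) => i.
  have := xN i; rewrite !mxE => /andP[x1 x2].
  have ex : exists k, x ord0 i <= - N + tau * k.+1%:R.
    by exists m.-1; rewrite prednK// /tau divfK ?gt_eqF//; lra.
  case: (ex_minnP ex) => k kP kmin.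
  have km : (k < m)%N.
    have := kmin m.-1; rewrite prednK// /tau divfK ?gt_eqF// => H.
    by apply: leq_ltn_trans (H _) _; [lra|rewrite ltn_predL].
  exists (Ordinal km) => /=; rewrite kP andbT ltNge; apply/negP => xk.
  case: k kP kmin km xk => [|k] kP kmin km xk; first by rewrite mulr0 addr0 in xk; lra.
  by have := kmin k xk; rewrite ltnn.
by exists [ffun i => f i] => i; have := fP i; rewrite !mxE ffunE.
Qed.

Lemma cell_diam f x y (r : R) : cell f x -> cell f y -> r = d.+1%:R * tau -> eucl_dist x y < r.
Proof.
move=> fx fy ->; have t0 := tau_gt0.
have r0 : 0 < d.+1%:R * tau by rewrite mulr_gt0.
rewrite /eucl_dist eucl_norm_ltE//; apply: (@le_lt_trans _ _ (d%:R * tau ^+ 2)).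
  rewrite mulr_natl -[X in _ *+ X](card_ord d) -sumr_const; apply: ler_sum => i _.
  have := fx i; have := fy i; rewrite !mxE -!natr1 !mulrDr mulr1 => /andP[? ?] /andP[? ?].
  rewrite -(real_normK (num_real (_ - _))) ler_pXn2r ?nnegrE ?(ltW t0)// ler_norml.
  by apply/andP; split; lra.
rewrite [ltRHS]exprMn ltr_pM2r ?exprn_gt0// -natrX ltr_nat.
by rewrite (leq_trans (ltnSn d))// leq_pmulr.
Qed.

(** A point of [F] and a point outside [F] in a common cell are at distance less than [d.+1 tau],
    and cells are disjoint, so the products count distinct pairs contributing to [A]. *)
Lemma cell_energy F : borel F ->
  (\sum_f leb (F `&` cell f) * leb (cell f `\` F) <= A F (d.+1%:R * tau))%E.
Proof.
move=> bF; have t0 := tau_gt0.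
have mFc f : measurable (F `&` cell f : set L).
  by apply: borel_measurable; apply: borelI => //; exact: borel_cell.
have mFcD f : measurable (cell f `\` F : set L).
  by apply: borel_measurable; apply: borelD => //; exact: borel_cell.
set r := d.+1%:R * tau.
have mball : measurable_fun setT (\1_(ball2 r) : @BRd R d -> R).
  by apply: measurable_indic; exact: borel_ball2.
rewrite /A -(double_integral_shift bF mball); last by [].
pose k (p : L * L) : R := \1_F p.1 * \1_(~` F) p.2 * \1_(ball2 r) (p.2 - p.1).
have mk : measurable_fun setT (EFin \o k).
  apply/measurable_EFinP; apply: measurable_funM; [apply: measurable_funM|].
  - exact: (measurable_indic_borel bF (@mfst R d)).
  - exact: (measurable_indic_borel (borelC bF) (@msnd R d)).
  - apply: (measurable_indic_borel (@borel_ball2 R d r)) => i; under eq_fun do rewrite !mxE.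
    by apply: measurable_funB; [exact: msnd|exact: mfst].
have k0 p : (0 <= (EFin \o k) p)%E by rewrite lee_fin !mulr_ge0.
have -> : (\int[leb]_(x in (F : set L)) \int[leb]_(y in (~` F : set L)) (\1_(ball2 r) (y - x))%:E =
    \int[leb]_x \int[leb]_y (EFin \o k) (x, y))%E.
  rewrite integral_mkcond; apply: eq_integral => x _; rewrite patchE.
  case: (boolP (x \in (F : set L))) => xF; last first.
    by rewrite integral0_eq// => y _; rewrite /k /= indicE (negbTE xF) !mul0r.
  rewrite integral_mkcond; apply: eq_integral => y _; rewrite patchE /k /= [\1_F x]indicE xF mul1r [\1_(~` F) y]indicE.
  by case: ifPn => _; rewrite ?mul1r ?mul0r.
pose h f (x : L) := ((\1_(F `&` cell f) x : R)%:E * leb (cell f `\` F))%E.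
have mh f : measurable_fun setT (h f).
  apply: emeasurable_funM; last exact: measurable_cst.
  by apply/measurable_EFinP; exact: measurable_indic.
have h0 f x : (0 <= h f x)%E by rewrite mule_ge0 ?lee_fin.
have -> : (\sum_f leb (F `&` cell f) * leb (cell f `\` F) = \int[leb]_x (\sum_f h f x))%E.
  rewrite (@ge0_integral_sum _ _ _ leb _ measurableT _ h mh (fun f x _ => h0 f x)).
  apply: eq_bigr => f _; have mi : measurable_fun setT (fun x : L => (\1_(F `&` cell f) x : R)%:E).
    by apply/measurable_EFinP; exact: measurable_indic.
  rewrite (ge0_integralZr leb measurableT mi); [|by move=> x _; rewrite lee_fin|exact: measure_ge0].
  by rewrite (integral_indic leb measurableT (mFc f)) setIT.
apply: ge0_le_integral; first exact: measurableT.
- by move=> x _; apply: sume_ge0 => f _; exact: h0.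
- by apply: emeasurable_sum => f; exact: mh.
- exact: (@measurable_fun_fubini_tonelli_F _ _ _ _ _ leb _ mk k0).
- move=> x _; have rhs0 : (0 <= \int[leb]_y (EFin \o k) (x, y))%E by apply: integral_ge0 => y _; exact: k0.
  have [[f [xf xF]]|nf] := pselect (exists f, cell f x /\ F x); last first.
    rewrite big1// => f _; rewrite /h indicE memNset ?mul0e// => -[xF xf].
    by apply: nf; exists f.
  rewrite (bigD1 f)//= big1 ?adde0; last first.
    move=> g gf; rewrite /h indicE memNset ?mul0e// => -[_ xg].
    by move/eqP: gf; apply; exact: cell_inj xg xf.
  rewrite /h indicE mem_set// mul1e -[cell f `\` F]setIT -(integral_indic leb measurableT (mFcD f)).
  apply: ge0_le_integral; first exact: measurableT.
  + by move=> y _; rewrite lee_fin.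
  + by apply/measurable_EFinP; apply: measurable_indic; exact: mFcD.
  + exact: (measurableT_comp mk (pair1_measurable x)).
  + move=> y _; rewrite lee_fin /k /= [\1_F x]indicE (mem_set xF) mul1r !indicE.
    have [yfF|nY] := pselect ((cell f `\` F) y); last by rewrite (memNset nY) mulr_ge0.
    have [yf yF] := yfF; rewrite (mem_set yfF) (mem_set (yF : (~` F) y)) mul1r mem_set// /ball2/=.
    rewrite -eucl_norm_ltE; last by rewrite mulr_gt0.
    exact: (cell_diam yf xf).
Qed.

(** A signature of [F] with values in a finite type, to which the pigeonhole principle applies. *)
Definition majority F : {ffun cell_index -> bool} :=
  [ffun f => ((tau ^+ d / 2)%:E <= leb (F `&` cell f))%E].

(* for a + b = q one has min(a, b) <= (2 / q) a b *)
Lemma majority_cell F G f : borel F -> borel G -> majority F f = majority G f ->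
  (leb ((F `\` G `|` G `\` F) `&` cell f) <=
   (2 / tau ^+ d)%:E * (leb (F `&` cell f) * leb (cell f `\` F) +
                        leb (G `&` cell f) * leb (cell f `\` G)))%E.
Proof.
move=> bF bG; rewrite !ffunE => FG; have q0 : 0 < tau ^+ d by rewrite exprn_gt0// tau_gt0.
have half (X : set 'rV[R]_d) : borel X ->
    exists a b : R, [/\ leb (X `&` cell f) = a%:E, leb (cell f `\` X) = b%:E,
      0 <= a, 0 <= b & a + b = tau ^+ d].
  move=> bX.
  have sum : (leb (cell f) = leb (cell f `\` X) + leb (X `&` cell f))%E.
    by rewrite (setIC X); exact: (measureDI leb (borel_measurable (borel_cell f)) (borel_measurable bX)).
  have fin1 : leb (X `&` cell f) \is a fin_num.
    rewrite ge0_fin_numE ?measure_ge0//; apply: (@le_lt_trans _ _ (leb (cell f))).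
      by apply: le_outer_measure; exact: subIsetr.
    by rewrite leb_cell ltry.
  have fin2 : leb (cell f `\` X) \is a fin_num.
    rewrite ge0_fin_numE ?measure_ge0//; apply: (@le_lt_trans _ _ (leb (cell f))).
      by apply: le_outer_measure; exact: subDsetl.
    by rewrite leb_cell ltry.
  exists (fine (leb (X `&` cell f))), (fine (leb (cell f `\` X))); split.
  - by rewrite fineK.
  - by rewrite fineK.
  - by rewrite fine_ge0// measure_ge0.
  - by rewrite fine_ge0// measure_ge0.
  - by move: sum; rewrite leb_cell -(fineK fin1) -(fineK fin2) -EFinD => -[->]; rewrite addrC.
have [a [b [aE bE a0 b0 ab]]] := half F bF.
have [a' [b' [aE' bE' a0' b0' ab']]] := half G bG.
move: FG; rewrite aE bE aE' bE' !lee_fin => FG.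
rewrite -!EFinM.
move: ab ab' q0 FG; move: (tau ^+ d) => q ab ab' q0 FG.
have small (u v : R) : 0 <= u -> 0 <= v -> u + v = q -> u <= q / 2 -> u <= 2 / q * (u * v).
  move=> u0 v0 uv uq; have -> : 2 / q * (u * v) = u * (2 * v / q) by ring.
  by rewrite -[leLHS]mulr1; apply: ler_wpM2l => //; rewrite ler_pdivlMr// mul1r; lra.
(* If both sets fill at least half of the cell, their symmetric difference lies in the union of the
   two complements; otherwise it lies in the union of the sets. In each case the smaller part is
   bounded by the product. *)
have [aq|aq] := leP (q / 2) a.
  move: FG; rewrite aq => /esym aq'.
  apply: (@le_trans _ _ (leb ((cell f `\` F) `|` (cell f `\` G)))).
    by apply: le_outer_measure => x [[[Fx Gx]|[Gx Fx]] xf]; [right|left].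
  apply: (le_trans (outer_measureU2 _ _ _)); rewrite [X in (X + _)%E]bE [X in (_ + X)%E]bE'.
  rewrite -EFinD lee_fin mulrDr; apply: lerD.
    by rewrite (mulrC a); apply: small => //; [rewrite addrC|lra].
  by rewrite (mulrC a'); apply: small => //; [rewrite addrC|lra].
move: FG; rewrite leNgt aq /= => /esym/negbT; rewrite -ltNge => aq'.
apply: (@le_trans _ _ (leb ((F `&` cell f) `|` (G `&` cell f)))).
  by apply: le_outer_measure => x [[[Fx Gx]|[Gx Fx]] xf]; [left|right].
apply: (le_trans (outer_measureU2 _ _ _)); rewrite [X in (X + _)%E]aE [X in (_ + X)%E]aE'.
by rewrite -EFinD lee_fin mulrDr; apply: lerD; apply: small => //; exact: ltW.
Qed.

Lemma majority_close F G : borel F -> borel G -> F `<=` cube N -> G `<=` cube N ->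
  majority F = majority G ->
  (leb (F `\` G `|` G `\` F) <= (2 / tau ^+ d)%:E *
     (A F (d.+1%:R * tau) + A G (d.+1%:R * tau)))%E.
Proof.
move=> bF bG FN GN FG; set X := _ `|` _; have q0 : 0 < tau ^+ d by rewrite exprn_gt0// tau_gt0.
apply: (@le_trans _ _ (\sum_f leb (X `&` cell f))%E).
  apply: (@le_trans _ _ (leb (\big[setU/set0]_f (X `&` cell f)))).
    apply: le_outer_measure => x Xx.
    have [f xf] : exists f, cell f x by apply: cell_cover; case: Xx => -[? _]; [exact: FN|exact: GN].
    by rewrite (bigD1 f)//=; left.
  elim/big_rec2 : _ => [|f y Y _ IH]; first by rewrite measure0.
  by apply: (le_trans (outer_measureU2 _ _ _)); exact: leeD2l.
apply: (@le_trans _ _ (\sum_f ((2 / tau ^+ d)%:E * (leb (F `&` cell f) * leb (cell f `\` F) +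
                        leb (G `&` cell f) * leb (cell f `\` G))))%E).
  by apply: lee_sum => f _; apply: majority_cell => //; rewrite FG.
have p0 f (Y : set 'rV[R]_d) : (0 <= leb (Y `&` cell f) * leb (cell f `\` Y))%E.
  by rewrite mule_ge0 ?measure_ge0.
rewrite -ge0_sume_distrr; last by move=> f _; rewrite adde_ge0.
apply: lee_wpmul2l; first by rewrite lee_fin divr_ge0// ltW.
by rewrite big_split/=; apply: leeD; exact: cell_energy.
Qed.

End grid.

(* diagonal argument: an infinite index set is refined at each stage by the pigeonhole principle *)
Lemma diagonal_subsequence (close : nat -> nat -> nat -> Prop) :
  (forall k, exists (T : finType) (c : nat -> T) n0,
    forall m n, (n0 <= m)%N -> (n0 <= n)%N -> c m = c n -> close k m n) ->
  exists phi : nat -> nat, {homo phi : m n / (m < n)%N} /\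
    forall k i j, (k <= i)%N -> (k <= j)%N -> close k (phi i) (phi j).
Proof.
move=> cl; pose inf (P : nat -> Prop) := forall n, exists m, (n <= m)%N /\ P m.
have step (kP : nat * {P | inf P}) : exists Q : {P | inf P},
    (forall m, sval Q m -> sval kP.2 m) /\
    (forall m n, sval Q m -> sval Q n -> close kP.1 m n).
  case: kP => k [P iP] /=; have [T [c [n0 cP]]] := cl k.
  have [t tP] : exists t, inf (fun m => [/\ P m, (n0 <= m)%N & c m = t]).
    apply/not_existsP => nt.
    have [b bP] : exists b : T -> nat, forall t m, (b t <= m)%N -> ~ [/\ P m, (n0 <= m)%N & c m = t].
      apply: (@fin_all_exists _ (fun=> nat) (fun t b => forall m, (b <= m)%N -> ~ [/\ P m, (n0 <= m)%N & c m = t])) => t.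
      have /existsNP[b bP] := nt t; exists b => m bm Hm; apply: bP; by exists m.
    have [m [mb Pm]] := iP (maxn n0 (\max_t b t)).
    move: mb; rewrite geq_max => /andP[n0m bm].
    by apply: (bP (c m) m) => //; apply: leq_trans bm; exact: leq_bigmax.
  exists (exist _ _ tP) => /=; split; first by move=> m [].
  by move=> m n [_ mn0 mt] [_ nn0 nt]; apply: cP => //; rewrite mt nt.
have [g gP] := choice step.
have infT : inf (fun=> True) by move=> n; exists n.
pose S := fix S k : {P | inf P} := if k is j.+1 then g (j, S j) else exist _ _ infT.
have Smono k i m : (k <= i)%N -> sval (S i) m -> sval (S k) m.
  elim: i => [|i IH]; first by rewrite leqn0 => /eqP ->.
  rewrite leq_eqVlt => /orP[/eqP -> //|ki] Sm; apply: IH => //.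
  exact: (gP (i, S i)).1 Sm.
have pick (kn : nat * nat) : exists m, (kn.2 <= m)%N /\ sval (S kn.1) m.
  by have := svalP (S kn.1) kn.2.
have [h hP] := choice pick.
(* [phi i] is drawn from [S i.+1], since closeness at level [k] holds on the refinement [S k.+1] of
   [S k]. *)
pose phi := fix phi i := if i is j.+1 then h (j.+2, (phi j).+1) else h (1%N, 0%N).
have phiS i : sval (S i.+1) (phi i) by case: i => [|i]; exact: (hP (_, _)).2.
exists phi; split.
  have phi1 i : (phi i < phi i.+1)%N by exact: (hP (i.+2, (phi i).+1)).1.
  by apply: homo_ltn => //; exact: ltn_trans.
move=> k i j ki kj; apply: (gP (k, S k)).2.
  exact: (@Smono k.+1 i.+1 (phi i) ki (phiS i)).
exact: (@Smono k.+1 j.+1 (phi j) kj (phiS j)).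
Qed.

(** * Extraction of a convergent subsequence *)

Section compactness.
Context {R : realType} (d : nat).
Local Notation L := (@LRd R d).
Local Notation leb := (@leb R d).
Implicit Types (F : set 'rV[R]_d).

Lemma cell_scaling (n : nat) (K D u : R) : 0 < u ->
  2 / u ^+ n * (K * (D * u) ^+ n.+1 + K * (D * u) ^+ n.+1) = 4 * K * D ^+ n.+1 * u.
Proof.
by move=> u0; rewrite exprMn (exprS u); field; rewrite gt_eqF// exprn_gt0.
Qed.

(** [E] is the upper limit of the sequence. A point outside all later differences [X j] keeps the
    same membership from [n] on, so the error is covered by the [X j], whose measures sum to at most
    2^(-n). *)
Lemma limsup_set_close (F : nat -> set 'rV[R]_d) : (forall n, borel (F n)) ->
  (forall n, (leb (F n `\` F n.+1 `|` F n.+1 `\` F n) <= ((2 ^ n.+1)%:R^-1)%:E)%E) ->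
  let E := \bigcap_n \bigcup_k F (n + k)%N in
  borel E /\ forall n, (leb (E `\` F n `|` F n `\` E) <= ((2 ^ n)%:R^-1)%:E)%E.
Proof.
move=> bF cF E.
have bE : borel E.
  by apply: bigcap_measurable => [|n _]; [exists 0%N|apply: borel_bigcup].
split => // n.
pose X j := F (n + j)%N `\` F (n + j).+1 `|` F (n + j).+1 `\` F (n + j)%N.
have bX j : borel (X j) by apply: borelU; apply: borelD.
apply: (@le_trans _ _ (leb (\bigcup_j X j))).
  apply: le_outer_measure => x; apply: contraPP => nX.
  have same j : F (n + j)%N x <-> F n x.
    elim: j => [|j IH]; first by rewrite addn0.
    rewrite addnS -IH; split => Fx; apply: contrapT => nFx; apply: nX; exists j => //.
      by right.
    by left.
  have EF : E x <-> F n x.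
    split => [Ex|Fx].
      by have [j _ /same] := Ex n I.
    by move=> p _; exists n => //; rewrite addnC; exact/same.
  by rewrite /setU/= /setD/= => -[[/EF]|[/EF]].
apply: (@le_trans _ _ (\sum_(j <oo) leb (X j))%E).
  exact: outer_measure_sigma_subadditive.
apply: le_trans (epsilon_trick0 xpredT (_ : 0 <= (2 ^ n)%:R^-1)); last by rewrite invr_ge0.
apply: lee_nneseries => // j _.
apply: (le_trans (cF (n + j)%N)); rewrite lee_fin -addnS expnD natrM invfM.
exact: lexx.
Qed.

Lemma energy_compactness (N K : R) (En : nat -> set 'rV[R]_d) : 0 < N -> 0 <= K ->
  (forall n, borel (En n)) -> (forall n, En n `<=` cube N) ->
  (forall t : R, 0 < t <= 1 -> \forall n \near \oo, (A (En n) t <= (K * t ^+ d.+1)%:E)%E) ->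
  exists phi : nat -> nat, {homo phi : m n / (m < n)%N} /\
    exists E : set 'rV[R]_d, borel E /\
      forall n, (leb (E `\` En (phi n) `|` En (phi n) `\` E) <= ((2 ^ n)%:R^-1)%:E)%E.
Proof.
move=> N0 K0 bE EN AE.
have [|phi [phi_incr phi_close]] := @diagonal_subsequence (fun k m n =>
    (leb (En m `\` En n `|` En n `\` En m) <= ((2 ^ k.+1)%:R^-1)%:E)%E).
  move=> k; set eta : R := (2 ^ k.+1)%:R^-1.
  have eta0 : 0 < eta by rewrite invr_gt0 ltr0n expn_gt0.
  pose D : R := d.+1%:R; pose c := 4 * K * D ^+ d.+1.
  have D1 : 1 <= D by rewrite ler1n.
  have D0 : 0 < D by apply: lt_le_trans D1.
  have c0 : 0 <= c by rewrite mulr_ge0 ?mulr_ge0// exprn_ge0// ltW.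
  (* The two terms serve two purposes: [B tau <= 1] gives both [D tau <= 1], where the bound on [A]
     is available, and [c tau <= eta], the accuracy of the grid. *)
  pose B := D + c / eta.
  have B0 : 0 < B by rewrite ltr_wpDr// divr_ge0// ltW.
  pose m := (Num.truncn (2 * N * B)).+1.
  have m0 : (0 < m)%N by [].
  set tau := 2 * N / m%:R.
  have tau0 : 0 < tau by exact: tau_gt0.
  have tauB : B * tau <= 1.
    rewrite /tau mulrA ler_pdivrMr ?ltr0n// mul1r mulrC; apply: ltW.
    exact: truncnS_gt.
  have r01 : 0 < D * tau <= 1.
    rewrite mulr_gt0//=; apply: le_trans tauB; rewrite ler_pM2r// lerDl divr_ge0//.
    exact: ltW.
  have [n0 _ n0P] := AE _ r01.
  exists {ffun {ffun 'I_d -> 'I_m} -> bool}, (fun n => @majority R d N m (En n)), n0.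
  move=> i j ni nj ij.
  apply: (le_trans (majority_close N0 m0 (bE i) (bE j) (EN i) (EN j) ij)).
  have q0 : 0 < tau ^+ d by rewrite exprn_gt0.
  apply: (@le_trans _ _ ((2 / tau ^+ d)%:E * ((K * (D * tau) ^+ d.+1)%:E + (K * (D * tau) ^+ d.+1)%:E))%E).
    apply: lee_wpmul2l; first by rewrite lee_fin divr_ge0// ltW.
    by apply: leeD; exact: n0P.
  rewrite -EFinD -EFinM lee_fin.
  have -> : 2 / tau ^+ d * (K * (D * tau) ^+ d.+1 + K * (D * tau) ^+ d.+1) = c * tau.
    exact: cell_scaling.
  apply: (@le_trans _ _ (eta * (B * tau))); last by rewrite -[leRHS]mulr1 ler_pM2l.
  rewrite mulrA; apply: ler_wpM2r; first exact: ltW.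
  by rewrite /B mulrDr mulrCA mulfV ?gt_eqF// mulr1 lerDr mulr_ge0// ltW.
exists phi; split => //.
have [|bL Lc] := @limsup_set_close (En \o phi) (fun n => bE (phi n)).
  by move=> n; exact: phi_close.
by exists (\bigcap_n \bigcup_k (En \o phi) (n + k)%N).
Qed.

End compactness.

(** * Borel representatives and conclusion *)

Section null_sets.
Context {R : realType} (d : nat).
Local Notation L := (@LRd R d).
Local Notation leb := (@leb R d).
Implicit Types (E B : set L).
Local Open Scope ereal_scope.

Definition null_extension E B := [/\ borel B, E `<=` B & leb (B `\` E) = 0].

(** The Borel set [U] confines the representative, so that sets inside a cube keep representatives
    inside it. *)
Lemma null_extension_exists E (U : set 'rV[R]_d) : measurable E -> leb E < +oo -> borel U -> E `<=` U ->
  exists B, null_extension E B /\ B `<=` U.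
Proof.
move=> mE Eoo bU EU; have [B [bB EB Beq]] := borel_hull Eoo.
exists (B `&` U); split; last by move=> x [].
split; [exact: borelI|by move=> x Ex; split; [exact: EB|exact: EU]|].
apply/eqP; rewrite eq_le measure_ge0 andbT.
apply: (@le_trans _ _ (leb (B `\` E))); first by apply: le_outer_measure => x [[Bx _] nEx].
have mB : measurable (B : set L) by exact: borel_measurable.
have Boo : leb B < +oo by rewrite Beq.
have -> : leb (B `\` E) = leb B - leb (B `&` E) by exact: measureD.
by rewrite setIidr// Beq subee// ge0_fin_numE ?measure_ge0.
Qed.

Lemma null_extension_leb E B : null_extension E B -> leb B = leb E.
Proof.
move=> [bB EB B0]; apply/eqP; rewrite eq_le; apply/andP; split; last exact: le_outer_measure.
rewrite -(setDUK EB); apply: (le_trans (outer_measureU2 _ _ _)).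
by rewrite [X in _ + X]B0 adde0.
Qed.

Lemma null_extension_integral E B (f : L -> \bar R) : measurable E -> null_extension E B ->
  measurable_fun setT f -> (forall x, 0 <= f x) ->
  \int[leb]_(x in B) f x = \int[leb]_(x in E) f x.
Proof.
move=> mE [bB EB B0] mf f0.
have mB : measurable (B : set L) by exact: borel_measurable.
have mBE : measurable (B `\` E) by exact: measurableD.
rewrite (@ge0_negligible_integral _ _ _ leb B (B `\` E) f mBE mB (measurable_funTS mf) (fun x _ => f0 x) B0).
by congr integral; rewrite setDD setIidr.
Qed.

Lemma null_extension_integralC E B (f : L -> \bar R) : measurable E -> null_extension E B ->
  measurable_fun setT f -> (forall x, 0 <= f x) ->
  \int[leb]_(x in ~` E) f x = \int[leb]_(x in ~` B) f x.
Proof.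
move=> mE [bB EB B0] mf f0.
have mB : measurable (B : set L) by exact: borel_measurable.
have mBE : measurable (B `\` E) by exact: measurableD.
rewrite (@ge0_negligible_integral _ _ _ leb (~` E) (B `\` E) f mBE (measurableC mE) (measurable_funTS mf) (fun x _ => f0 x) B0).
congr integral; apply/seteqP; split => x.
  by move=> [nE nBE] Bx; apply: nBE.
by move=> nB; split => [Ex|[]//]; apply: nB; exact: EB.
Qed.

(** The outer domain is changed while the inner one is still the complement of the Borel set, for
    which the inner integral is measurable by Tonelli; the inner domain is then changed for each
    [x]. *)
Lemma null_extension_Jt E B (r s : R) : measurable E -> null_extension E B -> Jt r s B = Jt r s E.
Proof.
move=> mE EB; have [bB _ _] := EB.
have mk : measurable_fun setT (fun p : L * L => (kern d r s (eucl_dist p.1 p.2))%:E).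
  apply/measurable_EFinP; apply: (measurableT_comp (measurable_kern d r s)).
  apply: measurable_eucl_norm => i; under eq_fun do rewrite !mxE.
  by apply: measurable_funB; [exact: mfst|exact: msnd].
have k0 (p : L * L) : 0 <= (kern d r s (eucl_dist p.1 p.2))%:E by rewrite lee_fin kern_ge0.
have mkC : measurable_fun setT (fun p : L * L => (kern d r s (eucl_dist p.1 p.2))%:E * (\1_(~` B) p.2 : R)%:E).
  apply: emeasurable_funM; first exact: mk.
  by apply/measurable_EFinP; exact: (measurable_indic_borel (borelC bB) (@msnd R d)).
have kC0 (p : L * L) : 0 <= (kern d r s (eucl_dist p.1 p.2))%:E * (\1_(~` B) p.2 : R)%:E.
  by rewrite mule_ge0// lee_fin.
rewrite /Jt.
have inner x : \int[leb]_(y in ~` B) (kern d r s (eucl_dist x y))%:E =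
    \int[leb]_y ((kern d r s (eucl_dist x y))%:E * (\1_(~` B) y : R)%:E).
  rewrite integral_mkcond; apply: eq_integral => y _; rewrite patchE indicE.
  by case: ifPn => _; rewrite ?mule1 ?mule0.
rewrite (null_extension_integral mE EB); last 2 first.
- under eq_fun do rewrite inner.
  exact: (@measurable_fun_fubini_tonelli_F _ _ _ _ _ leb _ mkC kC0).
- by move=> x; apply: integral_ge0 => y _; exact: (k0 (x, y)).
apply: eq_integral => x _; apply: esym.
exact: (null_extension_integralC mE EB (measurableT_comp mk (pair1_measurable x)) (fun y => k0 (x, y))).
Qed.

Lemma null_extension_Per E B : measurable E -> leb E < +oo -> null_extension E B -> Per B = Per E.
Proof.
move=> mE Eoo EB; have [bB sEB B0] := EB.
have mB : measurable (B : set L) by exact: borel_measurable.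
have mBE : measurable (B `\` E) by exact: measurableD.
have Boo : leb B < +oo by rewrite (null_extension_leb EB).
have ie phi : C1c_field phi -> \int[leb]_(x in B) (divergence phi x)%:E = \int[leb]_(x in E) (divergence phi x)%:E.
  move=> phiC; have phiI := bmf_integrable mB Boo (bmf_divergence B phiC).
  rewrite (negligible_integral mBE mB phiI B0).
  by congr integral; rewrite setDD setIidr.
rewrite /Per; congr ereal_sup; apply/seteqP; split => _ [phi [phiC phi1] <-]; exists phi => //.
  by rewrite ie.
by rewrite ie.
Qed.

Definition symdiff E B : \bar R := leb (E `\` B `|` B `\` E).

Lemma L1_convE (En : nat -> set L) E : measurable E -> (forall n, measurable (En n)) ->
  L1_conv En E <-> (fun n => symdiff E (En n)) @ \oo --> 0.
Proof.
move=> mE mEn; rewrite /L1_conv.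
suff -> : (fun n => \int[leb]_x `| (\1_(En n) x : R) - \1_E x |%:E) = (fun n => symdiff E (En n)) by [].
apply/funext => n; rewrite /symdiff.
have mS : measurable (E `\` En n `|` En n `\` E) by apply: measurableU; exact: measurableD.
rewrite -[X in leb X]setIT -(integral_indic leb measurableT mS).
apply: eq_integral => x _; congr EFin; rewrite !indicE.
have [Ex|Ex] := pselect (E x); have [Enx|Enx] := pselect (En n x).
- by rewrite (mem_set Ex) (mem_set Enx) subrr normr0 memNset// => -[[]|[]].
- by rewrite (mem_set Ex) (memNset Enx) sub0r normrN normr1 mem_set//; left.
- by rewrite (memNset Ex) (mem_set Enx) subr0 normr1 mem_set//; right.
- by rewrite (memNset Ex) (memNset Enx) subrr normr0 memNset// => -[[]|[]].
Qed.

Lemma symdiff_ge0 E B : 0 <= symdiff E B. Proof. exact: measure_ge0. Qed.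

Lemma symdiff_null E E' B B' : null_extension E B -> null_extension E' B' ->
  symdiff B B' <= symdiff E E' /\ symdiff E E' <= symdiff B B'.
Proof.
move=> [_ EB B0] [_ EB' B0']; split.
  apply: (@le_trans _ _ (leb (((E `\` E') `|` (E' `\` E)) `|` ((B `\` E) `|` (B' `\` E'))))).
    apply: le_outer_measure => x [[Bx nB]|[Bx nB]].
      have [Ex|Ex] := pselect (E x); last by right; left.
      by left; left; split => // /EB'.
    have [Ex|Ex] := pselect (E' x); last by right; right.
    by left; right; split => // /EB.
  apply: (le_trans (outer_measureU2 _ _ _)); apply: (@le_trans _ _ (symdiff E E' + (leb (B `\` E) + leb (B' `\` E')))).
    by apply: leeD2l; exact: outer_measureU2.
  by rewrite B0 B0' !adde0.
apply: (@le_trans _ _ (leb (((B `\` B') `|` (B' `\` B)) `|` ((B `\` E) `|` (B' `\` E'))))).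
  apply: le_outer_measure => x [[Ex nE]|[Ex nE]].
    have [Bx|Bx] := pselect (B' x); first by right; right.
    by left; left; split => //; exact: EB.
  have [Bx|Bx] := pselect (B x); first by right; left.
  by left; right; split => //; exact: EB'.
apply: (le_trans (outer_measureU2 _ _ _)); apply: (@le_trans _ _ (symdiff B B' + (leb (B `\` E) + leb (B' `\` E')))).
  by apply: leeD2l; exact: outer_measureU2.
by rewrite B0 B0' !adde0.
Qed.

Lemma symdiff_near (En : nat -> set L) E (k : R) : (fun n => symdiff E (En n)) @ \oo --> 0 ->
  (0 < k)%R -> \forall n \near \oo, leb (E `\` En n) + leb (En n `\` E) <= k%:E.
Proof.
move=> /fine_cvgP[fin /cvgrPdist_le cv] k0.
have k2 : (0 < k / 2)%R by rewrite divr_gt0.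
have := cv _ k2; move=> /(filterI fin); apply: filterS => n [fn].
rewrite sub0r normrN ger0_norm ?fine_ge0 ?symdiff_ge0// -lee_fin fineK// => H.
rewrite (splitr k) EFinD; apply: leeD; apply: le_trans H; apply: le_outer_measure => x ?; [by left|by right].
Qed.

End null_sets.

(** * Lower bound, recovery sequence and compactness for measurable sets *)

Section main.
Context {R : realType} (d : nat) (r s : nat -> R).
Hypothesis d0 : (0 < d)%N.
Hypothesis r01 : forall n, 0 < r n < 1.
Hypothesis s1 : forall n, 1 < s n.
Hypothesis r_cvg : r @ \oo --> (0 : R).
Hypothesis s_cvg : s @ \oo --> (1 : R).
Local Notation L := (@LRd R d.+1).
Local Notation leb := (@leb R d.+1).
Local Notation J F := (fun n => Jt (r n) (s n) (F n) * ((beta d.+1 (r n) (s n))^-1)%:E)%E.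

Lemma null_extensions (E : nat -> set L) : (forall n, measurable (E n) /\ (leb (E n) < +oo)%E) ->
  exists B : nat -> set L, forall n, null_extension (E n) (B n).
Proof.
move=> mE; have ext n : exists B : set L, null_extension (E n) B.
  have [mEn En] := mE n.
  have [B [EB _]] := @null_extension_exists _ _ (E n) setT mEn En measurableT (fun _ _ => I).
  by exists B.
by have [B BP] := choice ext; exists B.
Qed.

(** A finite lower limit [l] bounds [A B t] by [l / d.+2] times t^(d+2) for [t <= 1], and
    [perimeter_lower] converts this into a perimeter of at most [l / omega]. *)
Lemma liminf_inequality (E : set L) (En : nat -> set L) :
  measurable E -> (leb E < +oo)%E -> (forall n, measurable (En n) /\ (leb (En n) < +oo)%E) ->
  L1_conv En E -> (@omega_dm1 R d.+1 * Per E <= limn_einf (J En))%E.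
Proof.
move=> mE Eoo mEn cE.
have [B [EB _]] := @null_extension_exists _ _ E setT mE Eoo measurableT (fun _ _ => I).
have [Bn EBn] := null_extensions mEn.
have om0 := @omega_gt0 R d.
have -> : J En = J Bn.
  by apply/funext => n; rewrite (null_extension_Jt _ _ (mEn n).1 (EBn n)).
rewrite -(null_extension_Per mE Eoo EB) omega_dm1E.
have [bB _ _] := EB; have bBn n : borel (Bn n) by have [] := EBn n.
have Boo : (leb B < +oo)%E by rewrite (null_extension_leb EB).
have cB : (fun n => symdiff B (Bn n)) @ \oo --> 0%E.
  have /(L1_convE mE (fun n => (mEn n).1)) := cE.
  apply: squeeze_cvge (cvg_cst _); apply: nearW => n.
  by rewrite symdiff_ge0 (symdiff_null EB (EBn n)).1.
have key (l : R) : (limn_einf (J Bn) <= l%:E)%E -> (Per B <= (l / omega d)%:E)%E.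
  move=> Jl.
  have := @perimeter_lower R d d0 B (l / d.+2%:R) bB Boo (fun t t01 =>
    gamma_lower r01 s1 r_cvg s_cvg bB Boo bBn (fun k => symdiff_near cB) Jl t01).
  by congr (_ <= _%:E)%E; field; rewrite !gt_eqF.
case Jl : (limn_einf (J Bn)) => [l| |]; last 2 first.
- exact: leey.
(* A lower limit [-oo] would allow [l = -1] and a negative perimeter. *)
- have /key : (limn_einf (J Bn) <= (-1)%:E)%E by rewrite Jl leNye.
  by move/(le_trans (Per_ge0 B)); rewrite lee_fin mulN1r oppr_ge0 invr_le0 leNgt om0.
have : (limn_einf (J Bn) <= l%:E)%E by rewrite Jl.
move/key => H; apply: (@le_trans _ _ ((omega d)%:E * (l / omega d)%:E)%E).
  by apply: lee_wpmul2l => //; rewrite lee_fin ltW.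
by rewrite -EFinM lee_fin mulrCA mulfV ?gt_eqF// mulr1.
Qed.

(** One inequality is the lower bound for the constant sequence; the other holds because
    [perimeter_upper] is valid at every scale, and is trivial for infinite perimeter since [omega]
    is positive. *)
Lemma limsup_equality (E : set L) : measurable E -> (leb E < +oo)%E ->
  L1_conv (fun=> E) E /\ (@omega_dm1 R d.+1 * Per E = limn_esup (J (fun=> E)))%E.
Proof.
move=> mE Eoo.
have cE : L1_conv (fun=> E) E.
  rewrite /L1_conv (_ : (fun n => _) = cst 0%E); first exact: cvg_cst.
  by apply/funext => n; apply: integral0_eq => x _; rewrite subrr normr0.
split => //; apply/eqP; rewrite eq_le; apply/andP; split.
  by apply: le_trans (limn_einf_sup _); apply: liminf_inequality.
have [B [EB _]] := @null_extension_exists _ _ E setT mE Eoo measurableT (fun _ _ => I).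
have [bB _ _] := EB; have Boo : (leb B < +oo)%E by rewrite (null_extension_leb EB).
have -> : J (fun=> E) = J (fun=> B).
  by apply/funext => n; rewrite (null_extension_Jt _ _ mE EB).
have om0 := @omega_gt0 R d.
rewrite -(null_extension_Per mE Eoo EB) omega_dm1E.
have := Per_ge0 B; case PB : (Per B) => [P| |] // P0; last by rewrite gt0_muley ?lte_fin// leey.
have k0 : 0 <= omega d / d.+2%:R * P by rewrite mulr_ge0// divr_ge0// ltW.
have := @gamma_upper R d.+1 r s r01 s1 r_cvg s_cvg B _ bB Boo k0.
rewrite -EFinM (_ : _ * P * d.+2%:R = omega d * P); last by field.
apply => t t0; apply: (le_trans (perimeter_upper d0 bB Boo t0)).
by rewrite PB -EFinM mulrAC.
Qed.

Lemma energy_bound_compactness (N M : R) (En : nat -> set L) : 0 < N ->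
  (forall n, measurable (En n)) -> (forall n, En n `<=` cube N) ->
  (forall n, (Jt (r n) (s n) (En n) <= (M * beta d.+1 (r n) (s n))%:E)%E) ->
  exists phi : nat -> nat, {homo phi : m n / (m < n)%N} /\
    exists E : set L, [/\ borel E, (leb E < +oo)%E & L1_conv (fun n => En (phi n)) E].
Proof.
move=> N0 mEn EN JM.
have cubeoo : (leb (cube N) < +oo)%E by exact: le_lt_trans (leb_box_le _ _) (ltry _).
have Enoo n : (leb (En n) < +oo)%E by apply: le_lt_trans cubeoo; exact: le_outer_measure.
have ext n : exists B : set L, null_extension (En n) B /\ B `<=` cube N.
  by apply: null_extension_exists => //; exact: borel_cube.
have [B BP] := choice ext.
have bB n : borel (B n) by have [[]] := BP n.
have b0 := beta_gt0 d.+1 r01 s1.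
have JB n : (Jt (r n) (s n) (B n) * ((beta d.+1 (r n) (s n))^-1)%:E <= M%:E)%E.
  rewrite (null_extension_Jt _ _ (mEn n) (BP n).1).
  by rewrite -lee_pdivlMr ?invr_gt0// invrK -EFinM.
(* Any fixed [e] serves here; with [e = 1/4] the energy bound gives the constant [|M| / a], where
   the absolute value ensures nonnegativity. *)
pose q : R := (1 - 4^-1) ^+ d.+3; have q0 : 0 < q by rewrite exprn_gt0//; lra.
pose a := q * d.+2%:R; have a0 : 0 < a by rewrite mulr_gt0.
have AB (t : R) : 0 < t <= 1 -> \forall n \near \oo, (A (B n) t <= (`|M| / a * t ^+ d.+2)%:E)%E.
  move=> t01; have /andP[t0 _] := t01.
  have e01 : 0 < (4^-1 : R) < 2^-1 by rewrite invr_gt0 ltr0n/= ltf_pV2 ?posrE// ltr_nat.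
  have := near_energy_lower d.+1 r01 s1 r_cvg s_cvg e01 t01.
  apply: filterS => n /(_ _ (bB n)) H.
  have tp : 0 < t ^+ d.+2 by rewrite exprn_gt0.
  have c0 : 0 < q * (d.+2%:R / t ^+ d.+2) by rewrite mulr_gt0// divr_gt0.
  have := le_trans H (JB n); rewrite -/q -lee_pdivlMl// -EFinM => /le_trans; apply.
  rewrite lee_fin (_ : _ * M = M / a * t ^+ d.+2); last first.
    by rewrite /a; move: (t ^+ d.+2) tp => u tp; field; rewrite !gt_eqF.
  by apply: ler_wpM2r; [rewrite exprn_ge0// ltW|apply: ler_wpM2r; [rewrite invr_ge0 ltW|exact: ler_norm]].
have K0 : 0 <= `|M| / a by rewrite divr_ge0// ltW.
have [phi [phi_incr [E [bE EP]]]] := energy_compactness N0 K0 bB (fun n => (BP n).2) AB.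
exists phi; split => //; exists E.
have mE : measurable (E : set L) by exact: borel_measurable.
split => //.
  apply: (@le_lt_trans _ _ (leb ((E `\` B (phi 0%N) `|` B (phi 0%N) `\` E) `|` cube N))).
    apply: le_outer_measure => x Ex; have [Bx|Bx] := pselect (B (phi 0%N) x).
      by right; exact: (BP (phi 0%N)).2.
    by left; left.
  apply: (le_lt_trans (outer_measureU2 _ _ _)); apply: lte_add_pinfty => //.
  exact: le_lt_trans (EP 0%N) (ltry _).
apply/(L1_convE mE (fun n => mEn (phi n))).
have EE : null_extension E E by split => //; rewrite setDv measure0.
apply: (@squeeze_cvge _ _ _ _ (fun=> 0%E) _ (fun n => ((2 ^ n)%:R^-1)%:E)).
- apply: nearW => n; rewrite symdiff_ge0/=.
  exact: le_trans (symdiff_null EE (BP (phi n)).1).2 (EP n).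
- exact: cvg_cst.
- apply: cvg_EFin; first exact: nearW.
  rewrite (_ : _ \o _ = fun n => (2^-1 : R) ^+ n).
    by apply: cvg_expr; rewrite ger0_norm// invf_lt1// ltr1n.
  by apply/funext => n; rewrite /= natrX exprVn.
Qed.

End main.


Lemma increasing_cvgny (phi : nat -> nat) : {homo phi : m n / (m < n)%N} -> phi @ \oo --> \oo.
Proof.
move=> incr; have le n : (n <= phi n)%N.
  by elim: n => // n IH; apply: leq_ltn_trans IH _; exact: incr.
by apply/cvgnyPge => k; exists k => // n /= kn; exact: leq_trans (le n).
Qed.

Theorem theorem5p1 (R : realType) (d : nat) (r s : nat -> R) :
  (2 <= d)%N ->
  (forall n, 0 < r n < 1) ->
  (forall n, 1 < s n) ->
  r @ \oo --> (0 : R) ->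
  s @ \oo --> (1 : R) ->
  [/\
   (* (i) compactness *)
   (forall (U : set 'rV[R]_d) (M : R) (En : nat -> set (LRd d)),
      open U -> bounded_set U ->
      (forall n, measurable (En n)) ->
      (forall n, En n `<=` U) ->
      (forall n, (Jt (r n) (s n) (En n) <= (M * beta d (r n) (s n))%:E)%E) ->
      exists phi : nat -> nat, {homo phi : m n / (m < n)%N} /\
        exists E : set (LRd d),
          [/\ measurable E, (leb E < +oo)%E, (Per E < +oo)%E &
              L1_conv (fun n => En (phi n)) E]),
   (* (ii) lower bound *)
   (forall (E : set (LRd d)) (En : nat -> set (LRd d)),
      measurable E -> (leb E < +oo)%E ->
      (forall n, measurable (En n) /\ (leb (En n) < +oo)%E) ->
      L1_conv En E ->
      (@omega_dm1 R d * Per E <=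
         limn_einf (fun n => Jt (r n) (s n) (En n) * ((beta d (r n) (s n))^-1)%:E))%E) &
   (* (iii) upper bound *)
   (forall E : set (LRd d),
      measurable E -> (leb E < +oo)%E ->
      exists En : nat -> set (LRd d),
        [/\ (forall n, measurable (En n) /\ (leb (En n) < +oo)%E),
            L1_conv En E &
            (@omega_dm1 R d * Per E =
               limn_esup (fun n => Jt (r n) (s n) (En n) * ((beta d (r n) (s n))^-1)%:E))%E])].
Proof.
(* The ambient dimension becomes [d.+1] with [0 < d], the form in which slices and [omega] are set
   up. *)
case: d => [|[|d']] // _ r01 s1 r_cvg s_cvg; set d := d'.+1; have d0 : (0 < d)%N by [].
split.
- move=> U M En _ [B [_ BP]] mEn EU JM.
  have N0 : 0 < `|B| + 2 by rewrite ltr_wpDl.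
  have EN n : En n `<=` cube (`|B| + 2).
    move=> x /EU Ux; apply: norm_cube; apply: (@le_lt_trans _ _ (`|B| + 1)).
      by apply: BP => //; rewrite (le_lt_trans (ler_norm _))// ltrDl.
    by rewrite ltrD2l ltr1n.
  have [phi [phi_incr [E [bE Eoo cE]]]] :=
    energy_bound_compactness r01 s1 r_cvg s_cvg N0 mEn EN JM.
  have mE : measurable (E : set (LRd _)) by exact: borel_measurable.
  exists phi; split => //; exists E; split => //.
  have phi_oo := increasing_cvgny phi_incr.
  have mEphi n : measurable (En (phi n)) /\ (leb (En (phi n)) < +oo)%E.
    split => //; apply: (@le_lt_trans _ _ (leb (cube (`|B| + 2) : set (LRd _)))).
      by apply: le_outer_measure; exact: EN.
    exact: le_lt_trans (leb_box_le _ _) (ltry _).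
  have r_phi : (r \o phi) @ \oo --> (0 : R) by exact: cvg_comp phi_oo r_cvg.
  have s_phi : (s \o phi) @ \oo --> (1 : R) by exact: cvg_comp phi_oo s_cvg.
  (* Finiteness of the perimeter comes from the lower bound along the extracted subsequence, whose
     normalised energies are at most [M]. *)
  have H := liminf_inequality d0 (fun n => r01 (phi n)) (fun n => s1 (phi n))
    r_phi s_phi mE Eoo mEphi cE.
  have : (@omega_dm1 R d.+1 * Per (E : set (LRd _)) <= M%:E)%E.
    apply: (le_trans H); apply: (le_trans (limn_einf_sup _)).
    apply: limn_esup_le_near; apply: nearW => n /=.
    have b0 := beta_gt0 d.+1 r01 s1 (phi n).
    by rewrite -lee_pdivlMr ?invr_gt0// invrK -EFinM; exact: JM.
  rewrite omega_dm1E; case: (Per _) => [P _| |//]; first exact: ltry.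
  by rewrite gt0_muley// lte_fin omega_gt0.
- move=> E En mE Eoo mEn cE; exact: liminf_inequality.
- move=> E mE Eoo; exists (fun=> E).
  have [cE eqE] := limsup_equality d0 r01 s1 r_cvg s_cvg mE Eoo.
  by split.
Qed.
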